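(* Assume $\|X\|/p\le\lambda\le 2\bar\lambda$ with $\bar\lambda=2\|X\|\sqrt{\log p}$, and that there are constants $A_1,A_2,A_3,A_4>0$ (not depending on $p$) such that $A_1p^{-A_3}\pi_p(s-1)\le\pi_p(s)\le A_2p^{-A_4}\pi_p(s-1)$ for $s=1,\dots,p$. Then for sufficiently large $M$, as $n,p\to\infty$, with $S_0=S_{\beta^0}$, \begin{align*} &\inf_{\beta^0}\mathbb E_{\beta^0}\Pi\Big(\beta:S_\beta\supset\Big\{i:|\beta^0_i|\ge\frac{M}{\bar\psi(S_0)^2}\frac{|S_0|\sqrt{\log p}}{\|X\|\phi(S_0)^2}\Big\}\ \Big|\ Y\Big)\to1,\\ &\inf_{\beta^0}\mathbb E_{\beta^0}\Pi\Big(\beta:S_\beta\supset\Big\{i:|\beta^0_i|\ge\frac{M}{\tilde\psi(S_0)^2}\frac{\sqrt{|S_0|\log p}}{\|X\|\phi(S_0)}\Big\}\ \Big|\ Y\Big)\to1. \end{align*} Furthermore, for every $c_0>0$, any $d_0\le c_0^2(1+2/A_4)^{-1}/8$ and any sequence $s_n$ with $\lambda s_n\sqrt{\log p}/\|X\|\to0$, for sufficiently large $M$, \[ \inf\ \mathbb E_{\beta^0}\Pi\Big(\beta:S_\beta\supset\Big\{i:|\beta^0_i|\ge\frac{M\sqrt{\log p}}{\|X\|}\Big\}\ \Big|\ Y\Big)\to1, \] the infimum being over all $\beta^0$ with $\phi(S_0)\ge c_0$, $\tilde\psi(S_0)\ge c_0$, $|S_0|\le s_n$ and $|S_0|\le 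d_0\,\mathrm{mc}(X)^{-1}$.
   Context: Observations follow $Y=X\beta+\varepsilon$ with $X$ a deterministic real $n\times p$ matrix and $\varepsilon\sim N_n(0,I_n)$. $\mathbb E_{\beta^0}$ denotes expectation when $Y\sim N_n(X\beta^0,I_n)$. $S_\beta=\{i:\beta_i\ne0\}$, $\beta_S=(\beta_i)_{i\in S}$, $\|X\|=\max_i\|X_{\cdot,i}\|_2$. Prior $\Pi$: draw $s\sim\pi_p$ on $\{0,\dots,p\}$, then $S$ uniform among subsets of size $s$, then $\beta_i$, $i\in S$, i.i.d. with density $\frac{\lambda}{2}e^{-\lambda|x|}$, $\beta_i=0$ for $i\notin S$. Posterior $\Pi(B\mid Y)=\int_Be^{-\|Y-X\beta\|_2^2/2}d\Pi(\beta)/\int e^{-\|Y-X\beta\|_2^2/2}d\Pi(\beta)$. $\phi(S)=\inf\{\|X\beta\|_2|S|^{1/2}/(\|X\|\|\beta_S\|_1):\|\beta_{S^c}\|_1\le7\|\beta_S\|_1,\beta_S\ne0\}$; $\bar\phi(s)=\inf\{\|X\beta\|_2|S_\beta|^{1/2}/(\|X\|\|\beta\|_1):0\ne|S_\beta|\le s\}$; $\tilde\phi(s)=\inf\{\|X\beta\|_2/(\|X\|\|\beta\|_2):0\ne|S_\beta|\le s\}$; $\bar\psi(S)=\bar\phi\big((2+\frac{3}{A_4}+\frac{33}{\phi(S)^2}\frac{\lambda}{\bar\lambda})|S|\big)$, $\tilde\psi(S)$ the same with $\tilde\phi$; $\mathrm{mc}(X)=\max_{i\ne j}|\langle X_{\cdot,i},X_{\cdot,j}\rangle|/(\|X_{\cdot,i}\|_2\|X_{\cdot,j}\|_2)$.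 Asymptotics: $n,p\to\infty$ with $X,\lambda,\pi_p$ depending on $n,p$ subject to the assumptions (constants $A_i$ fixed).
   Formalization: In the first two displays the set is restricted to i in S_0, since at β^0=0 the threshold is 0, the set is all indices and the claim fails; in the third, β^0=0 (where the set is empty) is left out of the infimum because φ(∅) is taken as 0. *)

(* Defs.v *)
From HB Require Import structures.
From mathcomp Require Import all_boot all_order all_algebra.
From mathcomp Require Import all_classical all_reals all_analysis.
Set Implicit Arguments. Unset Strict Implicit. Unset Printing Implicit Defensive.
Import Order.TTheory GRing.Theory Num.Theory.
Import numFieldNormedType.Exports.
Local Open Scope classical_set_scope.
Local Open Scope ring_scope.

Section Defs.
Variable R : realType.

Definition sqnorm (m : nat) (v : 'cV[R]_m) : R := \sum_i (v i ord0) ^+ 2.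
Definition norm2 (m : nat) (v : 'cV[R]_m) : R := Num.sqrt (sqnorm v).
Definition l1 (m : nat) (v : 'cV[R]_m) : R := \sum_i `|v i ord0|.
Definition l1_on (m : nat) (S : {set 'I_m}) (v : 'cV[R]_m) : R :=
  \sum_(i in S) `|v i ord0|.
Definition supp (m : nat) (v : 'cV[R]_m) : {set 'I_m} := [set i | v i ord0 != 0].

Definition colnorm (n p : nat) (X : 'M[R]_(n, p)) (j : 'I_p) : R := norm2 (col j X).
Definition normX (n p : nat) (X : 'M[R]_(n, p)) : R := \big[Num.max/0]_j colnorm X j.
Definition mc (n p : nat) (X : 'M[R]_(n, p)) : R :=
  \big[Num.max/0]_i \big[Num.max/0]_(j | j != i)
     (`|\sum_k X k i * X k j| / (colnorm X i * colnorm X j)).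
Definition lambdabar (n p : nat) (X : 'M[R]_(n, p)) : R :=
  2 * normX X * Num.sqrt (ln (p%:R)).

Definition phi_c (n p : nat) (X : 'M[R]_(n, p)) (S : {set 'I_p}) : R :=
  inf [set r | exists b : 'cV[R]_p,
        [/\ l1_on (~: S) b <= 7 * l1_on S b, [exists i in S, b i ord0 != 0] &
            r = norm2 (X *m b) * Num.sqrt (#|S|%:R) / (normX X * l1_on S b)]].

Definition phibar (n p : nat) (X : 'M[R]_(n, p)) (s : R) : R :=
  inf [set r | exists b : 'cV[R]_p,
        [/\ (0 < #|supp b|)%N, #|supp b|%:R <= s &
            r = norm2 (X *m b) * Num.sqrt (#|supp b|%:R) / (normX X * l1 b)]].

Definition phitilde (n p : nat) (X : 'M[R]_(n, p)) (s : R) : R :=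
  inf [set r | exists b : 'cV[R]_p,
        [/\ (0 < #|supp b|)%N, #|supp b|%:R <= s &
            r = norm2 (X *m b) / (normX X * norm2 b)]].

Definition psi_arg (A4 lam : R) (n p : nat) (X : 'M[R]_(n, p)) (S : {set 'I_p}) : R :=
  (2 + 3 / A4 + 33 / (phi_c X S) ^+ 2 * (lam / lambdabar X)) * #|S|%:R.
Definition psibar (A4 lam : R) (n p : nat) (X : 'M[R]_(n, p)) (S : {set 'I_p}) : R :=
  phibar X (psi_arg A4 lam X S).
Definition psitilde (A4 lam : R) (n p : nat) (X : 'M[R]_(n, p)) (S : {set 'I_p}) : R :=
  phitilde X (psi_arg A4 lam X S).

Definition upd (m : nat) (b : 'cV[R]_m) (i : 'I_m) (x : R) : 'cV[R]_m :=
  \col_k (if k == i then x else b k ord0).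

Fixpoint iint (m : nat) (l : seq 'I_m) (f : 'cV[R]_m -> \bar R) (b : 'cV[R]_m)
  : \bar R :=
  match l with
  | [::] => f b
  | i :: l' => (\int[@lebesgue_measure R]_(x in [set: R]) iint l' f (upd b i x))%E
  end.

Definition lap (lam x : R) : R := lam / 2 * expR (- (lam * `|x|)).
Definition lik (n p : nat) (X : 'M[R]_(n, p)) (Y : 'cV[R]_n) (b : 'cV[R]_p) : R :=
  expR (- (sqnorm (Y - X *m b) / 2)).

(* int_{ {b : P b} } exp(-||Y - X b||^2/2) dPi(b), where Pi draws s ~ pi, S uniform
   of size s, and b_S with i.i.d. Laplace(lam) coordinates, b_{S^c} = 0 *)
Definition post_num (pi : nat -> R) (lam : R) (n p : nat) (X : 'M[R]_(n, p))
  (Y : 'cV[R]_n) (P : 'cV[R]_p -> bool) : \bar R :=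
  (\sum_(S : {set 'I_p})
     (pi #|S| / ('C(p, #|S|))%:R)%:E *
     iint (enum S)
       (fun b => (if P b then lik X Y b * \prod_(i in S) lap lam (b i ord0) else 0)%:E)
       0)%E.

Definition posterior (pi : nat -> R) (lam : R) (n p : nat) (X : 'M[R]_(n, p))
  (Y : 'cV[R]_n) (P : 'cV[R]_p -> bool) : R :=
  fine (post_num pi lam X Y P) / fine (post_num pi lam X Y (fun _ => true)).

Definition gauss (n p : nat) (X : 'M[R]_(n, p)) (b0 : 'cV[R]_p) (y : 'cV[R]_n) : R :=
  (Num.sqrt (2 * pi))^-1 ^+ n * expR (- (sqnorm (y - X *m b0) / 2)).

Definition expect (n p : nat) (X : 'M[R]_(n, p)) (b0 : 'cV[R]_p) (f : 'cV[R]_n -> R) : R :=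
  fine (iint (enum 'I_n) (fun y => (f y * gauss X b0 y)%:E) 0).

(* ---------- selection sets (thresholds, with "a/0 = +oo" cleared) ---------- *)
Definition sel1 (M A4 lam : R) (n p : nat) (X : 'M[R]_(n, p)) (b0 : 'cV[R]_p) : {set 'I_p} :=
  [set i in supp b0 | M * #|supp b0|%:R * Num.sqrt (ln p%:R) <=
      `|b0 i ord0| * (psibar A4 lam X (supp b0) ^+ 2 * normX X * phi_c X (supp b0) ^+ 2)].
Definition sel2 (M A4 lam : R) (n p : nat) (X : 'M[R]_(n, p)) (b0 : 'cV[R]_p) : {set 'I_p} :=
  [set i in supp b0 | M * Num.sqrt (#|supp b0|%:R * ln p%:R) <=
      `|b0 i ord0| * (psitilde A4 lam X (supp b0) ^+ 2 * normX X * phi_c X (supp b0))].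
Definition sel3 (M : R) (n p : nat) (X : 'M[R]_(n, p)) (b0 : 'cV[R]_p) : {set 'I_p} :=
  [set i | M * Num.sqrt (ln p%:R) / normX X <= `|b0 i ord0|].

(* inf_{b0 in A k} E k b0 -> 1 as k -> oo  (the quantities E are <= 1) *)
Definition inf_to_one (p : nat -> nat) (E : forall k, 'cV[R]_(p k) -> R)
  (A : forall k, set 'cV[R]_(p k)) : Prop :=
  forall e : R, 0 < e -> \forall k \near \oo, forall b0, A k b0 -> 1 - e <= E k b0.

End Defs.

(* Main.v *)
(** Write W = Y - X b0, L = log p, S0 = supp b0, d = b - b0. Integrating over
    a small box around h in the slab of a model U shows that the evidence of U at W, divided by
    exp(-|W|^2/2), is at least exp(<W,Xh> - |Xh|^2/2 - lam |h|_1) up to a factor p^(-3|U|). This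
    quotient has mean one, so by Markov's inequality, with probability at least 1 - 1/p,
    <W,Xh> - |Xh|^2/2 <= lam |h|_1 + 6 |U| L for all U and all h supported in U.
    Only a small fraction al of <W,Xd> is bounded in this way; the remaining exponential
    exp((1-al) <W,Xd> - (1-al)^2 |Xd|^2/2) has mean one and leaves a reserve -al |Xd|^2/2.
    The posterior mass of a set of vectors is therefore negligible as soon as, on it, the reserve and
    the Laplace prior pay for 12 al (|S| + |S0|) L (the predicate [covered]). This happens when
    d is outside the cone |d_(S0^c)|_1 <= 7 |d_(S0)|_1 and S is large or |Xd| is large, and when d is
    in the cone and |Xd| is large or, for small lam, S is large. Missing a coordinate above the
    thresholds of the first two claims forces |Xd| to be large, by the compatibility constants.
    For the third claim, an uncovered b has |X| |d|_1 = O(|S0| sqrt L); by the coherence bound the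
    other coordinates then barely disturb the regression on a missed X_i, and the integral over the
    model S + i beats the one over S by a power of p as large as needed. *)
Require Import Defs.
From HB Require Import structures.
From mathcomp Require Import all_boot all_order all_algebra.
From mathcomp Require Import all_classical all_reals all_analysis.
From mathcomp Require Import measurable_realfun ring lra.
Set Implicit Arguments. Unset Strict Implicit. Unset Printing Implicit Defensive.
Import Order.TTheory GRing.Theory Num.Theory.
Import numFieldNormedType.Exports.
Local Open Scope classical_set_scope.
Local Open Scope ring_scope.

(** * Iterated integrals *)

(** Hence the whole noise term cannot be bounded uniformly; only a fraction al, a small multiple of
    min(A4, 1), is. The rest is never bounded pointwise: for each fixed b it is an exponential of
    mean one, so integrating it over the slab against Laplace factors of the smaller rate lam/4
    gives mean 4^|S|, and the continuum of vectors b costs nothing more. All the probabilistic input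
    is thus mean-one identities and Tonelli's theorem, without Gaussian tail bounds; even the
    failure of the noise event enters as a sum of normalised evidences. The denominator of the
    posterior is bounded below by the true model alone, through a box around b0. *)

Section Iint.
Variable R : realType.
Local Open Scope ereal_scope.
Notation mu := (@lebesgue_measure R).

(** The integral of a nonnegative function is a supremum over the simple functions below it, and
    this supremum is monotone even for nonmeasurable functions. *)
Lemma le_integralT (f g : R -> \bar R) : (forall x, 0 <= f x) -> (forall x, f x <= g x) ->
  \int[mu]_x f x <= \int[mu]_x g x.
Proof.
move=> f0 fg; have g0 x : 0 <= g x by exact: le_trans (fg x).
rewrite !ge0_integralTE//; apply: ereal_sup_le => _ [h hf <-].
by exists h => // x; exact: le_trans (fg x).
Qed.

Definition cmeas d (T : measurableType d) m (g : T -> 'cV[R]_m) :=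
  forall i, measurable_fun [set: T] (fun t => g t i ord0).

(** Measurability is tested along all coordinatewise measurable maps into the vectors, so no
    sigma-algebra on column vectors has to be fixed, and composition is immediate. *)
Definition mf1 m (F : 'cV[R]_m -> \bar R) :=
  forall d (T : measurableType d) (h : T -> 'cV[R]_m), cmeas h ->
    measurable_fun [set: T] (F \o h).

Definition mf2 n m (F : 'cV[R]_n -> 'cV[R]_m -> \bar R) :=
  forall d (T : measurableType d) (g : T -> 'cV[R]_n) (h : T -> 'cV[R]_m),
    cmeas g -> cmeas h -> measurable_fun [set: T] (fun t => F (g t) (h t)).

Lemma cmeas_cst d (T : measurableType d) m (b : 'cV[R]_m) : cmeas (fun _ : T => b).
Proof. by move=> i; exact: measurable_cst. Qed.

Lemma cmeas_upd d (T : measurableType d) m (h : T -> 'cV[R]_m) (x : T -> R) i :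
  cmeas h -> measurable_fun [set: T] x -> cmeas (fun t => upd (h t) i (x t)).
Proof.
move=> ch mx k; have [ki|ki] := eqVneq k i.
  by under eq_fun do rewrite mxE ki eqxx.
by under eq_fun do rewrite mxE (negbTE ki); exact: ch.
Qed.

Lemma mf2C n m (F : 'cV[R]_n -> 'cV[R]_m -> \bar R) : mf2 F -> mf2 (fun b y => F y b).
Proof. by move=> mF d T g h cg ch; exact: mF. Qed.

Lemma mf2_1r n m (F : 'cV[R]_n -> 'cV[R]_m -> \bar R) y : mf2 F -> mf1 (F y).
Proof. by move=> mF d T h ch; apply: mF => //; exact: cmeas_cst. Qed.

Lemma mf2_1l n m (F : 'cV[R]_n -> 'cV[R]_m -> \bar R) b : mf2 F -> mf1 (F^~ b).
Proof. by move=> mF; exact: (mf2_1r b (mf2C mF)). Qed.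

Lemma mf1_2 n m (F : 'cV[R]_m -> \bar R) : mf1 F -> mf2 (fun (_ : 'cV[R]_n) b => F b).
Proof. by move=> mF d T g h cg ch; exact: mF. Qed.

Lemma mf1_upd m (F : 'cV[R]_m -> \bar R) b i : mf1 F ->
  measurable_fun [set: R] (fun x => F (upd b i x)).
Proof.
move=> mF; apply: mF; apply: cmeas_upd; first exact: cmeas_cst.
exact: measurable_id.
Qed.

Lemma iint_ge0 m l (F : 'cV[R]_m -> \bar R) b : (forall b, 0 <= F b) -> 0 <= iint l F b.
Proof.
move=> F0; elim: l b => [|i l IH] b //=.
by apply: integral_ge0 => x _; exact: IH.
Qed.

(** Each integration enlarges the parameter space from T to T * R and applies Tonelli's theorem
    there; this is why measurability quantifies over all T. *)
Lemma iint_mf2 n m l (F : 'cV[R]_n -> 'cV[R]_m -> \bar R) :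
  (forall y b, 0 <= F y b) -> mf2 F -> mf2 (fun y b => iint l (F y) b).
Proof.
move=> F0 mF; elim: l => [|i l IH] //= d T g h cg ch.
pose f (z : T * R) := iint l (F (g z.1)) (upd (h z.1) i z.2).
have mf : measurable_fun setT f.
  apply: IH; first by move=> k; apply: (measurableT_comp (cg k)); exact: measurable_fst.
  apply: cmeas_upd; first by move=> k; apply: (measurableT_comp (ch k)); exact: measurable_fst.
  exact: measurable_snd.
have f0 z : 0 <= f z by exact: iint_ge0.
have := @measurable_fun_fubini_tonelli_F _ _ T _ R (@lebesgue_measure R) f mf f0. by [].
Qed.

Lemma iint_mf1 m l (F : 'cV[R]_m -> \bar R) :
  (forall b, 0 <= F b) -> mf1 F -> mf1 (iint l F).
Proof.
move=> F0 mF.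
exact: (mf2_1r (0%R : 'cV[R]_0) (iint_mf2 l (fun _ => F0) (mf1_2 mF))).
Qed.

(* Only vectors that agree with the base point off the list are evaluated. *)
Lemma le_iint m l (F G : 'cV[R]_m -> \bar R) (b : 'cV[R]_m) :
  (forall b' : 'cV[R]_m, (forall i, i \notin l -> b' i ord0 = b i ord0) -> 0 <= F b' <= G b') ->
  iint l F b <= iint l G b.
Proof.
suff : (forall b' : 'cV[R]_m, (forall i, i \notin l -> b' i ord0 = b i ord0) -> 0 <= F b' <= G b') ->
  0 <= iint l F b /\ iint l F b <= iint l G b by move=> H /H[].
elim: l b => [|i l IH] b H /=.
  by have /andP[] := H b (fun _ _ => erefl).
have {}IH x : 0 <= iint l F (upd b i x) /\ iint l F (upd b i x) <= iint l G (upd b i x).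
  apply: IH => b' Hb'; apply: H => k; rewrite inE negb_or => /andP[ki kl].
  by rewrite Hb'// mxE (negbTE ki).
split; first by apply: integral_ge0 => x _; exact: (IH x).1.
by apply: le_integralT => x; [exact: (IH x).1|exact: (IH x).2].
Qed.

Lemma eq_iint m l (F G : 'cV[R]_m -> \bar R) (b : 'cV[R]_m) :
  (forall b' : 'cV[R]_m, (forall i, i \notin l -> b' i ord0 = b i ord0) -> F b' = G b') ->
  iint l F b = iint l G b.
Proof.
elim: l b => [|i l IH] b H /=; first exact: H.
apply: eq_integral => x _; apply: IH => b' Hb'; apply: H => k.
rewrite inE negb_or => /andP[ki kl].
by rewrite Hb'// mxE (negbTE ki).
Qed.

Lemma iintZ m l (F : 'cV[R]_m -> \bar R) b c : (0 <= c)%R ->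
  (forall b, 0 <= F b) -> mf1 F -> iint l (fun b => c%:E * F b) b = c%:E * iint l F b.
Proof.
move=> c0 F0 mF; elim: l b => [|i l IH] b //=.
under eq_integral do rewrite IH.
rewrite ge0_integralZl//; first by apply: mf1_upd; exact: iint_mf1.
by move=> x _; exact: iint_ge0.
Qed.

Lemma iintD m l (F G : 'cV[R]_m -> \bar R) (b : 'cV[R]_m) :
  (forall b, 0 <= F b) -> mf1 F -> (forall b, 0 <= G b) -> mf1 G ->
  iint l (fun b => F b + G b) b = iint l F b + iint l G b.
Proof.
move=> F0 mF G0 mG; elim: l b => [|i l IH] b //=.
under eq_integral do rewrite IH.
by rewrite ge0_integralD//;
  [move=> x _; exact: iint_ge0|by apply: mf1_upd; exact: iint_mf1|
   move=> x _; exact: iint_ge0|by apply: mf1_upd; exact: iint_mf1].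
Qed.

Lemma iint0 m l (b : 'cV[R]_m) : iint l (fun=> 0) b = 0.
Proof.
elim: l b => [|i l IH] b //=.
by under eq_integral do rewrite IH; exact: integral0.
Qed.

Lemma mf1_sum m (I : Type) (s : seq I) (P : pred I) (F : I -> 'cV[R]_m -> \bar R) :
  (forall i, P i -> mf1 (F i)) -> mf1 (fun b => \sum_(i <- s | P i) F i b).
Proof.
move=> mF d T h ch.
rewrite (_ : _ \o h = fun t => \sum_(i <- s) (if P i then F i (h t) else 0)); last first.
  by apply/funext => t /=; rewrite big_mkcond.
apply: emeasurable_sum => i; have [Pi|_] := boolP (P i); last exact: measurable_cst.
exact: mF.
Qed.

Lemma iint_sum m l (I : Type) (s : seq I) (P : pred I) (F : I -> 'cV[R]_m -> \bar R) b :
  (forall i b, P i -> 0 <= F i b) -> (forall i, P i -> mf1 (F i)) ->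
  iint l (fun b => \sum_(i <- s | P i) F i b) b = \sum_(i <- s | P i) iint l (F i) b.
Proof.
move=> F0 mF; elim: s => [|i s IH].
  rewrite big_nil; transitivity (iint l (fun=> 0) b); last exact: iint0.
  by apply: eq_iint => b' _; rewrite big_nil.
rewrite big_cons -IH; case: ifPn => Pi; last first.
  by apply: eq_iint => b' _; rewrite big_cons (negbTE Pi).
rewrite -iintD//; last 3 first.
- exact: mF.
- by move=> b'; apply: sume_ge0 => j; exact: F0.
- exact: mf1_sum.
- by apply: eq_iint => b' _; rewrite big_cons Pi.
- by move=> b'; exact: F0.
Qed.

Lemma iintC n m l l' (F : 'cV[R]_n -> 'cV[R]_m -> \bar R) y b :
  (forall y b, 0 <= F y b) -> mf2 F ->
  iint l (fun y => iint l' (F y) b) y = iint l' (fun b => iint l (F^~ b) y) b.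
Proof.
move=> F0 mF; elim: l y => [|i l IH] y //=.
under eq_integral do rewrite IH.
have {IH} : mf2 (fun y b => iint l (F^~ b) y).
  apply/mf2C; apply: (iint_mf2 l (F := fun b y => F y b)) => //; exact: mf2C.
have : forall y b, 0 <= iint l (F^~ b) y by move=> *; exact: iint_ge0.
set G := fun y b => iint l (F^~ b) y => G0 mG.
change (\int[mu]_x iint l' (G (upd y i x)) b = iint l' (fun b => \int[mu]_x G (upd y i x) b) b).
elim: l' b => [|j l' IH] b //=.
transitivity (\int[mu]_z \int[mu]_x iint l' (G (upd y i x)) (upd b j z)); last first.
  by apply: eq_integral => z _; exact: IH.
pose f (z : R * R) := iint l' (G (upd y i z.1)) (upd b j z.2).
have mf : measurable_fun setT f.
  apply: (iint_mf2 l' G0 mG).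
    by apply: cmeas_upd; [exact: cmeas_cst|exact: measurable_fst].
  by apply: cmeas_upd; [exact: cmeas_cst|exact: measurable_snd].
have f0 z : 0 <= f z by apply: iint_ge0 => b1; exact: G0.
exact: (@fubini_tonelli _ _ _ _ R (@lebesgue_measure R) (@lebesgue_measure R) f mf f0).
Qed.

Lemma iint_prod m l (f : 'I_m -> R -> R) (v : 'I_m -> R) b : uniq l ->
  (forall i x, (0 <= f i x)%R) -> (forall i, measurable_fun [set: R] (f i)) ->
  (forall i, \int[mu]_x (f i x)%:E = (v i)%:E) ->
  iint l (fun b => (\prod_(i <- l) f i (b i ord0))%:E) b = (\prod_(i <- l) v i)%:E.
Proof.
move=> ul f0 mf iv; elim: l ul b => [|i l IH] /= ul b; first by rewrite !big_nil.
case/andP: ul => il ul.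
rewrite big_cons EFinM -iv.
have v0 : (0 <= \prod_(i <- l) v i)%R.
  apply: prodr_ge0 => j _; rewrite -lee_fin -iv; apply: integral_ge0 => x _.
  by rewrite lee_fin.
have mfi : measurable_fun [set: R] (fun x => (f i x)%:E).
  by apply/measurable_EFinP; exact: mf.
have fi0 x : [set: R] x -> 0 <= (f i x)%:E by move=> _; rewrite lee_fin.
rewrite muleC -(ge0_integralZl mu measurableT mfi fi0) ?lee_fin//.
apply: eq_integral => x _.
transitivity (iint l (fun b => (f i x)%:E * (\prod_(i <- l) f i (b i ord0))%:E) (upd b i x)).
  apply: eq_iint => b' Hb'; rewrite big_cons EFinM; congr (_%:E * _).
  by rewrite Hb'// mxE eqxx.
rewrite iintZ//.
- by rewrite IH// muleC.
- by move=> b'; rewrite lee_fin; apply: prodr_ge0 => j _.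
- move=> d T h ch; apply/measurable_EFinP; apply: measurable_prod => j _.
  exact: (measurableT_comp (mf j)).
Qed.

(** Coordinate hyperplanes are null sets. This identifies the support of b with S almost everywhere
    in the slab of S. *)
Lemma iint_ae m l (F G : 'cV[R]_m -> \bar R) (b : 'cV[R]_m) :
  (forall b, 0 <= F b) -> mf1 F -> (forall b, 0 <= G b) -> mf1 G ->
  uniq l ->
  (forall b' : 'cV[R]_m, (forall i, i \notin l -> b' i ord0 = b i ord0) ->
     (forall i, i \in l -> b' i ord0 != 0)%R -> F b' = G b') ->
  iint l F b = iint l G b.
Proof.
move=> F0 mF G0 mG; elim: l b => [|i l IH] b /= ul H; first exact: H.
case/andP: ul => il ul.
apply: ge0_ae_eq_integral => //.
- by apply: mf1_upd; exact: iint_mf1.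
- by apply: mf1_upd; exact: iint_mf1.
- by move=> x _; exact: iint_ge0.
- by move=> x _; exact: iint_ge0.
exists [set 0%R]; split; first exact: measurable_set1.
  exact: lebesgue_measure_set1.
move=> x /= /not_implyP[_]; apply: contra_notP => /eqP x0; apply: IH => // b' Hb' nz.
apply: H => k; rewrite inE.
  by rewrite negb_or => /andP[ki kl]; rewrite Hb'// mxE (negbTE ki).
have [->|ki] /= := eqVneq k i; last exact: nz.
by rewrite Hb'// mxE eqxx.
Qed.

End Iint.

(** * Laplace and Gaussian integrals in one variable *)

Section OneDim.
Variable R : realType.
Notation mu := (@lebesgue_measure R).

Lemma continuous_lap (lam c : R) : continuous (fun x => lap lam (x - c)).
Proof.
move=> x; rewrite /lap.
apply: (@continuousM _ R^o (fun=> lam / 2) (fun x => expR (- (lam * `|x - c|)))).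
  exact: cst_continuous.
apply: continuous_comp; last exact: continuous_expR.
apply: (@continuousN _ R^o).
apply: (@continuousM _ R^o (fun=> lam) (fun x => `|x - c|)); first exact: cst_continuous.
apply: (@continuous_comp _ _ _ (fun x : R => x - c) (fun y : R => `|y|)); last exact: norm_continuous.
by apply: (@continuousB _ R^o _ id (fun=> c)); [exact: cvg_id|exact: cst_continuous].
Qed.

Lemma continuous_lap0 (lam : R) : continuous (lap lam).
Proof.
rewrite (_ : lap lam = fun x => lap lam (x - 0)); first exact: continuous_lap.
by apply/funext => x; rewrite subr0.
Qed.

Lemma lap_ge0 (lam x : R) : 0 < lam -> 0 <= lap lam x.
Proof. by move=> l0; rewrite mulr_ge0 ?expR_ge0 ?divr_ge0 ?ltW. Qed.

Lemma measurable_lap (lam c : R) : measurable_fun [set: R] (fun x => lap lam (x - c)).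
Proof. by apply: continuous_measurable_fun; exact: continuous_lap. Qed.

(** By symmetry the integral is twice that over the half-line, where twice the Laplace density is
    the exponential density. *)
Lemma integral_lap0 (lam : R) : 0 < lam -> (\int[mu]_x (lap lam x)%:E = 1)%E.
Proof.
move=> l0; rewrite ge0_symfun_integralT.
- rewrite -(integral_exponential_pdf l0) -(setUv `[0, +oo[%classic) ge0_integral_setU//=; last 4 first.
  + exact: measurableC.
  + by apply/measurable_EFinP; rewrite setUv; exact: measurable_exponential_pdf.
  + by move=> x _; rewrite lee_fin exponential_pdf_ge0// ltW.
  + exact/disj_setPCl.
  rewrite [X in (_ + X)%E]integral0_eq ?adde0; last first.
    by move=> x x0; rewrite /exponential_pdf patchE ifF// memNset.
  have ml : measurable_fun (`[0, +oo[%classic : set R) (fun x => (lap lam x)%:E).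
    apply/measurable_EFinP; apply: measurable_funTS.
    by apply: continuous_measurable_fun; exact: continuous_lap0.
  have ml0 x : (`[0, +oo[%classic : set R) x -> (0 <= (lap lam x)%:E)%E.
    by move=> _; rewrite lee_fin lap_ge0.
  rewrite -set_itvcy -(ge0_integralZl mu (measurable_itv _) ml ml0) ?lee_fin//.
  apply: eq_integral => x; rewrite inE/= in_itv/= andbT => x0.
  rewrite exponential_pdfE// /lap ger0_norm// -EFinM; congr (_%:E).
  by rewrite mulNr; field.
- by move=> x; exact: lap_ge0.
- exact: continuous_lap0.
- by move=> x; rewrite /= /lap normrN.
Qed.

Lemma integral_lap (lam c : R) : 0 < lam -> (\int[mu]_x (lap lam (x - c))%:E = 1)%E.
Proof.
move=> l0; rewrite -(integral_lap0 l0).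
have dF (x : R) : is_derive x (1 : R) (fun x => x - c) 1.
  by apply: is_derive_eq; rewrite subr0.
have FE : (fun x : R => x - c)^`()%classic = fun=> 1.
  by apply/funext => x; rewrite derive1E; case: (dF x).
rewrite (@increasing_ge0_integration_by_substitutionT _ (fun x => x - c) (lap lam)).
- by rewrite FE; apply: eq_integral => x _; rewrite /= mulr1.
- by move=> x y xy; rewrite ltrD2r.
- by rewrite FE; exact: cst_continuous.
- by rewrite FE; apply: (@is_cvg_cst R^o).
- by rewrite FE; apply: (@is_cvg_cst R^o).
- by move=> x; case: (dF x).
- apply/cvgrNyPle => A; near=> x; rewrite lerBlDr.
  by near: x; apply: nbhs_ninfty_le; exact: num_real.
- apply/cvgryPge => A; near=> x; rewrite lerBrDr.
  by near: x; apply: nbhs_pinfty_ge; exact: num_real.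
- exact: continuous_lap0.
- by move=> x; exact: lap_ge0.
Unshelve. all: end_near. Qed.

(** Completing the square: the tilted integrand is e^(v^2/2) times the normal density with mean m +
    v. *)
Lemma integral_gauss_mgf (m v : R) :
  (\int[mu]_x ((Num.sqrt (2 * pi))^-1 * (expR (- ((x - m) ^+ 2 / 2)) * expR ((x - m) * v)))%:E
   = (expR (v ^+ 2 / 2))%:E)%E.
Proof.
have e x : (Num.sqrt (2 * pi))^-1 * (expR (- ((x - m) ^+ 2 / 2)) * expR ((x - m) * v)) =
   expR (v ^+ 2 / 2) * normal_pdf (m + v) 1 x.
  rewrite normal_pdfE ?oner_eq0// /normal_peak /normal_fun expr1n mul1r.
  rewrite [RHS]mulrCA -!expRD; congr (_ * expR _); [congr (Num.sqrt _)^-1; ring|by field].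
under eq_integral do rewrite e EFinM.
rewrite ge0_integralZl//.
- by rewrite integral_normal_pdf mule1.
- by apply/measurable_EFinP; exact: measurable_normal_pdf.
- by move=> x _; rewrite lee_fin normal_pdf_ge0.
Qed.

End OneDim.

(** * Gaussian likelihoods *)

Section LinAlg.
Variable R : realType.

Definition dot n (v w : 'cV[R]_n) : R := \sum_i v i ord0 * w i ord0.

Lemma sqnorm_ge0 n (v : 'cV[R]_n) : 0 <= sqnorm v.
Proof. by apply: sumr_ge0 => i _; exact: sqr_ge0. Qed.

Lemma sqnormB n (v w : 'cV[R]_n) : sqnorm (v - w) = sqnorm v - 2 * dot v w + sqnorm w.
Proof.
rewrite /sqnorm /dot mulr_sumr -sumrB -big_split; apply: eq_bigr => i _ /=.
by rewrite !mxE; ring.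
Qed.

Lemma sqnormZ n a (v : 'cV[R]_n) : sqnorm (a *: v) = a ^+ 2 * sqnorm v.
Proof. by rewrite /sqnorm mulr_sumr; apply: eq_bigr => i _; rewrite mxE exprMn. Qed.

Lemma sqnorm_norm2 n (v : 'cV[R]_n) : norm2 v ^+ 2 = sqnorm v.
Proof. by rewrite sqr_sqrtr// sqnorm_ge0. Qed.

Lemma norm2_ge0 n (v : 'cV[R]_n) : 0 <= norm2 v.
Proof. exact: sqrtr_ge0. Qed.

Lemma dotZr n a (v w : 'cV[R]_n) : dot v (a *: w) = a * dot v w.
Proof. by rewrite /dot mulr_sumr; apply: eq_bigr => i _; rewrite mxE mulrCA. Qed.

Lemma dotBl n (u v w : 'cV[R]_n) : dot (u - v) w = dot u w - dot v w.
Proof. by rewrite /dot -sumrB; apply: eq_bigr => i _; rewrite !mxE mulrBl. Qed.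

Lemma dotC n (u v : 'cV[R]_n) : dot u v = dot v u.
Proof. by apply: eq_bigr => i _; rewrite mulrC. Qed.

Lemma dot_mulmxr n p (X : 'M[R]_(n, p)) (w : 'cV[R]_n) (h : 'cV[R]_p) :
  dot w (X *m h) = \sum_j h j ord0 * dot w (col j X).
Proof.
rewrite /dot; under eq_bigr do rewrite mxE mulr_sumr.
rewrite exchange_big; apply: eq_bigr => j _; rewrite mulr_sumr.
by apply: eq_bigr => i _; rewrite mxE; ring.
Qed.

Lemma lik_sub n p (X : 'M[R]_(n, p)) (Y : 'cV[R]_n) (b0 b : 'cV[R]_p) :
  lik X Y b = lik X (Y - X *m b0) (b - b0).
Proof.
by rewrite /lik mulmxBr opprB addrA subrK.
Qed.

Lemma lik_dot n p (X : 'M[R]_(n, p)) (W : 'cV[R]_n) (h : 'cV[R]_p) :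
  lik X W h = lik X W 0 * expR (dot W (X *m h) - sqnorm (X *m h) / 2).
Proof.
rewrite /lik mulmx0 subr0 -expRD sqnormB; congr expR; by field.
Qed.

Lemma lik_gt0 n p (X : 'M[R]_(n, p)) (W : 'cV[R]_n) (h : 'cV[R]_p) : 0 < lik X W h.
Proof. exact: expR_gt0. Qed.

Lemma lik_le1 n p (X : 'M[R]_(n, p)) (W : 'cV[R]_n) (h : 'cV[R]_p) : lik X W h <= 1.
Proof. by rewrite -expR0 ler_expR oppr_le0 divr_ge0// sqnorm_ge0. Qed.

Section Meas.
Context d (T : measurableType d).

Lemma cmeasB m (g h : T -> 'cV[R]_m) : cmeas g -> cmeas h -> cmeas (fun t => g t - h t).
Proof.
move=> cg ch i; under eq_fun do rewrite !mxE.
exact: (measurable_funB (cg i) (ch i)).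
Qed.

Lemma cmeasZ m a (h : T -> 'cV[R]_m) : cmeas h -> cmeas (fun t => a *: h t).
Proof.
move=> ch i; under eq_fun do rewrite !mxE.
exact: (measurable_funM (measurable_cst a) (ch i)).
Qed.

Lemma cmeas_mulmx n p (X : 'M[R]_(n, p)) (h : T -> 'cV[R]_p) :
  cmeas h -> cmeas (fun t => X *m h t).
Proof.
move=> ch i; under eq_fun do rewrite !mxE.
apply: measurable_sum => j.
exact: (measurable_funM (measurable_cst _) (ch j)).
Qed.

Lemma measurable_dot m (g h : T -> 'cV[R]_m) : cmeas g -> cmeas h ->
  measurable_fun [set: T] (fun t => dot (g t) (h t)).
Proof.
move=> cg ch; apply: measurable_sum => j; exact: (measurable_funM (cg j) (ch j)).
Qed.

Lemma measurable_sqnorm m (h : T -> 'cV[R]_m) : cmeas h ->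
  measurable_fun [set: T] (fun t => sqnorm (h t)).
Proof.
move=> ch; apply: measurable_sum => j; exact: (measurable_funX 2 (ch j)).
Qed.

Lemma measurable_lik n p (X : 'M[R]_(n, p)) (g : T -> 'cV[R]_n) (h : T -> 'cV[R]_p) :
  cmeas g -> cmeas h -> measurable_fun [set: T] (fun t => lik X (g t) (h t)).
Proof.
move=> cg ch; apply: measurableT_comp; first exact: measurable_expR.
apply: measurableT_comp; first exact: oppr_measurable.
apply: measurable_funM; last exact: measurable_cst.
by apply: measurable_sqnorm; apply: cmeasB => //; exact: cmeas_mulmx.
Qed.

Lemma measurable_gauss n p (X : 'M[R]_(n, p)) (b0 : 'cV[R]_p) (g : T -> 'cV[R]_n) :
  cmeas g -> measurable_fun [set: T] (fun t => gauss X b0 (g t)).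
Proof.
move=> cg; apply: measurable_funM; first exact: measurable_cst.
by apply: (@measurable_lik n p X g (fun=> b0)) => //; exact: cmeas_cst.
Qed.

Lemma measurable_coord_prod m (l : seq 'I_m) (f : 'I_m -> R -> R) (h : T -> 'cV[R]_m) :
  cmeas h -> (forall i, measurable_fun [set: R] (f i)) ->
  measurable_fun [set: T] (fun t => \prod_(i <- l) f i (h t i ord0)).
Proof.
move=> ch mf; apply: measurable_prod => j _.
exact: (measurableT_comp (mf j) (ch j)).
Qed.

End Meas.

Lemma gauss_ge0 n p (X : 'M[R]_(n, p)) (b0 : 'cV[R]_p) y : 0 <= gauss X b0 y.
Proof. by rewrite mulr_ge0 ?expR_ge0// exprn_ge0// invr_ge0 sqrtr_ge0. Qed.

Lemma gauss_mgf n p (X : 'M[R]_(n, p)) (b0 : 'cV[R]_p) (v : 'cV[R]_n) y0 :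
  iint (enum 'I_n) (fun y => (expR (dot (y - X *m b0) v) * gauss X b0 y)%:E) y0 =
  (expR (sqnorm v / 2))%:E.
Proof.
set c := X *m b0.
pose f (i : 'I_n) (x : R) := (Num.sqrt (2 * pi))^-1 * (expR (- ((x - c i ord0) ^+ 2 / 2)) *
      expR ((x - c i ord0) * v i ord0)).
transitivity (iint (enum 'I_n) (fun y => (\prod_(i <- enum 'I_n) f i (y i ord0))%:E) y0).
  apply: eq_iint => y _; congr (_%:E).
  rewrite big_split/= big_split/= -!expR_sum /gauss mulrCA -!expRD.
  rewrite big_enum_cond/= prodr_const card_ord !big_enum/= sumrN.
  congr (_ * _); rewrite addrC; congr expR; congr (_ + _).
    by rewrite -mulr_suml; congr (- (_ / _)); apply: eq_bigr => i _; rewrite !mxE.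
  by apply: eq_bigr => i _; rewrite !mxE.
rewrite (@iint_prod _ _ _ f (fun i => expR (v i ord0 ^+ 2 / 2))).
- by rewrite -expR_sum big_enum/= -mulr_suml.
- exact: enum_uniq.
- by move=> i x; rewrite !mulr_ge0 ?expR_ge0// invr_ge0 sqrtr_ge0.
- move=> i; apply: measurable_funM; first exact: measurable_cst.
  apply: measurable_funM.
    apply: measurableT_comp; first exact: measurable_expR.
    apply: measurableT_comp; first exact: oppr_measurable.
    apply: measurable_funM; last exact: measurable_cst.
    exact/measurable_funX/measurable_funB.
  apply: measurableT_comp; first exact: measurable_expR.
  by apply: measurable_funM; [exact: measurable_funB|exact: measurable_cst].
- by move=> i; exact: integral_gauss_mgf.
Qed.

(* The Gaussian exponential martingale has mean one for every shift [v b]; averaging it over [b]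
   preserves the total mass. *)
Lemma expect_mixture n p q (X : 'M[R]_(n, p)) (b0 : 'cV[R]_p) (l : seq 'I_q)
    (v : 'cV[R]_q -> 'cV[R]_n) (f : 'I_q -> R -> R) (c : 'I_q -> R) y0 b :
  (forall d (T : measurableType d) (h : T -> 'cV[R]_q), cmeas h -> cmeas (v \o h)) ->
  uniq l -> (forall i x, 0 <= f i x) -> (forall i, measurable_fun [set: R] (f i)) ->
  (forall i, (\int[@lebesgue_measure R]_x (f i x)%:E = (c i)%:E)%E) ->
  (iint (enum 'I_n) (fun y => iint l (fun b =>
     (expR (dot (y - X *m b0) (v b) - sqnorm (v b) / 2) * \prod_(i <- l) f i (b i ord0))%:E) b
       * (gauss X b0 y)%:E) y0 = (\prod_(i <- l) c i)%:E)%E.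
Proof.
move=> mv ul f0 mf fc.
pose F y b := (expR (dot (y - X *m b0) (v b) - sqnorm (v b) / 2) *
  \prod_(i <- l) f i (b i ord0))%:E.
pose G y b := ((gauss X b0 y)%:E * F y b)%E.
have p0 (b' : 'cV[R]_q) : 0 <= \prod_(i <- l) f i (b' i ord0) by apply: prodr_ge0.
have F0 y b' : (0 <= F y b')%E by rewrite lee_fin mulr_ge0 ?expR_ge0.
have G0 y b' : (0 <= G y b')%E by rewrite mule_ge0// lee_fin gauss_ge0.
have mF : mf2 F.
  move=> d T g h cg ch; apply/measurable_EFinP; apply: measurable_funM.
    apply: measurableT_comp; first exact: measurable_expR.
    apply: measurable_funB.
      apply: measurable_dot; last exact: mv.
      by apply: cmeasB => //; exact: cmeas_cst.
    by apply: measurable_funM; [apply: measurable_sqnorm; exact: mv|exact: measurable_cst].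
  exact: measurable_coord_prod.
have mG : mf2 G.
  move=> d T g h cg ch; apply: emeasurable_funM; last exact: mF.
  by apply/measurable_EFinP; exact: measurable_gauss.
transitivity (iint (enum 'I_n) (fun y => iint l (G y) b) y0).
  apply: eq_iint => y _; rewrite muleC -iintZ //; last exact: (mf2_1r y mF).
    exact: gauss_ge0.
  by move=> b'; exact: F0.
rewrite iintC//.
transitivity (iint l (fun b => (\prod_(i <- l) f i (b i ord0))%:E) b); last exact: iint_prod.
apply: eq_iint => b' _; rewrite /G /F.
transitivity (iint (enum 'I_n) (fun y => (expR (- (sqnorm (v b') / 2)) *
    \prod_(i <- l) f i (b' i ord0))%:E *
    (expR (dot (y - X *m b0) (v b')) * gauss X b0 y)%:E)%E y0).
  apply: eq_iint => y _; rewrite -!EFinM expRD; congr (_%:E); ring.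
rewrite iintZ.
- rewrite gauss_mgf -EFinM mulrAC -expRD addNr expR0 mul1r//.
- by rewrite mulr_ge0 ?expR_ge0.
- by move=> y; rewrite lee_fin mulr_ge0 ?expR_ge0 ?gauss_ge0.
- move=> d T h ch; apply/measurable_EFinP; apply: measurable_funM.
    apply: measurableT_comp; first exact: measurable_expR.
    by apply: measurable_dot; [apply: cmeasB => //; exact: cmeas_cst|exact: cmeas_cst].
  exact: measurable_gauss.
Qed.

End LinAlg.

(** * Norms and bounds by the largest column *)

Section Norms.
Variable R : realType.
Variables (n p : nat) (X : 'M[R]_(n, p)).

Lemma colnorm_le j : colnorm X j <= normX X.
Proof. exact: (le_bigmax _ (colnorm X)). Qed.

Lemma normX_ge0 : 0 <= normX X.
Proof. exact: bigmax_ge_id. Qed.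

Lemma sqnorm_col_le j : sqnorm (col j X) <= normX X ^+ 2.
Proof. by rewrite -sqnorm_norm2 lerXn2r ?nnegrE ?normX_ge0 ?norm2_ge0// colnorm_le. Qed.

(** The arithmetic-geometric form of Cauchy-Schwarz; for two columns of norm at most |X| it still
    gives the bound |X|^2. *)
Lemma norm_dot_le m (v w : 'cV[R]_m) : `|dot v w| <= (sqnorm v + sqnorm w) / 2.
Proof.
rewrite /dot (le_trans (ler_norm_sum _ _ _))// /sqnorm -big_split/= mulr_suml.
apply: ler_sum => i _; rewrite normrM -[X in X + _]real_normK ?num_real//.
rewrite -[X in _ + X]real_normK ?num_real//.
have := sqr_ge0 (`|v i ord0| - `|w i ord0|); nra.
Qed.

Lemma dot_col_le i j : `|dot (col i X) (col j X)| <= normX X ^+ 2.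
Proof.
apply: le_trans (norm_dot_le _ _) _.
by have := sqnorm_col_le i; have := sqnorm_col_le j; lra.
Qed.

Lemma sqnorm_dot m (v : 'cV[R]_m) : sqnorm v = dot v v.
Proof. by apply: eq_bigr => i _; rewrite expr2. Qed.

Lemma sqnorm_mulmx_le (d : 'cV[R]_p) : sqnorm (X *m d) <= (normX X * l1 d) ^+ 2.
Proof.
rewrite sqnorm_dot dot_mulmxr exprMn.
have -> : normX X ^+ 2 * l1 d ^+ 2 =
    \sum_j `|d j ord0| * (\sum_k `|d k ord0| * normX X ^+ 2).
  by rewrite -mulr_suml -mulr_suml -/(l1 d); ring.
apply: ler_sum => j _; apply: le_trans (ler_norm _) _; rewrite normrM ler_wpM2l//.
rewrite dotC dot_mulmxr; apply: le_trans (ler_norm_sum _ _ _) _.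
by apply: ler_sum => k _; rewrite normrM ler_wpM2l// dot_col_le.
Qed.

Lemma l1_ge0 m (d : 'cV[R]_m) : 0 <= l1 d.
Proof. by apply: sumr_ge0. Qed.

Lemma l1_on_ge0 m (S : {set 'I_m}) (d : 'cV[R]_m) : 0 <= l1_on S d.
Proof. by apply: sumr_ge0. Qed.

End Norms.

(** * Evidence of a model and control of the noise *)

Section Evidence.
Variable R : realType.
Variables (n p : nat) (X : 'M[R]_(n, p)) (lam : R).
Hypothesis lam0 : 0 < lam.

Definition slab_lik (Y : 'cV[R]_n) (S : {set 'I_p}) (b : 'cV[R]_p) : R :=
  lik X Y b * \prod_(i in S) lap lam (b i ord0).

Definition evidence (Y : 'cV[R]_n) (S : {set 'I_p}) : \bar R :=
  iint (enum S) (fun b => (slab_lik Y S b)%:E) 0.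

Lemma slab_lik_ge0 Y S b : 0 <= slab_lik Y S b.
Proof. by rewrite mulr_ge0 ?(ltW (lik_gt0 _ _ _))// prodr_ge0// => i _; exact: lap_ge0. Qed.

Lemma measurable_lap0 : measurable_fun [set: R] (lap lam).
Proof. by apply: continuous_measurable_fun; exact: continuous_lap0. Qed.

Lemma slab_lik_mf2 S : mf2 (fun Y b => (slab_lik Y S b)%:E).
Proof.
move=> d T g h cg ch; apply/measurable_EFinP; apply: measurable_funM.
  exact: measurable_lik.
under eq_fun do rewrite -big_enum.
by apply: (@measurable_coord_prod _ _ _ _ _ (fun=> lap lam)) => // _; exact: measurable_lap0.
Qed.

Lemma evidence_ge0 Y S : (0 <= evidence Y S)%E.
Proof. by apply: iint_ge0 => b; rewrite lee_fin slab_lik_ge0. Qed.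

Lemma evidence_mf1 S : mf1 (evidence ^~ S).
Proof.
have F0 (Y : 'cV[R]_n) b : (0 <= (slab_lik Y S b)%:E)%E by rewrite lee_fin slab_lik_ge0.
exact: (mf2_1l 0 (iint_mf2 (enum S) F0 (@slab_lik_mf2 S))).
Qed.

Lemma evidence_le1 Y S : (evidence Y S <= 1)%E.
Proof.
have -> : 1%E = iint (enum S) (fun b => (\prod_(i <- enum S) lap lam (b i ord0))%:E) (0 : 'cV[R]_p).
  rewrite (@iint_prod _ _ _ (fun=> lap lam) (fun=> 1)) ?enum_uniq//.
  - by rewrite big1.
  - by move=> _ x; exact: lap_ge0.
  - by move=> _; exact: measurable_lap0.
  - by move=> _; exact: integral_lap0.
apply: le_iint => b _; rewrite !lee_fin slab_lik_ge0/= big_enum/= ler_piMl ?lik_le1//.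
by rewrite prodr_ge0// => i _; exact: lap_ge0.
Qed.

Lemma evidence_fin Y S : evidence Y S \is a fin_num.
Proof.
rewrite ge0_fin_numE ?evidence_ge0//; exact: le_lt_trans (evidence_le1 Y S) (ltry _).
Qed.

(* The slab restricted to the box of side [r] attached to [h], on the side of each [h_i] where the
   linear term of the log-likelihood increases. *)
Lemma evidence_lb Y (U : {set 'I_p}) (h : 'cV[R]_p) :
  (0 < #|U|)%N -> supp h \subset U -> normX X / p%:R <= lam ->
  (((2 * #|U|%:R * p%:R)^-1 ^+ #|U| * expR (- (3 / 2)) * (lik X Y h * expR (- (lam * l1 h))))%:E
     <= evidence Y U)%E.
Proof.
move=> U0 hU lamN.
have u1 : 1 <= #|U|%:R :> R by rewrite ler1n.
have p1 : 1 <= p%:R :> R by rewrite ler1n (leq_trans U0)// -[X in (_ <= X)%N]card_ord max_card.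
set u : R := #|U|%:R in u1 *; set P : R := p%:R in p1 lamN *.
(* With this side, lam |U| r <= 1, so the Laplace factors lose at most e^(-1), and |X| |U| r <= 1
   because |X|/p <= lam, so |X(b - h)|^2 <= 1 on the box. *)
pose r := (u * P * lam)^-1.
have uPl : 0 < u * P * lam by rewrite !mulr_gt0//; lra.
have r0 : 0 < r by rewrite invr_gt0.
have nz : (lam != 0) && (u != 0) && (P != 0) by rewrite !gt_eqF//; lra.
have rl : u * r * lam <= 1.
  rewrite (_ : u * r * lam = P^-1); first by rewrite invf_le1//; lra.
  by rewrite /r; case/andP: nz => /andP[? ?] ?; field; apply/and3P.
have rN : normX X * (u * r) <= 1.
  rewrite (_ : normX X * (u * r) = normX X / P / lam).
    by rewrite ler_pdivrMr// mul1r.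
  by rewrite /r; case/andP: nz => /andP[? ?] ?; field; apply/and3P.
pose W := Y - X *m h.
pose a i := if 0 <= dot W (col i X) then h i ord0 else h i ord0 - r.
pose f i : R -> R := \1_(`[a i, a i + r]%classic).
(* A lower bound for [slab_lik] on the box: of the exponent 3/2, the quadratic term uses 1/2 and the
   Laplace factors 1. The volume r^|U| turns (lam/2)^|U| into (2 |U| p)^(-|U|). *)
set c := expR (- (3 / 2)) * (lik X Y h * expR (- (lam * l1 h))) * (lam / 2) ^+ #|U|.
have c0 : 0 <= c by rewrite !mulr_ge0 ?expR_ge0 ?exprn_ge0// divr_ge0// ltW.
have f0 i x : 0 <= f i x by rewrite /f indicE.
have mf i : measurable_fun [set: R] (f i) by exact: measurable_indic.
have If i : (\int[@lebesgue_measure R]_x (f i x)%:E = r%:E)%E.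
  rewrite integral_indic// setIT. transitivity (@lebesgue_measure R [set` `[a i, a i + r]]); first by [].
  rewrite lebesgue_measure_itv/= lte_fin ltrDl r0.
  by rewrite -EFinB addrAC subrr add0r.
have -> : ((2 * u * P)^-1 ^+ #|U| * expR (- (3 / 2)) * (lik X Y h * expR (- (lam * l1 h))))%:E =
    iint (enum U) (fun b => (c * \prod_(i <- enum U) f i (b i ord0))%:E) 0.
  under [RHS]eq_iint do rewrite EFinM.
  rewrite iintZ//; last 2 first.
  - by move=> b; rewrite lee_fin prodr_ge0.
  - by move=> d T g cg; apply/measurable_EFinP; exact: measurable_coord_prod.
  rewrite (iint_prod _ _ _ mf If) ?enum_uniq// big_enum/= prodr_const -EFinM; congr (_%:E).
  rewrite /c -[RHS]mulrA -exprMn (_ : lam / 2 * r = (2 * u * P)^-1); first by ring.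
  by rewrite /r; case/andP: nz => /andP[? ?] ?; field; apply/and3P.
apply: le_iint => b b0; rewrite !lee_fin mulr_ge0 ?prodr_ge0//= big_enum/=.
have [/forall_inP bf|/forall_inPn[i iU fi]] :=
    boolP [forall i in U, b i ord0 \in `[a i, a i + r]]; last first.
  rewrite (bigD1 i)//= {1}/f indicE memNset ?mul0r ?mulr0 ?slab_lik_ge0//.
  exact/negP.
have -> : \prod_(i in U) f i (b i ord0) = 1.
  by rewrite big1// => i iU; rewrite /f indicE mem_set//; exact: bf.
rewrite mulr1.
have hz i : i \notin U -> h i ord0 = 0.
  by move=> iU; apply/eqP; apply: contraNT iU => hi; apply: (fintype.subsetP hU); rewrite inE.
have bz i : i \notin U -> b i ord0 = 0 by move=> iU; rewrite b0 ?mem_enum// mxE.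
have db i : `|(b - h) i ord0| <= (i \in U)%:R * r.
  rewrite !mxE; have [iU|iU] := boolP (i \in U); last by rewrite bz// hz// subr0 normr0 mul0r.
  have := bf i iU; rewrite in_itv/= mul1r ler_norml /a => /andP[].
  by case: ifP => _ ? ?; apply/andP; split; lra.
have dg i : 0 <= (b - h) i ord0 * dot W (col i X).
  rewrite !mxE; have [iU|iU] := boolP (i \in U); last by rewrite bz// hz// subr0 mul0r.
  have := bf i iU; rewrite in_itv/= /a => /andP[]; case: ifPn => [g0 ? ?|].
    by rewrite mulr_ge0//; lra.
  rewrite -ltNge => g0 ? ?; rewrite mulr_le0// ?(ltW g0)//; lra.
have l1d : l1 (b - h) <= u * r.
  apply: le_trans (ler_sum _ (fun i _ => db i)) _.
  rewrite (eq_bigr (fun i => if i \in U then r else 0)).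
    by rewrite -big_mkcond/= sumr_const -mulr_natl.
  by move=> i _; case: ifP; rewrite ?mul1r ?mul0r.
rewrite /slab_lik /c.
have -> : lik X Y h = lik X W 0 by rewrite (lik_sub X Y h) subrr.
rewrite (lik_sub X Y h b) -/W (lik_dot X W (b - h)).
have q1 : sqnorm (X *m (b - h)) <= 1.
  apply: le_trans (sqnorm_mulmx_le _ _) _.
  rewrite expr_le1// ?mulr_ge0 ?normX_ge0 ?l1_ge0//.
  by apply: le_trans rN; rewrite ler_wpM2l ?normX_ge0.
have d0 : 0 <= dot W (X *m (b - h)) by rewrite dot_mulmxr sumr_ge0.
have lapE : (lam / 2) ^+ #|U| * expR (- (lam * l1 h) - 1) <= \prod_(i in U) lap lam (b i ord0).
  apply: (@le_trans _ _ (\prod_(i in U) (lam / 2 * expR (- (lam * `|h i ord0|) - lam * r)))).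
    rewrite big_split/= prodr_const ler_wpM2l ?exprn_ge0//; first by rewrite divr_ge0// ltW.
    rewrite -expR_sum ler_expR big_split/= sumrN -mulr_sumr sumr_const -mulr_natl -/u.
    apply: lerD.
      rewrite lerN2 ler_wpM2l ?(ltW lam0)//.
      by rewrite /l1 [leRHS](bigID (mem U))/= lerDl sumr_ge0.
    by rewrite mulrN lerN2 mulrCA mulrC.
  apply: ler_prod => i iU; rewrite mulr_ge0 ?expR_ge0 ?divr_ge0 ?(ltW lam0)//=.
  rewrite ler_wpM2l ?divr_ge0 ?(ltW lam0)// ler_expR -opprD lerN2 -mulrDr ler_wpM2l ?(ltW lam0)//.
  have -> : b i ord0 = h i ord0 + (b - h) i ord0 by rewrite !mxE; ring.
  rewrite (le_trans (ler_normD _ _))// lerD2l (le_trans (db i))// iU mul1r//.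
apply: (@le_trans _ _ (lik X W 0 * expR (- (1 / 2)) * ((lam / 2) ^+ #|U| * expR (- (lam * l1 h) - 1)))).
  rewrite (_ : - (3 / 2) = - (1 / 2) - 1 :> R); last by field.
  by rewrite !expRD le_eqVlt; apply/orP; left; apply/eqP; ring.
apply: ler_pM => //.
- by rewrite mulr_ge0 ?expR_ge0.
- by rewrite mulr_ge0 ?expR_ge0// exprn_ge0// divr_ge0// ltW.
- by rewrite ler_wpM2l ?expR_ge0// ler_expR; lra.
Qed.

End Evidence.

Section Noise.
Variable R : realType.
Variables (n p : nat) (X : 'M[R]_(n, p)) (lam : R).
Hypothesis lam0 : 0 < lam.
Hypothesis lamN : normX X / p%:R <= lam.
Notation L := (ln (p%:R : R)).
Hypothesis L3 : 3 <= L.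

(** The quotient has mean one, so one model fails with probability at most p^(-3|U|). There are at
    most p^u models of size u, which leaves p^(-2u), and the sum over the p sizes is at most 1/p. *)
Definition noise_ctl (W : 'cV[R]_n) : Prop := forall U : {set 'I_p}, (0 < #|U|)%N ->
  (evidence X lam W U <= (p%:R ^+ (3 * #|U|) * lik X W 0)%:E)%E.

Lemma p_gt0 : 0 < p%:R :> R.
Proof.
rewrite ltr0n lt0n; apply: contraTneq L3 => ->.
by rewrite -ltNge ln0//; lra.
Qed.

Lemma expR_L : expR L = p%:R.
Proof. by rewrite lnK// posrE p_gt0. Qed.

Lemma expR_ge2 : 2 <= expR (1 : R).
Proof. by have := @expR_ge1Dx R 1; lra. Qed.

Lemma supp_notin (m : nat) (h : 'cV[R]_m) (U : {set 'I_m}) i :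
  supp h \subset U -> i \notin U -> h i ord0 = 0.
Proof.
move=> hU iU; apply/eqP; apply: contraNT iU => hi.
by apply: (fintype.subsetP hU); rewrite inE.
Qed.

(** Of the 6 |U| L, the event [noise_ctl] accounts for 3 |U| L and the box for |U| (1 + 2 L) + 3/2;
    the hypothesis 3 <= L absorbs the constants. *)
Lemma noise_ctl_dot W h (U : {set 'I_p}) : noise_ctl W -> (0 < #|U|)%N -> supp h \subset U ->
  dot W (X *m h) - sqnorm (X *m h) / 2 <= lam * l1 h + 6 * #|U|%:R * L.
Proof.
move=> T1 U0 hU.
have := le_trans (evidence_lb lam0 W U0 hU lamN) (T1 U U0).
rewrite lee_fin [lik X W h]lik_dot => H.
have {H} : (2 * #|U|%:R * p%:R)^-1 ^+ #|U| * expR (- (3 / 2)) *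
    (expR (dot W (X *m h) - sqnorm (X *m h) / 2) * expR (- (lam * l1 h))) <=
    p%:R ^+ (3 * #|U|) :> R.
  by rewrite -(ler_pM2r (lik_gt0 X W 0)); apply: le_trans H; rewrite le_eqVlt; apply/orP; left; apply/eqP; ring.
have u1 : 1 <= #|U|%:R :> R by rewrite ler1n.
have k : expR (- (#|U|%:R * (1 + 2 * L))) <= (2 * #|U|%:R * p%:R)^-1 ^+ #|U|.
  have d0 : 0 < 2 * #|U|%:R * p%:R :> R by rewrite !mulr_gt0 ?p_gt0// ltr0n.
  have k0 : 2 * #|U|%:R * p%:R <= expR (1 + 2 * L).
    rewrite (_ : 1 + 2 * L = 1 + L + L); last by ring.
    rewrite !expRD expR_L; apply: ler_pM => //.
    - apply: ler_pM => //; first exact: expR_ge2.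
      by rewrite ler_nat -[X in (_ <= X)%N]card_ord max_card.
  rewrite -mulrN expRM_natl; apply: lerXn2r.
  - by rewrite nnegrE expR_ge0.
  - by rewrite nnegrE invr_ge0 ltW.
  - by rewrite expRN lef_pV2 ?posrE ?expR_gt0.
have -> : p%:R ^+ (3 * #|U|) = expR (3 * #|U|%:R * L) by rewrite -expR_L -expRM_natl natrM expR_L.
move=> H; have {H k} : expR (- (#|U|%:R * (1 + 2 * L))) * expR (- (3 / 2)) *
    (expR (dot W (X *m h) - sqnorm (X *m h) / 2) * expR (- (lam * l1 h))) <=
    expR (3 * #|U|%:R * L).
  by apply: le_trans H; rewrite !(ler_wpM2r, expR_ge0, mulr_ge0)//.
have uL : #|U|%:R * 3 <= #|U|%:R * L by rewrite ler_wpM2l.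
rewrite -!expRD ler_expR; lra.
Qed.

(** Testing on d/2 halves the linear term but quarters the quadratic one. The resulting coefficient
    1/4, below the 1/2 of the log-likelihood, is what leaves a negative quadratic reserve. *)
Lemma noise_ctl_quad W d (U : {set 'I_p}) : noise_ctl W -> (0 < #|U|)%N -> supp d \subset U ->
  dot W (X *m d) <= sqnorm (X *m d) / 4 + lam * l1 d + 12 * #|U|%:R * L.
Proof.
move=> T1 U0 dU.
have dU' : supp (2^-1 *: d) \subset U.
  apply: fintype.subset_trans dU; apply/fintype.subsetP => i; rewrite !inE !mxE.
  by apply: contra_neq => ->; rewrite mulr0.
have := noise_ctl_dot T1 U0 dU'.
rewrite -scalemxAr dotZr sqnormZ.
have -> : l1 (2^-1 *: d) = 2^-1 * l1 d.
  by rewrite /l1 mulr_sumr; apply: eq_bigr => i _; rewrite mxE normrM ger0_norm// invr_ge0.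
lra.
Qed.

Section Pointwise.
Variables (al : R) (b0 : 'cV[R]_p).
Hypothesis al0 : 0 <= al.
Hypothesis al4 : al <= 1 / 4.

(** With a and c the l1 norms of b - b0 on and off S0, the prior contributes lam (a - c). The
    controlled noise adds at most lam (a + c)/4, and so does the Laplace factor retained in [tilt];
    this makes 3/2 and -1/2. *)
Definition slack (b : 'cV[R]_p) : R :=
  - al * sqnorm (X *m (b - b0)) / 2 + 3 / 2 * lam * l1_on (supp b0) (b - b0)
    - 1 / 2 * lam * l1_on (~: supp b0) (b - b0).

(** The factor 4 restores the constant lam/2 of the original Laplace density in spite of the rate
    lam/4, so each coordinate has total mass 4. *)
Definition tilt (W : 'cV[R]_n) (S : {set 'I_p}) (b : 'cV[R]_p) : R :=
  expR (dot W ((1 - al) *: (X *m (b - b0))) - sqnorm ((1 - al) *: (X *m (b - b0))) / 2) *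
  \prod_(i <- enum S) (4 * lap (lam / 4) (b i ord0 - b0 i ord0)).

Lemma l1_split (S : {set 'I_p}) (d : 'cV[R]_p) : l1 d = l1_on S d + l1_on (~: S) d.
Proof.
rewrite /l1 /l1_on (bigID (mem S))/=; congr (_ + _).
by apply: eq_bigl => i; rewrite inE.
Qed.

(* The fraction [al] of the noise term is bounded on the event [noise_ctl], at the price of the
   small entropy [12 al (|S| + |S0|) log p]; the rest is kept as an exponential martingale. *)
Lemma slab_lik_le_tilt Y (S : {set 'I_p}) b : noise_ctl (Y - X *m b0) -> (0 < #|supp b0|)%N ->
  supp b \subset S ->
  slab_lik X lam Y S b * expR (lam * l1 b0) <=
  lik X (Y - X *m b0) 0 * expR (slack b + 12 * al * (#|S|%:R + #|supp b0|%:R) * L) *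
    tilt (Y - X *m b0) S b.
Proof.
set W := Y - X *m b0 => T1 s0 bS.
set d := b - b0.
have U0 : (0 < #|S :|: supp b0|)%N by rewrite (leq_trans s0)// subset_leq_card// finset.subsetUr.
have dU : supp d \subset S :|: supp b0.
  apply/fintype.subsetP => i; rewrite !inE !mxE; apply: contraNT; rewrite negb_or negbK.
  by case/andP => iS /eqP ->; rewrite (supp_notin bS iS) subr0.
have U1 : #|S :|: supp b0|%:R <= #|S|%:R + #|supp b0|%:R :> R.
  by rewrite -natrD ler_nat cardsU leq_subr.
have := noise_ctl_quad T1 U0 dU.
rewrite /slab_lik (lik_sub X Y b0 b) -/W -/d lik_dot.
have L0 : 0 <= L by apply: le_trans L3.
have l1b : \sum_(i in S) `|b i ord0| = l1 b.
  rewrite (l1_split S b) [l1_on (~: S) b]big1 ?addr0// => i; rewrite inE => iS.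
  by rewrite (supp_notin bS iS) normr0.
have lapE : \prod_(i in S) lap lam (b i ord0) = (lam / 2) ^+ #|S| * expR (- (lam * l1 b)).
  by rewrite big_split/= prodr_const -expR_sum sumrN -mulr_sumr l1b.
have tiltE : \prod_(i <- enum S) (4 * lap (lam / 4) (b i ord0 - b0 i ord0)) =
    (lam / 2) ^+ #|S| * expR (- (lam / 4 * l1_on S d)).
  rewrite big_enum/= (eq_bigr (fun i => lam / 2 * expR (- (lam / 4 * `|d i ord0|)))).
    by rewrite big_split/= prodr_const -expR_sum sumrN -mulr_sumr.
  by move=> i iS; rewrite /lap !mxE mulrA; congr (_ * _); field.
rewrite lapE /tilt tiltE -/d dotZr sqnormZ.
set a := l1_on (supp b0) d; set c := l1_on (~: supp b0) d.
have l1d : l1 d = a + c by exact: l1_split.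
have Sd : l1_on S d <= a + c by rewrite -l1d (l1_split S d) lerDl l1_on_ge0.
have bb : l1 b0 - l1 b <= a - c.
  have -> : l1 b0 = l1_on (supp b0) b0.
    rewrite (l1_split (supp b0) b0) [X in _ + X]big1 ?addr0// => i.
    by rewrite !inE negbK => /eqP ->; rewrite normr0.
  rewrite (l1_split (supp b0) b) opprD addrA lerB//.
    rewrite -sumrB; apply: ler_sum => i _; rewrite !mxE distrC.
    exact: lerB_dist.
  by apply: ler_sum => i; rewrite !inE negbK !mxE => /eqP ->; rewrite subr0.
have [a0 c0] : 0 <= a /\ 0 <= c by rewrite !l1_on_ge0.
rewrite l1d; move: (dot W (X *m d)) (sqnorm_ge0 (X *m d)) => D.
rewrite /slack -/d -/a -/c; move: (sqnorm (X *m d)) => q q0 HD.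
(* The coefficients of q combine to -1/2 + (1 - al)^2/2 + al/4 = -3 al/4 + al^2/2, which is at most
   -al/2 for al <= 1/4. *)
have E : D - q / 2 - lam * l1 b + lam * l1 b0 <=
   - al * q / 2 + 3 / 2 * lam * a - 1 / 2 * lam * c +
     12 * al * (#|S|%:R + #|supp b0|%:R) * L +
   ((1 - al) * D - (1 - al) ^+ 2 * q / 2) - lam / 4 * l1_on S d.
  have h1 : lam * l1 b0 - lam * l1 b <= lam * a - lam * c by rewrite -!mulrBr ler_wpM2l// ltW.
  have h2 : lam / 4 * l1_on S d <= lam / 4 * (a + c) by rewrite ler_wpM2l// divr_ge0// ltW.
  have h3 : al * D <= al * (q / 4 + lam * (a + c) + 12 * #|S :|: supp b0|%:R * L).
    by rewrite ler_wpM2l.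
  have h4 : al * (12 * #|S :|: supp b0|%:R * L) <= al * (12 * (#|S|%:R + #|supp b0|%:R) * L).
    by rewrite ler_wpM2l// ler_wpM2r// ler_wpM2l.
  have h5 : al * (lam * (a + c)) <= 1 / 4 * (lam * (a + c)).
    by rewrite ler_wpM2r// mulr_ge0 ?(ltW lam0)// addr_ge0.
  have h6 : al ^+ 2 * q <= al * (1 / 4) * q by rewrite ler_wpM2r// expr2 ler_wpM2l.
  have h7 : 0 <= al * q by rewrite mulr_ge0.
  lra.
have := ltW (lik_gt0 X W 0); move: (lik X W 0) => K K0.
have : 0 <= (lam / 2) ^+ #|S| by rewrite exprn_ge0// divr_ge0// ltW.
move: ((lam / 2) ^+ #|S|) => P P0.
rewrite (_ : K * expR (D - q / 2) * (P * expR (- (lam * l1 b))) * expR (lam * l1 b0) =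
  K * P * expR (D - q / 2 - lam * l1 b + lam * l1 b0)); last by rewrite !expRD; ring.
rewrite [leRHS](_ : _ = K * P * expR (- al * q / 2 + 3 / 2 * lam * a - 1 / 2 * lam * c +
     12 * al * (#|S|%:R + #|supp b0|%:R) * L +
   ((1 - al) * D - (1 - al) ^+ 2 * q / 2) - lam / 4 * l1_on S d)); last by rewrite !expRD; ring.
by rewrite ler_wpM2l ?mulr_ge0// ler_expR.
Qed.

End Pointwise.
End Noise.

(** * The posterior as a mixture over models *)

Section Posterior.
Variable R : realType.
Variables (n p : nat) (X : 'M[R]_(n, p)) (lam : R) (pr : nat -> R).
Hypothesis lam0 : 0 < lam.
Hypothesis pr0 : forall s, 0 <= pr s.

Definition weight (S : {set 'I_p}) : R := pr #|S| / ('C(p, #|S|))%:R.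
Definition ev Y S : R := fine (evidence X lam Y S).
Definition mass Y (P : pred {set 'I_p}) : R := \sum_(S | P S) weight S * ev Y S.

Lemma weight_ge0 S : 0 <= weight S.
Proof. by rewrite divr_ge0. Qed.

Lemma evE Y S : (ev Y S)%:E = evidence X lam Y S.
Proof. by rewrite fineK// evidence_fin. Qed.

Lemma ev_ge0 Y S : 0 <= ev Y S.
Proof. by rewrite fine_ge0// evidence_ge0. Qed.

Lemma mass_ge0 Y P : 0 <= mass Y P.
Proof. by apply: sumr_ge0 => S _; rewrite mulr_ge0 ?weight_ge0 ?ev_ge0. Qed.

Lemma mass_split Y (P : pred {set 'I_p}) : mass Y predT = mass Y P + mass Y (predC P).
Proof. by rewrite /mass (bigID P). Qed.

Lemma measurable_neq0 : measurable_fun [set: R] (fun x : R => (x != 0)%:R : R).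
Proof.
rewrite (_ : (fun x => _) = \1_(~` [set 0])).
  by apply: measurable_indic; apply: measurableC; exact: measurable_set1.
apply/funext => x; rewrite indicE; have [->|x0] := eqVneq x 0; first by rewrite memNset//= => /(_ erefl).
by rewrite mem_set//= => /eqP; rewrite (negbTE x0).
Qed.

(** In the slab of S the support of b is S up to a null set, so the event depends on the model only.
    If some i of [sel] is outside S, then b_i = 0 and the integrand vanishes identically. *)
Lemma post_num_sel Y (sel : {set 'I_p}) :
  post_num pr lam X Y (fun b => sel \subset supp b) = (mass Y (fun S => sel \subset S))%:E.
Proof.
rewrite /post_num /mass -sumEFin [RHS]big_mkcond; apply: eq_bigr => S _; rewrite -/(weight S).
case: ifPn => [selS|/subsetPn[i isel iS]]; last first.
  rewrite (_ : iint _ _ _ = 0%E) ?mule0//.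
  rewrite -(iint0 (enum S) (0 : 'cV[R]_p)); apply: eq_iint => b bS.
  rewrite ifN//; apply/subsetPn; exists i => //.
  by rewrite inE negbK bS ?mem_enum// mxE.
rewrite [RHS]EFinM evE; congr (_ * _)%E.
(* The event becomes a product of coordinate indicators, whose measurability is known. *)
have selE b : (if sel \subset supp b then slab_lik X lam Y S b else 0) =
    (\prod_(i <- enum sel) (b i ord0 != 0)%:R) * slab_lik X lam Y S b.
  case: ifPn => [/fintype.subsetP ss|/subsetPn[i isel ib]].
    rewrite big_enum big1 ?mul1r// => i /ss; by rewrite inE => ->.
  by rewrite big_enum (bigD1 i)//= (_ : _ != 0 = false) ?mul0r//; move: ib; rewrite inE => /negbTE.
apply: iint_ae => [b|d T h ch|b|||b bS nz].
- by rewrite lee_fin; case: ifP => // _; exact: slab_lik_ge0.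
- apply/measurable_EFinP.
  under eq_fun do rewrite -/(slab_lik X lam Y S _) selE.
  apply: measurable_funM.
    exact: (measurable_coord_prod _ (f := fun _ x => (x != 0)%:R) ch (fun=> measurable_neq0)).
  apply/measurable_EFinP; exact: (mf2_1r Y (@slab_lik_mf2 R n p X lam S)).
- by rewrite lee_fin slab_lik_ge0.
- exact: (mf2_1r Y (@slab_lik_mf2 R n p X lam S)).
- exact: enum_uniq.
- rewrite ifT//; apply/fintype.subsetP => i /(fintype.subsetP selS) iS.
  by rewrite inE nz// mem_enum.
Qed.

Lemma post_num_true Y : post_num pr lam X Y (fun=> true) = (mass Y predT)%:E.
Proof.
rewrite /post_num /mass -sumEFin; apply: eq_bigr => S _.
by rewrite [RHS]EFinM evE.
Qed.

Lemma posteriorE Y (sel : {set 'I_p}) :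
  posterior pr lam X Y (fun b => sel \subset supp b) =
  mass Y (fun S => sel \subset S) / mass Y predT.
Proof. by rewrite /posterior post_num_sel post_num_true. Qed.

Lemma measurable_mass d (T : measurableType d) (g : T -> 'cV[R]_n) P : cmeas g ->
  measurable_fun [set: T] (fun t => mass (g t) P).
Proof.
move=> cg; rewrite (_ : (fun t => _) = fun t => \sum_S (if P S then weight S else 0) * ev (g t) S).
  apply: measurable_sum => S; apply: measurable_funM; first exact: measurable_cst.
  apply: measurableT_comp; first exact: fine_measurable.
  exact: evidence_mf1.
by apply/funext => t; rewrite /mass big_mkcond; apply: eq_bigr => S _; case: ifP => _; rewrite ?mul0r.
Qed.

Lemma posterior_mf1 (sel : {set 'I_p}) :
  mf1 (fun Y => (posterior pr lam X Y (fun b => sel \subset supp b))%:E).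
Proof.
move=> d T g cg; apply/measurable_EFinP.
(* On nonnegative numbers the inverse is the power -1, which is measurable everywhere. *)
under eq_fun do rewrite posteriorE -(powR_inv1 (mass_ge0 _ _)).
apply: measurable_funM; first exact: measurable_mass.
by apply: (measurableT_comp (measurable_powR _)); exact: measurable_mass.
Qed.

Lemma posterior_bounds Y (sel : {set 'I_p}) :
  0 <= posterior pr lam X Y (fun b => sel \subset supp b) <= 1.
Proof.
rewrite posteriorE divr_ge0 ?mass_ge0//=.
have := mass_ge0 Y predT; rewrite le_eqVlt => /predU1P[<-|D0]; first by rewrite invr0 mulr0.
rewrite ler_pdivrMr// mul1r (mass_split Y (fun S => sel \subset S)) lerDl mass_ge0//.
Qed.

Lemma posterior_ge Y (sel : {set 'I_p}) (c : R) : 0 < mass Y predT ->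
  mass Y (fun S => ~~ (sel \subset S)) <= c * mass Y predT ->
  1 <= posterior pr lam X Y (fun b => sel \subset supp b) + c.
Proof.
move=> D0 H; rewrite posteriorE -ler_pdivrMr// in H *.
have e := mass_split Y (fun S => sel \subset S).
have : 1 = mass Y predT / mass Y predT by rewrite divff// gt_eqF.
rewrite {1}e mulrDl => ->; rewrite lerD2l//.
Qed.

(** Here g dominates the failure 1 - f; stated additively, no integrals are subtracted. The bound f
    <= 1 makes the integral finite, so [fine] in [expect] keeps its value. *)
Lemma expect_ge (b0 : 'cV[R]_p) (f : 'cV[R]_n -> R) (g : 'cV[R]_n -> \bar R) (e : R) :
  (forall y, 0 <= f y <= 1) -> mf1 (fun y => (f y)%:E) ->
  (forall y, (0 <= g y)%E) -> mf1 g ->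
  (forall y, (1 <= (f y)%:E + g y)%E) ->
  (iint (enum 'I_n) (fun y => g y * (gauss X b0 y)%:E) 0 <= e%:E)%E ->
  1 - e <= expect X b0 f.
Proof.
move=> f01 mf g0 mg fg ge.
pose G y := (gauss X b0 y)%:E.
have G0 y : (0 <= G y)%E by rewrite lee_fin gauss_ge0.
have mG : mf1 G by move=> d T h ch; apply/measurable_EFinP; exact: measurable_gauss.
have IG : iint (enum 'I_n) G 0 = 1%E.
  have := gauss_mgf X b0 0 0; rewrite (_ : sqnorm 0 = 0) ?mul0r ?expR0; last first.
    by rewrite /sqnorm big1// => i _; rewrite mxE expr0n.
  move=> <-; apply: eq_iint => y _; rewrite (_ : dot _ 0 = 0) ?expR0 ?mul1r//.
  by rewrite /dot big1// => i _; rewrite [X in _ * X]mxE mulr0.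
have f0 y : (0 <= (f y * gauss X b0 y)%:E)%E.
  by rewrite lee_fin mulr_ge0 ?gauss_ge0//; case/andP: (f01 y).
have If1 : (iint (enum 'I_n) (fun y => (f y * gauss X b0 y)%:E) 0 <= 1)%E.
  rewrite -IG; apply: le_iint => y _; rewrite f0/= lee_fin ler_piMl ?gauss_ge0//.
  by case/andP: (f01 y).
have fin : iint (enum 'I_n) (fun y => (f y * gauss X b0 y)%:E) 0 \is a fin_num.
  rewrite ge0_fin_numE; last exact: iint_ge0.
  exact: le_lt_trans If1 (ltry _).
rewrite -lee_fin /expect EFinB fineK// leeBlDr//.
apply: (@le_trans _ _ (iint (enum 'I_n) (fun y => (f y * gauss X b0 y)%:E) 0 +
   iint (enum 'I_n) (fun y => g y * G y) 0)%E); last by rewrite leeD2l.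
rewrite -iintD//.
- rewrite -IG; apply: le_iint => y _; rewrite G0/= EFinM -ge0_muleDl//; last first.
    by rewrite lee_fin; case/andP: (f01 y).
  by rewrite -[leLHS]mul1e; apply: lee_wpmul2r.
- by move=> d T h ch; apply/measurable_EFinP; apply: measurable_funM;
    [apply/measurable_EFinP; exact: mf|exact: measurable_gauss].
- by move=> y; rewrite mule_ge0.
- by move=> d T h ch; apply: emeasurable_funM; [exact: mg|exact: mG].
Qed.

End Posterior.

(** * From bounds on model masses to the expected posterior *)

Section Master.
Variable R : realType.
Variables (n p : nat) (X : 'M[R]_(n, p)) (lam : R) (pr : nat -> R).
Variables (b0 : 'cV[R]_p) (al : R).
Hypothesis lam0 : 0 < lam.
Hypothesis lamN : normX X / p%:R <= lam.
Hypothesis L3 : 3 <= ln (p%:R : R).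
Hypothesis pr0 : forall s, 0 <= pr s.
Hypothesis s0_gt0 : (0 < #|supp b0|)%N.
Hypothesis prs0 : 0 < pr #|supp b0|.
Notation s0 := (#|supp b0|).
Notation W Y := (Y - X *m b0).
Notation L := (ln (p%:R : R)).

Definition tiltm (Y : 'cV[R]_n) (S : {set 'I_p}) : \bar R :=
  iint (enum S) (fun b => (tilt X lam al b0 (W Y) S b)%:E) 0.

Lemma tilt_ge0 V S b : 0 <= tilt X lam al b0 V S b.
Proof.
rewrite mulr_ge0 ?expR_ge0// prodr_ge0// => i _; rewrite mulr_ge0// lap_ge0// divr_gt0//.
Qed.

Lemma tiltm_ge0 Y S : (0 <= tiltm Y S)%E.
Proof. by apply: iint_ge0 => b; rewrite lee_fin tilt_ge0. Qed.

Let slope (i : 'I_p) (x : R) : R := 4 * lap (lam / 4) (x - b0 i ord0).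

Lemma slope_ge0 i x : 0 <= slope i x.
Proof. by rewrite mulr_ge0// lap_ge0// divr_gt0. Qed.

Lemma measurable_slope i : measurable_fun [set: R] (slope i).
Proof. by apply: measurable_funM; [exact: measurable_cst|exact: measurable_lap]. Qed.

Lemma integral_slope i : (\int[@lebesgue_measure R]_x (slope i x)%:E = 4%:E)%E.
Proof.
under eq_integral do rewrite EFinM.
rewrite ge0_integralZl ?lee_fin//.
- by rewrite integral_lap ?divr_gt0// mule1.
- by apply/measurable_EFinP; exact: measurable_lap.
- by move=> x _; rewrite lee_fin lap_ge0// divr_gt0.
Qed.

Lemma cmeas_shift d (T : measurableType d) (h : T -> 'cV[R]_p) :
  cmeas h -> cmeas (fun t => (1 - al) *: (X *m (h t - b0))).
Proof. by move=> ch; apply: cmeasZ; apply: cmeas_mulmx; apply: cmeasB => //; exact: cmeas_cst. Qed.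

Lemma tilt_mf2 S : mf2 (fun Y b => (tilt X lam al b0 (W Y) S b)%:E).
Proof.
move=> d T g h cg ch; apply/measurable_EFinP; apply: measurable_funM.
  apply: measurableT_comp; first exact: measurable_expR.
  apply: measurable_funB.
    apply: measurable_dot; last exact: cmeas_shift.
    by apply: cmeasB => //; exact: cmeas_cst.
  by apply: measurable_funM; [apply: measurable_sqnorm; exact: cmeas_shift|exact: measurable_cst].
exact: (@measurable_coord_prod _ _ _ _ _ slope _ ch measurable_slope).
Qed.

Lemma tiltm_mf1 S : mf1 (tiltm ^~ S).
Proof.
have F0 Y b : (0 <= (tilt X lam al b0 (W Y) S b)%:E)%E by rewrite lee_fin tilt_ge0.
exact: (mf2_1l 0 (iint_mf2 (enum S) F0 (@tilt_mf2 S))).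
Qed.

(** For fixed data, <W,v> - |v|^2/2 <= |W|^2/2 whatever v is, so the integrand is at most a constant
    times an integrable product. *)
Lemma tiltm_fin Y S : tiltm Y S \is a fin_num.
Proof.
rewrite ge0_fin_numE ?tiltm_ge0//.
apply: (@le_lt_trans _ _ (iint (enum S) (fun b => (expR (sqnorm (W Y) / 2))%:E *
    (\prod_(i <- enum S) slope i (b i ord0))%:E)%E 0)).
  apply: le_iint => b _; rewrite -EFinM !lee_fin tilt_ge0/=.
  rewrite /tilt ler_wpM2r ?prodr_ge0//; first by move=> i _; exact: slope_ge0.
  rewrite ler_expR; set v := (1 - al) *: _.
  by have := sqnorm_ge0 (W Y - v); rewrite sqnormB; lra.
rewrite iintZ ?expR_ge0//.
- rewrite (iint_prod _ (enum_uniq _) slope_ge0 measurable_slope integral_slope) -EFinM ltry//.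
- by move=> b; rewrite lee_fin prodr_ge0// => i _; exact: slope_ge0.
- move=> d T h ch; apply/measurable_EFinP.
  exact: (@measurable_coord_prod _ _ _ _ _ slope _ ch measurable_slope).
Qed.

Lemma expect_tiltm S :
  (iint (enum 'I_n) (fun y => tiltm y S * (gauss X b0 y)%:E) 0 = (4 ^+ #|S|)%:E)%E.
Proof.
have := @expect_mixture R n p p X b0 (enum S) (fun b => (1 - al) *: (X *m (b - b0))) slope (fun=> 4) 0 0.
rewrite big_enum/= prodr_const => <- //.
- by move=> d T h ch; exact: cmeas_shift.
- exact: enum_uniq.
- exact: slope_ge0.
- exact: measurable_slope.
- exact: integral_slope.
Qed.

(** The likelihood ratio of Xb against 0 has mean one for every b, and the slab density has mass
    one. *)
Lemma expect_evidence (U : {set 'I_p}) :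
  (iint (enum 'I_n) (fun y => (ev X lam (W y) U / lik X (W y) 0 * gauss X b0 y)%:E) 0 = 1)%E.
Proof.
have := @expect_mixture R n p p X b0 (enum U) (fun b => X *m b) (fun=> lap lam) (fun=> 1) 0 0.
rewrite big1// => <-//.
- apply: eq_iint => y _; rewrite EFinM; congr (_ * _)%E.
  rewrite EFinM evE// /evidence muleC -iintZ ?invr_ge0 ?(ltW (lik_gt0 _ _ _))//.
  + apply: eq_iint => b _; rewrite -EFinM /slab_lik (lik_dot X (W y) b) big_enum/=; congr (_%:E).
    by field; rewrite gt_eqF// lik_gt0.
  + by move=> b; rewrite lee_fin slab_lik_ge0.
  + exact: (mf2_1r (W y) (@slab_lik_mf2 R n p X lam U)).
- by move=> d T h ch; exact: cmeas_mulmx.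
- exact: enum_uniq.
- by move=> _ x; exact: lap_ge0.
- by move=> _; exact: measurable_lap0.
- by move=> _; exact: integral_lap0.
Qed.

Lemma expect_lin (I : Type) (s : seq I) (P : pred I) (c e : I -> R) (h : I -> 'cV[R]_n -> R) :
  (forall i, P i -> 0 <= c i) -> (forall i y, P i -> 0 <= h i y) ->
  (forall i, P i -> mf1 (fun y => (h i y)%:E)) ->
  (forall i, P i -> (iint (enum 'I_n) (fun y => (h i y * gauss X b0 y)%:E) 0 = (e i)%:E)%E) ->
  (iint (enum 'I_n) (fun y => ((\sum_(i <- s | P i) c i * h i y) * gauss X b0 y)%:E) 0 =
  (\sum_(i <- s | P i) c i * e i)%:E)%E.
Proof.
move=> c0 h0 mh he.
transitivity (iint (enum 'I_n) (fun y => \sum_(i <- s | P i) ((c i)%:E * (h i y * gauss X b0 y)%:E))%E 0).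
  apply: eq_iint => y _; rewrite mulr_suml -sumEFin; apply: eq_bigr => i _.
  by rewrite -[RHS]EFinM; congr (_%:E); ring.
have h00 i y : P i -> (0 <= (h i y * gauss X b0 y)%:E)%E.
  by move=> Pi; rewrite lee_fin mulr_ge0 ?gauss_ge0 ?h0.
have mhg i : P i -> mf1 (fun y => (h i y * gauss X b0 y)%:E).
  move=> Pi d T g cg; apply/measurable_EFinP; apply: measurable_funM.
    by apply/measurable_EFinP; exact: mh.
  exact: measurable_gauss.
rewrite iint_sum; last 2 first.
- by move=> i y Pi; apply: mule_ge0; [rewrite lee_fin c0|exact: h00].
- move=> i Pi d T g cg; apply: emeasurable_funM; first exact: measurable_cst.
  exact: mhg.
rewrite -sumEFin; apply: eq_bigr => i Pi; rewrite iintZ ?c0//.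
- by rewrite he// EFinM.
- by move=> y; exact: h00.
- exact: mhg.
Qed.

Definition kappa : R := (2 * s0%:R * p%:R)^-1 ^+ s0 * expR (- (3 / 2)).

Lemma kappa_gt0 : 0 < kappa.
Proof. by rewrite mulr_gt0 ?expR_gt0// exprn_gt0// invr_gt0 !mulr_gt0 ?ltr0n// -?(ltr0n R) ?(p_gt0 L3). Qed.

Lemma weight_s0_gt0 : 0 < weight pr (supp b0).
Proof.
by rewrite divr_gt0// ltr0n bin_gt0 -[X in (_ <= X)%N]card_ord max_card.
Qed.

(** Only the true model is kept, with the box attached to b0. *)
Lemma mass_lb Y : weight pr (supp b0) * (kappa * (lik X (W Y) 0 * expR (- (lam * l1 b0)))) <=
  mass X lam pr Y predT.
Proof.
rewrite /mass (bigD1 (supp b0))//= -[leLHS]addr0 lerD//.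
  rewrite ler_wpM2l ?weight_ge0// -lee_fin evE//.
  rewrite -[lik X (W Y) 0](_ : lik X Y b0 = _); last by rewrite (lik_sub X Y b0) subrr.
  exact: evidence_lb.
by apply: sumr_ge0 => S _; rewrite mulr_ge0 ?weight_ge0 ?ev_ge0.
Qed.

Lemma mass_gt0 Y : 0 < mass X lam pr Y predT.
Proof.
apply: lt_le_trans (mass_lb Y).
apply: (mulr_gt0 weight_s0_gt0); apply: (mulr_gt0 kappa_gt0).
by apply: mulr_gt0; [exact: lik_gt0|exact: expR_gt0].
Qed.

(** Dividing by the lower bound on the total mass cancels e^(-lam |b0|_1) and the likelihood at zero
    shift, both random-free or common to all models; the failure of the posterior is then dominated
    by terms with computable means. *)
Lemma expect_posterior_ge (sel : {set 'I_p}) (G : nat -> R) (del : R) : 0 <= del ->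
  (forall Y, noise_ctl X lam (W Y) ->
     mass X lam pr Y (fun S => ~~ (sel \subset S)) <=
     \sum_(S : {set 'I_p} | ~~ (sel \subset S)) weight pr S *
       (expR (- (lam * l1 b0)) * lik X (W Y) 0 * expR (G #|S|) * fine (tiltm Y S)) +
     del * mass X lam pr Y predT) ->
  1 - (\sum_(U : {set 'I_p} | (0 < #|U|)%N) (p%:R ^+ (3 * #|U|))^-1 +
       \sum_(S : {set 'I_p}) weight pr S / (weight pr (supp b0) * kappa) * expR (G #|S|) * 4 ^+ #|S| +
       del)
  <= expect X b0 (fun Y => posterior pr lam X Y (fun b => sel \subset supp b)).
Proof.
move=> del0 H.
pose c (S : {set 'I_p}) := weight pr S / (weight pr (supp b0) * kappa) * expR (G #|S|).
have wk0 : 0 < weight pr (supp b0) * kappa by rewrite mulr_gt0 ?weight_s0_gt0 ?kappa_gt0.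
have c0 S : 0 <= c S by rewrite mulr_ge0 ?expR_ge0// divr_ge0 ?weight_ge0// ltW.
have P0 : 0 < p%:R :> R := p_gt0 L3.
(* [g1] replaces the indicator of the failure of [noise_ctl]: one violated model already contributes
   a term of at least 1. *)
pose g1 y := \sum_(U : {set 'I_p} | (0 < #|U|)%N) (p%:R ^+ (3 * #|U|))^-1 * (ev X lam (W y) U / lik X (W y) 0).
pose g2 y := \sum_(S : {set 'I_p}) c S * fine (tiltm y S).
(* The constant is written as a one-term sum so that [expect_lin] applies to all three pieces. *)
pose g3 (y : 'cV[R]_n) := \sum_(i < 1) del * (fun _ _ => 1 : R) i y.
have mev U : mf1 (fun y => (ev X lam (W y) U / lik X (W y) 0)%:E).
  move=> d T h ch; apply/measurable_EFinP.
  have cW : cmeas (fun t => W (h t)) by apply: cmeasB => //; exact: cmeas_cst.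
  apply: measurable_funM.
    apply: measurableT_comp; first exact: fine_measurable.
    exact: (evidence_mf1 X lam0 U cW).
  under eq_fun do rewrite -(powR_inv1 (ltW (lik_gt0 _ _ _))).
  apply: (measurableT_comp (measurable_powR _)).
  by apply: (measurable_lik X cW); exact: cmeas_cst.
have mti S : mf1 (fun y => (fine (tiltm y S))%:E).
  move=> d T h ch; apply/measurable_EFinP.
  apply: measurableT_comp; first exact: fine_measurable.
  exact: tiltm_mf1.
have ev0 y U : 0 <= ev X lam (W y) U / lik X (W y) 0.
  by rewrite divr_ge0 ?ev_ge0// ltW// lik_gt0.
have ti0 y S : 0 <= fine (tiltm y S) by rewrite fine_ge0 ?tiltm_ge0.
have g10 y : 0 <= g1 y by apply: sumr_ge0 => U _; rewrite mulr_ge0// invr_ge0 exprn_ge0// ltW.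
have g20 y : 0 <= g2 y by apply: sumr_ge0 => U _; rewrite mulr_ge0.
have g30 y : 0 <= g3 y by apply: sumr_ge0 => U _; rewrite mulr1.
have mlin (I : finType) (P : pred I) (a : I -> R) (h : I -> 'cV[R]_n -> R) :
    (forall i, mf1 (fun y => (h i y)%:E)) -> mf1 (fun y => (\sum_(i | P i) a i * h i y)%:E).
  move=> mh d T k ck; apply/measurable_EFinP.
  rewrite (_ : (fun t => _) = fun t => \sum_i (if P i then a i else 0) * h i (k t)).
    apply: measurable_sum => i; apply: measurable_funM; first exact: measurable_cst.
    by apply/measurable_EFinP; exact: mh.
  by apply/funext => t; rewrite big_mkcond; apply: eq_bigr => i _; case: ifP => _; rewrite ?mul0r.
have m1 : mf1 (fun y => (g1 y)%:E) by exact: mlin.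
have m2 : mf1 (fun y => (g2 y)%:E) by exact: mlin.
have m3 : mf1 (fun y => (g3 y)%:E).
  by apply: mlin => _ d T h ch; exact: measurable_cst.
apply: (@expect_ge R n p X b0 _ (fun y => (g1 y + g2 y + g3 y)%:E)).
- by move=> y; exact: posterior_bounds.
- exact: posterior_mf1.
- by move=> y; rewrite lee_fin !addr_ge0.
- move=> d T h ch; apply/measurable_EFinP; apply: measurable_funD; first apply: measurable_funD.
  + by apply/measurable_EFinP; exact: m1.
  + by apply/measurable_EFinP; exact: m2.
  + by apply/measurable_EFinP; exact: m3.
- move=> y; rewrite -EFinD lee_fin.
  have [/asboolP T1|/asboolPn] := boolP `[< noise_ctl X lam (W y) >].
    apply: (@le_trans _ _ (posterior pr lam X y (fun b => sel \subset supp b) + (g2 y + g3 y))); last first.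
      by rewrite lerD2l -addrA lerDr.
    apply: (posterior_ge lam0 (mass_gt0 y)); apply: le_trans (H _ T1) _.
    rewrite mulrDl; apply: lerD; last by rewrite /g3 big_ord1 mulr1.
    rewrite /g2 mulr_suml big_mkcond/=; apply: ler_sum => S _.
    case: ifPn => _; last by apply: mulr_ge0; [exact: mulr_ge0|exact: ltW (mass_gt0 y)].
    apply: (@le_trans _ _ (c S * fine (tiltm y S) * (weight pr (supp b0) * (kappa * (lik X (W y) 0 * expR (- (lam * l1 b0))))))).
      rewrite le_eqVlt; apply/orP; left; apply/eqP; rewrite /c.
      by field; rewrite !gt_eqF ?kappa_gt0 ?weight_s0_gt0.
    by apply: ler_wpM2l; [exact: mulr_ge0|exact: mass_lb].
  rewrite /noise_ctl => /existsNP[U] /not_implyP[U0 /negP].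
  rewrite -ltNge -(evE _ lam0) lte_fin => HU.
  apply: (@le_trans _ _ (g1 y)); last first.
    have /andP[post0 _] := posterior_bounds X lam0 pr0 y sel.
    by move: (g10 y) (g20 y) (g30 y) post0; lra.
  rewrite /g1 (bigD1 U)//= -[leLHS]addr0; apply: lerD.
    rewrite mulrC ler_pdivlMr ?exprn_gt0// mul1r ler_pdivlMr ?lik_gt0//.
    exact: ltW.
  by apply: sumr_ge0 => V _; rewrite mulr_ge0// invr_ge0 exprn_ge0// ltW.
- have gg y : (0 <= (gauss X b0 y)%:E)%E by rewrite lee_fin gauss_ge0.
  have mm (h : 'cV[R]_n -> R) : mf1 (fun y => (h y)%:E) -> mf1 (fun y => (h y * gauss X b0 y)%:E).
    move=> mh d T k ck; apply/measurable_EFinP; apply: measurable_funM.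
      by apply/measurable_EFinP; exact: mh.
    exact: measurable_gauss.
  have gp (h : 'cV[R]_n -> R) : (forall y, 0 <= h y) -> forall y, (0 <= (h y * gauss X b0 y)%:E)%E.
    by move=> h0 y; rewrite lee_fin mulr_ge0// gauss_ge0.
  have -> : iint (enum 'I_n) (fun y => ((g1 y + g2 y + g3 y)%:E * (gauss X b0 y)%:E)%E) 0 =
      iint (enum 'I_n) (fun y => ((g1 y * gauss X b0 y)%:E + (g2 y * gauss X b0 y)%:E)
         + (g3 y * gauss X b0 y)%:E)%E 0.
    by apply: eq_iint => y _; rewrite -EFinM -!EFinD !mulrDl.
  rewrite iintD; last 4 first.
  + by move=> y; rewrite adde_ge0 ?gp.
  + move=> d T h ch; apply: emeasurable_funD; first exact: (mm _ m1 _ _ _ ch).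
    exact: (mm _ m2 _ _ _ ch).
  + exact: gp.
  + exact: mm.
  rewrite iintD; last 4 first.
  + exact: gp.
  + exact: mm.
  + exact: gp.
  + exact: mm.
  rewrite /g1 /g2 /g3.
  rewrite (@expect_lin _ _ _ _ (fun=> 1)); last 4 first.
  + by move=> U _; rewrite invr_ge0 exprn_ge0// ltW.
  + by move=> U y _; exact: ev0.
  + by move=> U _; exact: mev.
  + by move=> U _; exact: expect_evidence.
  rewrite (@expect_lin _ _ xpredT c (fun S => 4 ^+ #|S|) (fun S y => fine (tiltm y S))); last 4 first.
  + by move=> S _; exact: c0.
  + by move=> S y _; exact: ti0.
  + by move=> S _; exact: mti.
  + move=> S _; rewrite -expect_tiltm; apply: eq_iint => y _.
    by rewrite EFinM fineK// tiltm_fin.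
  rewrite (@expect_lin _ _ xpredT (fun=> del) (fun=> 1) (fun _ _ => 1)); last 4 first.
  + by [].
  + by [].
  + by move=> _ _ d T h ch; exact: measurable_cst.
  + move=> _ _; have := gauss_mgf X b0 0 0.
    rewrite (_ : sqnorm 0 = 0) ?mul0r ?expR0; last first.
      by rewrite /sqnorm big1// => i _; rewrite mxE expr0n.
    move=> <-; apply: eq_iint => y _; rewrite (_ : dot _ 0 = 0) ?expR0//.
    by rewrite /dot big1// => i _; rewrite [X in _ * X]mxE mulr0.
  rewrite -!EFinD lee_fin big_ord1 mulr1 lerD2r lerD2r.
  by apply: ler_sum => U _; rewrite mulr1.
Qed.

End Master.

(** * Prior weights *)

Section Sums.
Variable R : realType.
Variables (p : nat) (pr : nat -> R).
Notation L := (ln (p%:R : R)).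

Lemma sum_set_card (F : nat -> R) :
  \sum_(S : {set 'I_p}) F #|S| = \sum_(s < p.+1) ('C(p, s))%:R * F s.
Proof.
have cS (S : {set 'I_p}) : (#|S| < p.+1)%N by rewrite ltnS -[X in (_ <= X)%N]card_ord max_card.
rewrite (partition_big (fun S => Ordinal (cS S)) predT)//=.
apply: eq_bigr => s _; rewrite (eq_bigr (fun=> F s)); last by move=> S /eqP <-.
have := card_draws 'I_p s; rewrite card_ord => <-.
rewrite sumr_const -[LHS]mulr_natl; congr (_%:R * _).
by apply: eq_card => S; rewrite !inE.
Qed.

Lemma ffact_le_expn m k : (m ^_ k <= m ^ k)%N.
Proof. by elim: k => // k IH; rewrite ffactnSr expnSr leq_mul// leq_subr. Qed.

(** From s^s/s! <= e^s. The uniform choice of the model costs C(p,s) and the box costs s^s; bounded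
    together they cost (e p)^s, whereas separate bounds would give p^(2s). *)
Lemma bin_expn_le s : ('C(p, s) * s ^ s)%N%:R <= expR 1 ^+ s * p%:R ^+ s :> R.
Proof.
have f0 : 0 < s`!%:R :> R by rewrite ltr0n fact_gt0.
have ess : s%:R ^+ s <= expR 1 ^+ s * s`!%:R :> R.
  case: s f0 => [|s] f0; first by rewrite !expr0 fact0 mulr1.
  rewrite -ler_pdivrMr// -expRM_natl mulr1.
  by have := @expR_ge1Dxn R s.+1%:R s (ler0n _ _); lra.
rewrite -(ler_pM2r f0) natrM -mulrA [_ * s`!%:R]mulrC mulrA -natrM bin_ffact natrX.
apply: (@le_trans _ _ (p%:R ^+ s * (expR 1 ^+ s * s`!%:R))).
  by apply: ler_pM => //; rewrite ?exprn_ge0// -natrX ler_nat ffact_le_expn.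
by rewrite le_eqVlt; apply/orP; left; apply/eqP; ring.
Qed.

Lemma sum_geometric_half (s0 N : nat) :
  \sum_(s < N) (if (s0 <= s)%N then 2^-1 ^+ (s - s0) else 0) <= 2 :> R.
Proof.
(* The induction needs the exact value of the partial sum, that is, 2 minus the missing tail. *)
suff : \sum_(s < N) (if (s0 <= s)%N then 2^-1 ^+ (s - s0) else 0) <=
    2 - (if (s0 < N)%N then 2 * 2^-1 ^+ (N - s0) else 2) :> R.
  move=> /le_trans; apply; rewrite gerBl; case: ifP => // _.
elim: N => [|N IH]; first by rewrite big_ord0 ltn0 subrr.
rewrite big_ord_recr/=; apply: le_trans (lerD IH (lexx _)) _; rewrite ltnS.
have [sN|sN] := ltnP s0 N.
  by rewrite (ltnW sN) subSn ?(ltnW sN)// exprS; set x := _ ^+ _; lra.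
have [->|ns] := eqVneq s0 N; first by rewrite leqnn subnn subSn// subnn expr0 expr1; lra.
by rewrite leqNgt ltn_neqAle eq_sym ns sN/=; lra.
Qed.

Hypothesis pr0 : forall s, 0 <= pr s.
Variables (A1 A2 A3 A4 : R).
Hypotheses (A1_gt0 : 0 < A1) (A2_gt0 : 0 < A2) (A3_gt0 : 0 < A3) (A4_gt0 : 0 < A4).
Hypothesis prR : forall s, (1 <= s <= p)%N ->
  A1 * (p%:R `^ (- A3)) * pr s.-1 <= pr s /\ pr s <= A2 * (p%:R `^ (- A4)) * pr s.-1.
Hypothesis L20 : 20 <= L.
Hypothesis pA1 : A1^-1 <= p%:R.
Hypothesis pA2 : 4 * A2 * expR (- (A4 / 10 * L)) <= 1 / 2.

Let L3 : 3 <= L. Proof. by apply: le_trans L20; lra. Qed.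
Let p0 : 0 < p%:R :> R. Proof. exact: p_gt0 L3. Qed.

Lemma powR_expR (a : R) : p%:R `^ a = expR (a * L).
Proof. by rewrite /powR gt_eqF// p0. Qed.

(** If pr 0 vanished, the upper recursion would make every weight vanish, against total mass one;
    the lower recursion then propagates positivity. *)
Lemma prior_gt0 : \sum_(s < p.+1) pr s = 1 -> forall s, (s <= p)%N -> 0 < pr s.
Proof.
move=> pr1; have pr00 : 0 < pr 0.
  rewrite lt_def pr0 andbT; apply: contra_eq_neq pr1 => e0.
  rewrite big1 ?(eq_sym 0) ?oner_eq0// => -[s /= sp] _.
  elim: s sp => // s IH sp; have [_] := prR (s := s.+1) sp.
  by rewrite /= IH ?(ltnW sp)// mulr0 => le0; apply/eqP; rewrite eq_le le0 pr0.
elim=> // s IH sp; have [+ _] := prR (s := s.+1) sp.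
by apply: lt_le_trans; rewrite !mulr_gt0 ?IH ?powR_gt0// ltnW.
Qed.

Lemma prior_le_up s0 s : (s0 <= s <= p)%N ->
  pr s <= (A2 * expR (- (A4 * L))) ^+ (s - s0) * pr s0.
Proof.
elim: s => [|s IH] /andP[]; first by rewrite leqn0 => /eqP -> _; rewrite subnn expr0 mul1r.
rewrite leq_eqVlt => /predU1P[-> _|]; first by rewrite subnn expr0 mul1r.
rewrite ltnS => ss sp; have [_] := prR (s := s.+1) sp.
move=> /le_trans; apply; rewrite powR_expR mulNr subSn// exprS -[leRHS]mulrA.
by rewrite ler_wpM2l ?mulr_ge0 ?expR_ge0 ?(ltW A2_gt0)// IH// ss ltnW.
Qed.

(** One extra factor p per step absorbs A1^(-1). *)
Lemma prior_le_down s0 s : (s <= s0 <= p)%N ->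
  pr s <= expR ((A3 + 1) * L) ^+ (s0 - s) * pr s0.
Proof.
elim: s0 => [|s0 IH] /andP[]; first by rewrite leqn0 => /eqP -> _; rewrite subnn expr0 mul1r.
rewrite leq_eqVlt => /predU1P[-> _|]; first by rewrite subnn expr0 mul1r.
rewrite ltnS => ss sp; have [+ _] := prR (s := s0.+1) sp; rewrite /= => H.
have ssp : (s <= s0 <= p)%N by rewrite ss ltnW.
apply: le_trans (IH ssp) _.
rewrite subSn// exprSr -mulrA ler_wpM2l ?exprn_ge0 ?expR_ge0//.
move: H; rewrite powR_expR mulNr expRN => H.
have e0 := expR_gt0 (A3 * L).
rewrite mulrDl mul1r expRD (expR_L L3).
have : expR (A3 * L) * p%:R * (A1 * (expR (A3 * L))^-1 * pr s0) <= expR (A3 * L) * p%:R * pr s0.+1.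
  by rewrite ler_wpM2l// mulr_ge0// expR_ge0.
apply: le_trans.
rewrite [leRHS](_ : _ = A1 * p%:R * pr s0); last by field; rewrite gt_eqF.
by rewrite ler_peMl// mulrC -ler_pdivrMr// mul1r.
Qed.


(* [pr s / pr s0] is at most about [p ^ (- A4 (s - s0))] above [s0] and [p ^ (A3 (s0 - s))] below,
   while the evidence bound costs [p ^ (2 s0)]: models of size [s] may gain [expR (budget s0 s)]
   over the true one and remain negligible in total. *)
Definition budget (s0 s : nat) : R :=
  if (s0 <= s)%N then (9 / 10 * A4 * (s%:R - s0%:R) - 11 / 5 * s0%:R) * L
  else - (A3 + 5) * s0%:R * L.

(** Above s0, the missing tenth of A4 leaves p^(-A4/10) per extra coordinate, enough to bring 4 A2
    below 1/2, and 11/5 exceeds by 1/5 the 2 spent on the evidence. Below s0, A3 + 5 is A3 + 1 for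
    the prior, 2 for the evidence and a surplus of 2, which pays for the constants and for p^(-1),
    summable over the p + 1 sizes. *)
Lemma prior_budget s0 s : (0 < s0 <= p)%N -> (s <= p)%N ->
  expR (2 * s0%:R * (1 + L) + 3 / 2) * (pr s * expR (budget s0 s) * 4 ^+ s) <=
  expR (6 - L / 5) * ((if (s0 <= s)%N then 2^-1 ^+ (s - s0) else 0) + p%:R^-1) * pr s0.
Proof.
move=> /andP[s0p s0p'] sp.
have e4 : 4 <= expR 2 :> R.
  have e2 : 2 <= expR 1 :> R := expR_ge2 R.
  by rewrite (_ : 2 = 1 + 1 :> R)// expRD; have : 2 * 2 <= expR 1 * expR 1 :> R; [exact: ler_pM|lra].
have s1 : 1 <= s0%:R :> R by rewrite ler1n.
have [ss|ss] := leqP s0 s.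
  rewrite /budget ss; set k := (s - s0)%N.
  have sE : s%:R = s0%:R + k%:R :> R by rewrite -natrD subnKC.
  have ks : s = (s0 + k)%N by rewrite subnKC.
  have prs := prior_le_up (s0 := s0) (s := s); rewrite ss sp -/k in prs.
  have {}prs := prs isT.
  apply: (@le_trans _ _ (expR (2 * s0%:R * (1 + L) + 3 / 2) *
     ((A2 * expR (- (A4 * L))) ^+ k * pr s0 *
       expR ((9 / 10 * A4 * (s%:R - s0%:R) - 11 / 5 * s0%:R) * L) * 4 ^+ s))).
    by rewrite ler_wpM2l ?expR_ge0// ler_wpM2r ?exprn_ge0// ler_wpM2r ?expR_ge0.
  have e : expR (2 * s0%:R * (1 + L) + 3 / 2) *
     ((A2 * expR (- (A4 * L))) ^+ k * pr s0 *
       expR ((9 / 10 * A4 * (s%:R - s0%:R) - 11 / 5 * s0%:R) * L) * 4 ^+ s) =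
     (expR (3 / 2) * (expR (2 - L / 5) * 4) ^+ s0) *
       (4 * A2 * expR (- (A4 / 10 * L))) ^+ k * pr s0.
    rewrite sE {1}ks exprD !exprMn -!expRM_natl.
    have -> : 2 * s0%:R * (1 + L) + 3 / 2 = 3 / 2 + s0%:R * (2 - L / 5) + s0%:R * (11 / 5 * L) by field.
    have -> : (9 / 10 * A4 * (s0%:R + k%:R - s0%:R) - 11 / 5 * s0%:R) * L =
      - (s0%:R * (11 / 5 * L)) - k%:R * - (A4 * L) + k%:R * - (A4 / 10 * L) by field.
    rewrite !expRD !expRN; field; rewrite !gt_eqF ?expR_gt0//.
  rewrite {}e ler_wpM2r//.
  apply: (@le_trans _ _ (expR (6 - L / 5) * 2^-1 ^+ k)); last first.
    by rewrite ler_wpM2l ?expR_ge0// lerDl invr_ge0 ltW.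
  apply: ler_pM.
  - by rewrite mulr_ge0 ?exprn_ge0 ?mulr_ge0 ?expR_ge0.
  - by rewrite exprn_ge0// !mulr_ge0 ?expR_ge0 ?(ltW A2_gt0).
  - apply: (@le_trans _ _ (expR (3 / 2) * expR (4 - L / 5) ^+ s0)).
      rewrite ler_wpM2l ?expR_ge0// lerXn2r ?nnegrE ?mulr_ge0 ?expR_ge0//.
      rewrite (_ : 4 - L / 5 = 2 - L / 5 + 2); last by ring.
      by rewrite [leRHS]expRD ler_wpM2l ?expR_ge0.
    rewrite -expRM_natl -expRD ler_expR.
    (* Here 20 <= L enters: each further true coordinate multiplies the bound by e^(4 - L/5) <= 1,
       so s0 = 1 is the worst case. *)
    have : 0 <= (s0%:R - 1) * (L / 5 - 4) by rewrite mulr_ge0//; move: L20; lra.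
    lra.
  - by rewrite lerXn2r ?nnegrE ?mulr_ge0 ?expR_ge0 ?(ltW A2_gt0)//; move: pA2; lra.
rewrite /budget leqNgt ss/= add0r.
have prs := prior_le_down (s0 := s0) (s := s); rewrite (ltnW ss) s0p' in prs.
have {}prs := prs isT.
have c1 : pr s <= expR ((A3 + 1) * L) ^+ s0 * pr s0.
  apply: le_trans prs _; rewrite ler_wpM2r// ler_weXn2l ?leq_subr//.
  by rewrite -[leLHS]expR0 ler_expR mulr_ge0 ?addr_ge0 ?(ltW A3_gt0)// (le_trans _ L20).
have c2 : 4 ^+ s <= expR 2 ^+ s0 :> R.
  apply: (@le_trans _ _ (4 ^+ s0)); first by rewrite ler_weXn2l ?(ltnW ss)//; lra.
  by rewrite lerXn2r ?nnegrE ?expR_ge0.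
apply: (@le_trans _ _ (expR (2 * s0%:R * (1 + L) + 3 / 2) *
   (expR ((A3 + 1) * L) ^+ s0 * pr s0 * expR (- (A3 + 5) * s0%:R * L) * expR 2 ^+ s0))).
  rewrite ler_wpM2l ?expR_ge0// ler_pM ?exprn_ge0 ?mulr_ge0 ?expR_ge0//.
  by rewrite ler_wpM2r ?expR_ge0.
have -> : p%:R^-1 = expR (- L) by rewrite expRN expR_L.
rewrite -!expRM_natl -expRD.
rewrite [leLHS](_ : _ = expR (2 * s0%:R * (1 + L) + 3 / 2 + s0%:R * ((A3 + 1) * L) + - (A3 + 5) * s0%:R * L
   + s0%:R * 2) * pr s0); last by rewrite !expRD; ring.
rewrite ler_wpM2r// ler_expR.
have : 0 <= (s0%:R - 1) * (2 * L - 4) by rewrite mulr_ge0//; move: L20; lra.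
move: L20; lra.
Qed.

Lemma sum_noise_le : \sum_(U : {set 'I_p} | (0 < #|U|)%N) (p%:R ^+ (3 * #|U|))^-1 <= p%:R^-1 :> R.
Proof.
rewrite big_mkcond (@sum_set_card (fun u => if (0 < u)%N then (p%:R ^+ (3 * u))^-1 else 0)).
rewrite big_ord_recl/= mulr0 add0r.
apply: (@le_trans _ _ (\sum_(i < p) (p%:R ^+ 2)^-1)); last first.
  by rewrite sumr_const card_ord -[leLHS]mulr_natl expr2 invfM mulrA divff ?mul1r// gt_eqF.
apply: ler_sum => i _; rewrite /bump/= add1n.
have p1 : 1 <= p%:R :> R by rewrite ler1n -(ltr0n R).
have bin_le : ('C(p, i.+1) <= p ^ i.+1)%N.
  by apply: leq_trans (ffact_le_expn _ _); rewrite -bin_ffact leq_pmulr ?fact_gt0.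
apply: (@le_trans _ _ (p%:R ^+ i.+1 * (p%:R ^+ (3 * i.+1))^-1)).
  by rewrite ler_wpM2r ?invr_ge0 ?exprn_ge0// -natrX ler_nat.
rewrite ler_pdivrMr ?exprn_gt0// mulrC ler_pdivlMr ?exprn_gt0// -exprD.
by rewrite ler_weXn2l// !mulSn mul0n addn0 leq_add2l addSn addnS.
Qed.

Lemma sum_budget_le (b0 : 'cV[R]_p) : (0 < #|supp b0|)%N -> 0 < pr #|supp b0| ->
  \sum_(S : {set 'I_p}) weight pr S / (weight pr (supp b0) * kappa b0) *
    expR (budget #|supp b0| #|S|) * 4 ^+ #|S| <= expR (8 - L / 5).
Proof.
set s0 := #|supp b0| => s0_gt0 prs0.
have s0p : (s0 <= p)%N by rewrite -[X in (_ <= X)%N]card_ord max_card.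
pose w (S : {set 'I_p}) := weight pr S.
have bin0 s : (s <= p)%N -> ('C(p, s))%:R != 0 :> R by move=> sp; rewrite pnatr_eq0 -lt0n bin_gt0.
have s00 : 0 < s0%:R :> R by rewrite ltr0n.
have e2 : 2 <= expR 1 :> R := expR_ge2 R.
have D : (weight pr (supp b0) * kappa b0)^-1 <=
    expR (2 * s0%:R * (1 + L) + 3 / 2) / pr s0.
  have -> : (weight pr (supp b0) * kappa b0)^-1 =
      ('C(p, s0) * s0 ^ s0)%N%:R * (2 ^+ s0 * p%:R ^+ s0 * expR (3 / 2)) / pr s0.
    by rewrite /weight /kappa -/s0 natrM natrX exprVn expRN !invfM !invrK !exprMn; ring.
  rewrite ler_wpM2r ?invr_ge0//.
  apply: (@le_trans _ _ (expR 1 ^+ s0 * p%:R ^+ s0 * (expR 1 ^+ s0 * p%:R ^+ s0 * expR (3 / 2)))).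
    apply: ler_pM => //; rewrite ?mulr_ge0 ?exprn_ge0 ?expR_ge0//; first exact: bin_expn_le.
    rewrite ler_wpM2r ?expR_ge0// ler_wpM2r ?exprn_ge0//.
    by rewrite lerXn2r ?nnegrE ?expR_ge0.
  have -> : p%:R ^+ s0 = expR (s0%:R * L) by rewrite expRM_natl expR_L.
  rewrite -expRM_natl -!expRD ler_expR.
  by rewrite le_eqVlt; apply/orP; left; apply/eqP; ring.
(* Grouped by size, the C(p,s) models of size s cancel the binomial in their weight. *)
rewrite (@sum_set_card (fun s => pr s / ('C(p, s))%:R / (weight pr (supp b0) * kappa b0) *
    expR (budget s0 s) * 4 ^+ s)).
apply: (@le_trans _ _ (\sum_(s < p.+1) expR (6 - L / 5) *
    ((if (s0 <= s)%N then 2^-1 ^+ (s - s0) else 0) + p%:R^-1))).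
  apply: ler_sum => s _; have sp : (s <= p)%N by rewrite -ltnS.
  have := @prior_budget s0 s; rewrite s0_gt0 s0p => /(_ isT sp).
  rewrite -ler_pdivrMr//; apply: le_trans.
  move: D; set z := _^-1; set e := expR (2 * _ * _ + _) => D.
  rewrite [leLHS](_ : _ = z * (pr s * expR (budget s0 s) * 4 ^+ s)); last first.
    by field; exact: bin0.
  rewrite [leRHS](_ : _ = (e / pr s0) * (pr s * expR (budget s0 s) * 4 ^+ s)); last by ring.
  by rewrite ler_wpM2r// !mulr_ge0 ?expR_ge0 ?exprn_ge0.
(* The brackets sum to at most 2 + (p + 1)/p <= 4 <= e^2. *)
rewrite -mulr_sumr (_ : 8 - L / 5 = 6 - L / 5 + 1 + 1); last by ring.
rewrite [expR (_ + 1 + 1)]expRD [expR (_ + 1)]expRD -[leRHS]mulrA ler_wpM2l ?expR_ge0//.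
have e4 : 2 * 2 <= expR 1 * expR 1 :> R by apply: ler_pM.
apply: le_trans e4; rewrite big_split/= sumr_const card_ord -[p%:R^-1 *+ _]mulr_natl.
have -> : p.+1%:R * p%:R^-1 = 1 + p%:R^-1 :> R by rewrite -addn1 natrD mulrDl mul1r divff// gt_eqF.
have : p%:R^-1 <= 1 :> R by rewrite invf_le1// ler1n -(ltr0n R).
have := sum_geometric_half s0 p.+1; lra.
Qed.

End Sums.

(** * Evidence of nested models *)

Section Perm.
Variable R : realType.
Local Open Scope ereal_scope.
Notation mu := (@lebesgue_measure R).

Lemma iint_cat m l l' (F : 'cV[R]_m -> \bar R) b : iint (l ++ l') F b = iint l (iint l' F) b.
Proof. by elim: l b => //= i l IH b; apply: eq_integral => x _; exact: IH. Qed.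

Lemma upd_upd m (b : 'cV[R]_m) i j x z : i != j ->
  upd (upd b i x) j z = upd (upd b j z) i x.
Proof.
move=> ij; apply/matrixP => k c; rewrite !mxE.
by have [->|] := eqVneq k j; rewrite ?(eq_sym j) ?(negbTE ij).
Qed.

Lemma iint_swap m (i j : 'I_m) l (F : 'cV[R]_m -> \bar R) b :
  (forall b, 0 <= F b) -> mf1 F -> iint (i :: j :: l) F b = iint (j :: i :: l) F b.
Proof.
move=> F0 mF; have [->//|ij] := eqVneq i j; rewrite /=.
pose f (z : R * R) := iint l F (upd (upd b i z.1) j z.2).
have mf : measurable_fun setT f.
  apply: (iint_mf1 l F0 mF); apply: cmeas_upd; last exact: measurable_snd.
  by apply: cmeas_upd; [exact: cmeas_cst|exact: measurable_fst].
have f0 z : 0 <= f z by exact: iint_ge0.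
have := @fubini_tonelli _ _ _ _ R (@lebesgue_measure R) (@lebesgue_measure R) f mf f0.
rewrite /f /= => ->; apply: eq_integral => x _; apply: eq_integral => z _.
by rewrite upd_upd.
Qed.

Lemma iint_perm m (l l' : seq 'I_m) (F : 'cV[R]_m -> \bar R) b :
  (forall b, 0 <= F b) -> mf1 F -> perm_eq l l' -> iint l F b = iint l' F b.
Proof.
move=> F0 mF.
have move1 i l1 l2 b1 : iint (i :: l1 ++ l2) F b1 = iint (l1 ++ i :: l2) F b1.
  elim: l1 b1 => // j l1 IH b1; rewrite [LHS]iint_swap//=.
  by apply: eq_integral => x _; exact: IH.
elim: l l' b => [|i l IH] l' b; first by rewrite perm_sym => /perm_nilP ->.
move=> pl; have il : i \in l' by rewrite -(perm_mem pl) mem_head.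
case/splitPr: il pl => l1 l2; rewrite -move1 => pl /=; apply: eq_integral => x _; apply: IH.
by rewrite -(perm_cons i); apply: perm_trans pl _; rewrite -[i :: l2]cat1s perm_catCA.
Qed.

End Perm.

Section Extend.
Variable R : realType.
Variables (n p : nat) (X : 'M[R]_(n, p)) (lam : R).
Hypothesis lam0 : 0 < lam.
Variables (b0 : 'cV[R]_p) (al : R).

(** The enumeration of the larger model is permuted to integrate the new coordinate innermost, so
    that the two models can be compared for each fixed b in the slab of S. *)
Lemma evidence_add Y (S : {set 'I_p}) i : i \notin S ->
  evidence X lam Y (i |: S) =
  iint (enum S) (fun b => \int[@lebesgue_measure R]_x (slab_lik X lam Y (i |: S) (upd b i x))%:E)%E 0.
Proof.
move=> iS; rewrite /evidence (@iint_perm _ _ _ (enum S ++ [:: i])).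
- by rewrite iint_cat.
- by move=> b; rewrite lee_fin slab_lik_ge0.
- exact: (mf2_1r Y (@slab_lik_mf2 R n p X lam _)).
- apply: uniq_perm; rewrite ?cat_uniq ?enum_uniq ?andbT//=.
    by rewrite orbF mem_enum.
  by move=> j; rewrite mem_cat !mem_enum !inE orbC.
Qed.

Lemma ev_le_tilt Y (S : {set 'I_p}) (c : R) : 0 <= c ->
  (forall b : 'cV[R]_p, supp b \subset S ->
     slab_lik X lam Y S b <= c * tilt X lam al b0 (Y - X *m b0) S b) ->
  ev X lam Y S <= c * fine (tiltm X lam b0 al Y S).
Proof.
move=> c0 H; rewrite -lee_fin evE// EFinM fineK ?tiltm_fin// /tiltm -iintZ//.
- apply: le_iint => b bS; rewrite lee_fin slab_lik_ge0//= lee_fin; apply: H.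
  apply/fintype.subsetP => k; rewrite inE; apply: contraNT => kS.
  by rewrite bS ?mem_enum// mxE.
- by move=> b; rewrite lee_fin tilt_ge0.
- exact: (mf2_1r Y (@tilt_mf2 _ _ _ X lam b0 al S)).
Qed.

(** Each b is paid for either by the tilt or by the larger model. Adding the two bounds, instead of
    splitting the slab, avoids the measurability of the set where each one holds. *)
Lemma ev_le_tilt_add Y (S : {set 'I_p}) i (c e : R) : 0 <= c -> 0 <= e -> i \notin S ->
  (forall b : 'cV[R]_p, supp b \subset S ->
     ((slab_lik X lam Y S b)%:E <= (c * tilt X lam al b0 (Y - X *m b0) S b)%:E +
       e%:E * \int[@lebesgue_measure R]_x (slab_lik X lam Y (i |: S) (upd b i x))%:E)%E) ->
  ev X lam Y S <= c * fine (tiltm X lam b0 al Y S) + e * ev X lam Y (i |: S).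
Proof.
move=> c0 e0 iS H; rewrite -lee_fin.
have -> : (ev X lam Y S)%:E = evidence X lam Y S by exact: evE.
have -> : (c * fine (tiltm X lam b0 al Y S) + e * ev X lam Y (i |: S))%:E =
    (c%:E * (fine (tiltm X lam b0 al Y S))%:E + e%:E * (ev X lam Y (i |: S))%:E)%E by [].
have -> : (fine (tiltm X lam b0 al Y S))%:E = tiltm X lam b0 al Y S by rewrite fineK// tiltm_fin.
have -> : (ev X lam Y (i |: S))%:E = evidence X lam Y (i |: S) by exact: evE.
rewrite evidence_add// /tiltm.
have s0 b : (0 <= (slab_lik X lam Y (i |: S) b)%:E)%E by rewrite lee_fin slab_lik_ge0.
have ms : mf1 (fun b => (slab_lik X lam Y (i |: S) b)%:E).
  exact: (mf2_1r Y (@slab_lik_mf2 R n p X lam _)).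
have mi : mf1 (fun b => \int[@lebesgue_measure R]_x (slab_lik X lam Y (i |: S) (upd b i x))%:E)%E.
  exact: (iint_mf1 [:: i] s0 ms).
have mt : mf1 (fun b => (tilt X lam al b0 (Y - X *m b0) S b)%:E).
  exact: (mf2_1r Y (@tilt_mf2 _ _ _ X lam b0 al S)).
have i0 b : (0 <= \int[@lebesgue_measure R]_x (slab_lik X lam Y (i |: S) (upd b i x))%:E)%E.
  by apply: integral_ge0 => x _.
have t0 b : (0 <= (tilt X lam al b0 (Y - X *m b0) S b)%:E)%E by rewrite lee_fin tilt_ge0.
rewrite -!iintZ// -iintD//.
- apply: le_iint => b bS; rewrite lee_fin slab_lik_ge0//=; apply: H.
  apply/fintype.subsetP => k; rewrite inE; apply: contraNT => kS.
  by rewrite bS ?mem_enum// mxE.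
- by move=> b; rewrite mule_ge0.
- by move=> d T h ch; apply: emeasurable_funM; [exact: measurable_cst|exact: mt].
- by move=> b; rewrite mule_ge0.
- by move=> d T h ch; apply: emeasurable_funM; [exact: measurable_cst|exact: mi].
Qed.

End Extend.

(** * Compatibility constants *)

Section InfNonneg.
Variable R : realType.

Lemma inf_le_mem (E : set R) x : (forall y, E y -> 0 <= y) -> E x -> inf E <= x.
Proof.
move=> E0 Ex; apply: ge_inf => //; exists 0 => y; exact: E0.
Qed.

(** The empty set has infimum 0 here, so the compatibility constants are nonnegative without any
    nonemptiness argument. *)
Lemma inf_ge0 (E : set R) : (forall y, E y -> 0 <= y) -> 0 <= inf E.
Proof.
move=> E0; have [->|] := eqVneq E set0; first by rewrite inf0.
by move=> /set0P ne; apply: lb_le_inf.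
Qed.

End InfNonneg.

Section Compat.
Variable R : realType.
Variables (n p : nat) (X : 'M[R]_(n, p)).
Hypothesis XN : 0 < normX X.
Notation N := (normX X).

Lemma sqnorm_delta (j : 'I_p) : sqnorm (delta_mx j ord0 : 'cV[R]_p) = 1.
Proof.
rewrite /sqnorm (bigD1 j)//= big1 ?addr0 ?mxE ?eqxx ?expr1n// => k kj.
by rewrite mxE (negbTE kj) expr0n.
Qed.

Lemma l1_delta (j : 'I_p) : l1 (delta_mx j ord0 : 'cV[R]_p) = 1.
Proof.
rewrite /l1 (bigD1 j)//= big1 ?addr0 ?mxE ?eqxx ?normr1// => k kj.
by rewrite mxE (negbTE kj) normr0.
Qed.

Lemma supp_delta (j : 'I_p) : supp (delta_mx j ord0 : 'cV[R]_p) = [set j]%SET.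
Proof. by apply/setP => k; rewrite !inE mxE andbT pnatr_eq0 eqb0 negbK. Qed.

Lemma supp_card_gt0 (d : 'cV[R]_p) i : d i ord0 != 0 -> (0 < #|supp d|)%N.
Proof. by move=> di; apply/card_gt0P; exists i; rewrite inE. Qed.

Lemma l1_ge_coord (d : 'cV[R]_p) i : `|d i ord0| <= l1 d.
Proof. by rewrite /l1 (bigD1 i)//= lerDl sumr_ge0. Qed.

Lemma l1_on_ge_coord (S : {set 'I_p}) (d : 'cV[R]_p) i : i \in S -> `|d i ord0| <= l1_on S d.
Proof. by move=> iS; rewrite /l1_on (bigD1 i)//= lerDl sumr_ge0. Qed.

Lemma sqnorm_ge_coord (d : 'cV[R]_p) i : d i ord0 ^+ 2 <= sqnorm d.
Proof. by rewrite /sqnorm (bigD1 i)//= lerDl sumr_ge0// => *; exact: sqr_ge0. Qed.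

Lemma phi_c_ge0 S : 0 <= phi_c X S.
Proof.
apply: inf_ge0 => _ [b [_ _ ->]].
by rewrite divr_ge0 ?mulr_ge0 ?norm2_ge0 ?sqrtr_ge0 ?normX_ge0 ?l1_on_ge0.
Qed.

Lemma phibar_ge0 s : 0 <= phibar X s.
Proof.
apply: inf_ge0 => _ [b [_ _ ->]].
by rewrite divr_ge0 ?mulr_ge0 ?norm2_ge0 ?sqrtr_ge0 ?normX_ge0 ?l1_ge0.
Qed.

Lemma phitilde_ge0 s : 0 <= phitilde X s.
Proof.
apply: inf_ge0 => _ [b [_ _ ->]].
by rewrite divr_ge0 ?mulr_ge0 ?norm2_ge0 ?normX_ge0.
Qed.

(** The defining infimum, squared and cleared of its denominator; a nonzero coordinate in S makes
    that denominator positive. *)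
Lemma phi_c_sq S (d : 'cV[R]_p) i : l1_on (~: S) d <= 7 * l1_on S d -> i \in S -> d i ord0 != 0 ->
  (phi_c X S * N * l1_on S d) ^+ 2 <= sqnorm (X *m d) * #|S|%:R.
Proof.
move=> cone iS di.
have a0 : 0 < l1_on S d by rewrite (lt_le_trans _ (l1_on_ge_coord d iS))// normr_gt0.
rewrite -sqnorm_norm2 -[#|S|%:R]sqr_sqrtr// -exprMn lerXn2r ?nnegrE.
- by [].
- by rewrite !mulr_ge0 ?phi_c_ge0 ?normX_ge0 ?l1_on_ge0.
- by rewrite mulr_ge0 ?norm2_ge0 ?sqrtr_ge0.
rewrite -mulrA -ler_pdivlMr ?mulr_gt0//; apply: inf_le_mem.
  move=> _ [b [_ _ ->]].
  by rewrite divr_ge0 ?mulr_ge0 ?norm2_ge0 ?sqrtr_ge0 ?normX_ge0 ?l1_on_ge0.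
exists d; split=> //; apply/existsP; exists i; by rewrite iS.
Qed.

Lemma phibar_sq s (d : 'cV[R]_p) i : d i ord0 != 0 -> #|supp d|%:R <= s ->
  (phibar X s * N * l1 d) ^+ 2 <= sqnorm (X *m d) * #|supp d|%:R.
Proof.
move=> di ds.
have a0 : 0 < l1 d by rewrite (lt_le_trans _ (l1_ge_coord d i))// normr_gt0.
rewrite -sqnorm_norm2 -[#|_|%:R in leRHS]sqr_sqrtr// -exprMn lerXn2r ?nnegrE.
- by [].
- by rewrite !mulr_ge0 ?phibar_ge0 ?normX_ge0 ?l1_ge0.
- by rewrite mulr_ge0 ?norm2_ge0 ?sqrtr_ge0.
rewrite -mulrA -ler_pdivlMr ?mulr_gt0//; apply: inf_le_mem.
  move=> _ [b [_ _ ->]].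
  by rewrite divr_ge0 ?mulr_ge0 ?norm2_ge0 ?sqrtr_ge0 ?normX_ge0 ?l1_ge0.
by exists d; split=> //; exact: supp_card_gt0 di.
Qed.

Lemma phitilde_sq s (d : 'cV[R]_p) i : d i ord0 != 0 -> #|supp d|%:R <= s ->
  (phitilde X s * N) ^+ 2 * sqnorm d <= sqnorm (X *m d).
Proof.
move=> di ds.
have a0 : 0 < norm2 d.
  by rewrite sqrtr_gt0 (lt_le_trans _ (sqnorm_ge_coord d i))// exprn_even_gt0.
rewrite -!sqnorm_norm2 -exprMn lerXn2r ?nnegrE.
- by [].
- by rewrite !mulr_ge0 ?phitilde_ge0 ?normX_ge0 ?norm2_ge0.
- exact: norm2_ge0.
rewrite -mulrA -ler_pdivlMr ?mulr_gt0//; apply: inf_le_mem.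
  move=> _ [b [_ _ ->]].
  by rewrite divr_ge0 ?mulr_ge0 ?norm2_ge0 ?normX_ge0.
by exists d; split=> //; exact: supp_card_gt0 di.
Qed.

Lemma phitilde_col s j : 1 <= s -> phitilde X s * N <= colnorm X j.
Proof.
move=> s1; have := @phitilde_sq s (delta_mx j ord0) j.
rewrite supp_delta cards1 sqnorm_delta mulr1 mxE !eqxx oner_eq0 => /(_ isT s1).
rewrite -colE -sqnorm_norm2 ler_pXn2r ?nnegrE ?norm2_ge0//.
by rewrite mulr_ge0 ?phitilde_ge0 ?normX_ge0.
Qed.

Lemma phitilde_le1 s (j : 'I_p) : 1 <= s -> phitilde X s <= 1.
Proof.
by move=> s1; rewrite -(ler_pM2r XN) mul1r (le_trans (phitilde_col j s1))// colnorm_le.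
Qed.

Lemma phibar_le1 s (j : 'I_p) : 1 <= s -> phibar X s <= 1.
Proof.
move=> s1; have := @phibar_sq s (delta_mx j ord0) j.
rewrite supp_delta cards1 l1_delta !mulr1 mxE !eqxx oner_eq0 => /(_ isT s1).
rewrite -colE -sqnorm_norm2 ler_pXn2r ?nnegrE ?norm2_ge0//; last first.
  by rewrite mulr_ge0 ?phibar_ge0 ?normX_ge0.
by move=> H; rewrite -(ler_pM2r XN) mul1r (le_trans H)// colnorm_le.
Qed.

Lemma sqnormD_dot m (v w : 'cV[R]_m) : sqnorm (v + w) = sqnorm v + 2 * dot v w + sqnorm w.
Proof.
rewrite /sqnorm /dot mulr_sumr -!big_split/=; apply: eq_bigr => i _; rewrite mxE; ring.
Qed.

(* The signs are chosen one at a time, so that the cross term never increases the norm. *)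
Lemma sign_vector (l : seq 'I_p) : uniq l -> exists b : 'cV[R]_p,
  [/\ forall i, i \in l -> `|b i ord0| = 1, forall i, i \notin l -> b i ord0 = 0 &
      sqnorm (X *m b) <= (size l)%:R * N ^+ 2].
Proof.
elim: l => [_|j l IH /= /andP[jl ul]].
  exists 0; split=> // [i _|]; first by rewrite mxE.
  by rewrite mulmx0 mul0r /sqnorm big1// => i _; rewrite mxE expr0n.
have [b [b1 b2 b3]] := IH ul.
pose e : R := if dot (X *m b) (col j X) <= 0 then 1 else - 1.
have e1 : e ^+ 2 = 1 by rewrite /e; case: ifP; rewrite ?sqrrN expr1n.
have ed : dot (X *m b) (e *: col j X) <= 0.
  rewrite dotZr /e; case: ifPn => [|]; first by rewrite mul1r.
  by rewrite -ltNge mulN1r oppr_le0 => /ltW.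
exists (b + e *: delta_mx j ord0); split.
- move=> i; rewrite inE !mxE andbT; have [->{i} _|ij /= il] := eqVneq i j.
    by rewrite (b2 _ jl) add0r mulr1 /e; case: ifP; rewrite ?normrN normr1.
  by rewrite mulr0 addr0 b1.
- move=> i; rewrite inE negb_or !mxE => /andP[/negbTE -> il].
  by rewrite b2// mulr0 addr0.
- rewrite mulmxDr -scalemxAr -colE sqnormD_dot sqnormZ e1 mul1r.
  have -> : (size l).+1%:R * N ^+ 2 = (size l)%:R * N ^+ 2 + N ^+ 2 by rewrite -natr1 mulrDl mul1r.
  by have := sqnorm_col_le X j; lra.
Qed.

(** A unit vector would only give the bound sqrt |S|. A sign vector on S has l1 norm |S|, and with
    well-chosen signs its image has squared norm at most |S| |X|^2, which gives exactly 1. *)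
Lemma phi_c_le1 (S : {set 'I_p}) i : i \in S -> phi_c X S <= 1.
Proof.
move=> iS; have [b [b1 b2 b3]] := sign_vector (enum_uniq S).
have bS : l1_on S b = #|S|%:R.
  by rewrite /l1_on (eq_bigr (fun=> 1)) ?sumr_const// => j jS; rewrite b1 ?mem_enum.
have bC : l1_on (~: S) b = 0.
  by rewrite /l1_on big1// => j; rewrite inE => jS; rewrite b2 ?mem_enum ?normr0.
have S0 : 0 < #|S|%:R :> R by rewrite ltr0n; apply/card_gt0P; exists i.
have := @phi_c_sq S b i; rewrite bC bS iS.
have -> : b i ord0 != 0 by rewrite -normr_eq0 b1 ?mem_enum ?oner_eq0.
rewrite mulr_ge0// => /(_ isT isT isT) H.
have {}H := le_trans H (ler_wpM2r (ltW S0) b3).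
have : phi_c X S ^+ 2 <= 1.
  rewrite -(@ler_pM2r _ ((N * #|S|%:R) ^+ 2)) ?exprn_gt0 ?mulr_gt0//.
  by move: H; rewrite -cardE; lra.
by rewrite expr_le1// phi_c_ge0.
Qed.

Definition restrict (T : {set 'I_p}) (d : 'cV[R]_p) : 'cV[R]_p :=
  \col_j (if j \in T then d j ord0 else 0).

Lemma l1_restrict T d : l1 (restrict T d) = l1_on T d.
Proof.
rewrite /l1 /l1_on [RHS]big_mkcond; apply: eq_bigr => j _; rewrite mxE.
by case: ifP => //; rewrite normr0.
Qed.

(* Maurey's sampling argument, with a greedy choice of the atoms in place of the average. *)
Lemma maurey (T : {set 'I_p}) (d : 'cV[R]_p) m : exists f : 'cV[R]_p,
  [/\ supp f \subset T, (#|supp f| <= m)%N &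
      sqnorm (X *m (f - m%:R *: restrict T d)) <= m%:R * (2 * N * l1_on T d) ^+ 2].
Proof.
set v := restrict T d; set b := l1_on T d.
have b0 : 0 <= b := l1_on_ge0 _ _.
elim: m => [|m [f [fT fm fq]]].
  exists 0; have s0 : supp (0 : 'cV[R]_p) = finset.set0 by apply/setP => j; rewrite !inE mxE eqxx.
  split; rewrite ?s0 ?finset.sub0set ?cards0// mulr0n scale0r subr0 mulmx0 mul0r.
  by rewrite /sqnorm big1// => i _; rewrite mxE expr0n.
pose r := X *m (f - m%:R *: v).
pose atom j : 'cV[R]_p := (b * Num.sg (d j ord0)) *: delta_mx j ord0.
(* The average of the atoms with weights |d_j|/b is v, so the corresponding average of these inner
   products is zero and one of them is not positive. *)
have b1 : b <= 0 \/ exists2 j, j \in T & dot r (X *m (atom j - v)) <= 0.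
  have [|bp] := leP b 0; [by left|right]; apply: contrapT => H.
  have Hj j : j \in T -> 0 < dot r (X *m (atom j - v)).
    by move=> jT; rewrite ltNge; apply/negP => jr; apply: H; exists j.
  have : 0 < \sum_(j in T) `|d j ord0| * dot r (X *m (atom j - v)).
    rewrite lt_def sumr_ge0 ?andbT; last by move=> j jT; rewrite mulr_ge0 ?(ltW (Hj j jT)).
    apply/eqP => s0; have := bp; rewrite /b /l1_on big1 ?ltxx// => j jT.
    apply/eqP; have/eqP := psumr_eq0P (fun k kT => mulr_ge0 (normr_ge0 _) (ltW (Hj k kT))) s0 jT.
    by rewrite mulf_eq0 (gt_eqF (Hj j jT)) orbF.
  rewrite (eq_bigr (fun j => b * (v j ord0 * dot r (col j X)) - `|d j ord0| * dot r (X *m v))); last first.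
    move=> j jT; rewrite mulmxBr dotC dotBl !(dotC _ r) /atom -scalemxAr -colE dotZr mxE jT.
    have := numEsg (d j ord0); move: (Num.sg _) `|_| => s y ->; ring.
  rewrite sumrB -mulr_sumr -mulr_suml -/b.
  have -> : \sum_(j in T) v j ord0 * dot r (col j X) = dot r (X *m v).
    rewrite dot_mulmxr [LHS]big_mkcond; apply: eq_bigr => j _.
    by rewrite mxE; case: (j \in T); rewrite ?mul0r.
  by rewrite subrr ltxx.
case: b1 => [bn|[j jT jr]].
  have bz : b = 0 by apply/eqP; rewrite eq_le bn b0.
  have vz : v = 0.
    apply/matrixP => j c; rewrite ord1 !mxE; case: ifP => // jT.
    apply/eqP; rewrite -normr_eq0 eq_le normr_ge0 andbT -bz; exact: l1_on_ge_coord.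
  exists f; split=> //; first exact: leqW.
  by move: fq; rewrite vz !scaler0 bz !mulr0 expr0n/= !mulr0.
exists (f + atom j); split.
- apply/fintype.subsetP => k; rewrite inE !mxE andbT; have [->//|kj] := eqVneq k j.
  by rewrite mulr0 addr0 => fk; apply: (fintype.subsetP fT); rewrite inE.
- apply: (@leq_trans #|j |: supp f|); last by rewrite cardsU1 -add1n leq_add// leq_b1.
  apply: subset_leq_card; apply/fintype.subsetP => k; rewrite !inE !mxE andbT.
  by have [//|kj] := eqVneq k j; rewrite mulr0 addr0.
- have -> : f + atom j - m.+1%:R *: v = (f - m%:R *: v) + (atom j - v).
    by rewrite -natr1 scalerDl scale1r opprD addrACA.
  rewrite mulmxDr sqnormD_dot -/r.
  have q : sqnorm (X *m (atom j - v)) <= (2 * N * b) ^+ 2.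
    apply: le_trans (sqnorm_mulmx_le _ _) _.
    rewrite lerXn2r ?nnegrE ?mulr_ge0 ?l1_ge0 ?normX_ge0//.
    rewrite (_ : 2 * N * b = N * (b + b)); last by ring.
    rewrite ler_wpM2l ?normX_ge0//.
    have -> : b + b = l1 (atom j) + l1 v + (b - l1 (atom j)) by rewrite /v l1_restrict -/b; ring.
    apply: (@le_trans _ _ (l1 (atom j) + l1 v)).
      by rewrite /l1 -big_split/=; apply: ler_sum => k _; rewrite !mxE ler_normB.
    rewrite lerDl subr_ge0.
    rewrite /l1 (bigD1 j)//= big1 ?addr0; last by move=> k kj; rewrite !mxE (negbTE kj) mulr0 normr0.
    rewrite !mxE !eqxx mulr1 normrM (ger0_norm b0) ler_piMr//.
    by rewrite normr_sg; case: (_ != 0).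
  have -> : m.+1%:R * (2 * N * b) ^+ 2 = m%:R * (2 * N * b) ^+ 2 + (2 * N * b) ^+ 2.
    by rewrite -natr1 mulrDl mul1r.
  by move: fq jr; rewrite -/r; lra.
Qed.

(** On S the vector is kept; off S it is replaced by the mean of k atoms, whose error has squared
    image at most 4 (|X| |d_(S^c)|_1)^2 / k. The bound |u + v|^2 <= 2 |u|^2 + 2 |v|^2 doubles both
    terms. *)
Lemma sparsify (S : {set 'I_p}) (d : 'cV[R]_p) k : (0 < k)%N -> exists e : 'cV[R]_p,
  [/\ forall i, i \in S -> e i ord0 = d i ord0, (#|supp e| <= #|S| + k)%N &
      sqnorm (X *m e) <= 2 * sqnorm (X *m d) + 8 * (N * l1_on (~: S) d) ^+ 2 / k%:R].
Proof.
move=> k0; have [f [fT fk fq]] := maurey (~: S) d k.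
have kp : 0 < k%:R :> R by rewrite ltr0n.
pose g := k%:R^-1 *: f - restrict (~: S) d.
exists (d + g); split.
- move=> i iS; rewrite !mxE (supp_notin fT) ?inE ?iS// mulr0 subr0 addr0//.
- apply: (@leq_trans #|S :|: supp f|); last by rewrite cardsU (leq_trans (leq_subr _ _))// leq_add2l.
  apply: subset_leq_card; apply/fintype.subsetP => i; rewrite !inE !mxE !inE.
  case: (i \in S) => //=; apply: contraNN => /eqP ->.
  by rewrite mulr0 sub0r subrr.
have gq : sqnorm (X *m g) <= 4 * (N * l1_on (~: S) d) ^+ 2 / k%:R.
  have gE : g = k%:R^-1 *: (f - k%:R *: restrict (~: S) d).
    by rewrite scalerBr scalerA mulVf ?scale1r// gt_eqF.
  rewrite gE -scalemxAr sqnormZ ler_pdivlMr// -(ler_pM2r kp).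
  rewrite [leLHS](_ : _ = sqnorm (X *m (f - k%:R *: restrict (~: S) d))); last by field; rewrite gt_eqF.
  by apply: le_trans fq _; rewrite le_eqVlt; apply/orP; left; apply/eqP; ring.
rewrite mulmxDr sqnormD_dot.
by have := norm_dot_le (X *m d) (X *m g); rewrite ler_norml => /andP[_]; lra.
Qed.

End Compat.

(** * Vectors of negligible posterior mass *)

Section Budget.
Variable R : realType.
Variables (p : nat) (A3 A4 : R).
Hypotheses (A3_gt0 : 0 < A3) (A4_gt0 : 0 < A4).
Notation L := (ln (p%:R : R)).
Hypothesis L20 : 20 <= L.

(* The fraction of the quadratic term kept in reserve against the prior slack. *)
Definition frac : R := Num.min A4 1 / 1200.

Lemma frac_gt0 : 0 < frac.
Proof. by have : 0 < Num.min A4 1; [rewrite lt_min A4_gt0 ltr01|rewrite /frac; lra]. Qed.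

Lemma frac_leA : 1200 * frac <= A4.
Proof. by have : Num.min A4 1 <= A4; [rewrite ge_min lexx|rewrite /frac; lra]. Qed.

Lemma frac_le1 : 1200 * frac <= 1.
Proof. by have : Num.min A4 1 <= 1; [rewrite ge_min lexx orbT|rewrite /frac; lra]. Qed.

Definition absorbed (s0 s : nat) (x : R) : Prop :=
  x + 12 * frac * (s%:R + s0%:R) * L <= budget p A3 A4 s0 s.

(** By the choice of [frac] the entropy term is at most (A4 max(s - s0, 0)/100 + s0/50) L; the unit
    separating A3 + 6 from the A3 + 5 of [budget] covers the part in s0. *)
Lemma absorb_low s0 s x : x <= - (A3 + 6) * s0%:R * L -> absorbed s0 s x.
Proof.
rewrite /absorbed /budget => xb.
have [fA f1] := (frac_leA, frac_le1); have f0 := ltW frac_gt0.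
have L0 : 0 <= L by apply: le_trans L20.
have s00 : 0 <= s0%:R :> R by [].
have A3s : 0 <= A3 * s0%:R by rewrite mulr_ge0// ltW.
have fs0 : 1200 * frac * s0%:R <= 1 * s0%:R by rewrite ler_wpM2r.
case: ifPn => [|]; rewrite -?ltnNge => ss.
  have t0 : 0 <= s%:R - s0%:R :> R by rewrite subr_ge0 ler_nat.
  have ft : 1200 * frac * (s%:R - s0%:R) <= A4 * (s%:R - s0%:R) by rewrite ler_wpM2r.
  have At : 0 <= A4 * (s%:R - s0%:R) by rewrite mulr_ge0// ltW.
  apply: le_trans (lerD xb (lexx _)) _; rewrite -mulrDl ler_wpM2r//; lra.
have fs : frac * s%:R <= frac * s0%:R by rewrite ler_wpM2l// ler_nat ltnW.
apply: le_trans (lerD xb (lexx _)) _; rewrite -mulrDl ler_wpM2r//; lra.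
Qed.

(** After the entropy the prior still pays 0.89 A4 (s - s0), at least (2.67 + 29 A4 y) s0, against a
    need of (2.22 + 4.5 A4 y) s0. As |supp d| <= (s - s0) + 2 s0, the excess required here with y =
    rho/phi^2 matches [psi_arg]. *)
Lemma absorb_far s0 s x (y : R) : 0 <= y -> (3 / A4 + 33 * y) * s0%:R <= s%:R - s0%:R ->
  x <= 9 / 2 * A4 * y * s0%:R * L -> absorbed s0 s x.
Proof.
move=> y0 ts xb; rewrite /absorbed /budget.
have [fA f1] := (frac_leA, frac_le1); have f0 := ltW frac_gt0.
have L0 : 0 <= L by apply: le_trans L20.
have s00 : 0 <= s0%:R :> R by [].
have fs0 : 1200 * frac * s0%:R <= 1 * s0%:R by rewrite ler_wpM2r.
have t0 : 0 <= s%:R - s0%:R :> R.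
  by apply: le_trans ts; rewrite mulr_ge0// addr_ge0 ?divr_ge0 ?(ltW A4_gt0)// mulr_ge0.
rewrite ifT; last by move: t0; rewrite subr_ge0 ler_nat.
have ft : 1200 * frac * (s%:R - s0%:R) <= A4 * (s%:R - s0%:R) by rewrite ler_wpM2r.
have At : (3 + 33 * A4 * y) * s0%:R <= A4 * (s%:R - s0%:R).
  rewrite [leLHS](_ : _ = A4 * ((3 / A4 + 33 * y) * s0%:R)); last by field; rewrite gt_eqF.
  by rewrite ler_wpM2l// ltW.
have Ay : 0 <= A4 * y * s0%:R by rewrite !mulr_ge0// ltW.
apply: le_trans (lerD xb (lexx _)) _; rewrite -mulrDl ler_wpM2r//; lra.
Qed.

End Budget.

Section BadCases.
Variable R : realType.
Variables (n p : nat) (X : 'M[R]_(n, p)) (lam : R) (b0 : 'cV[R]_p) (A3 A4 : R).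
Hypotheses (A3_gt0 : 0 < A3) (A4_gt0 : 0 < A4).
Notation L := (ln (p%:R : R)).
Notation N := (normX X).
Hypothesis L20 : 20 <= L.
Hypothesis XN : 0 < N.
Hypothesis lam0 : 0 < lam.
Hypothesis lam2 : lam <= 2 * lambdabar X.
Notation s0 := (#|supp b0|).
Notation al := (frac A4).
Notation phi := (phi_c X (supp b0)).
Notation rho := (lam / lambdabar X).

Let L0 : 0 < L. Proof. by apply: lt_le_trans L20. Qed.

Lemma lambdabar_gt0 : 0 < lambdabar X.
Proof. by rewrite !mulr_gt0// sqrtr_gt0. Qed.

Lemma rho_gt0 : 0 < rho.
Proof. by rewrite divr_gt0// lambdabar_gt0. Qed.

Lemma rho_le2 : rho <= 2.
Proof. by rewrite ler_pdivrMr// lambdabar_gt0. Qed.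

Lemma lam_sq : lam ^+ 2 = 4 * rho ^+ 2 * N ^+ 2 * L.
Proof.
have : lam = rho * (2 * N * Num.sqrt L) by rewrite -/(lambdabar X) divfK// gt_eqF// lambdabar_gt0.
move: rho => r ->; rewrite !exprMn sqr_sqrtr ?ltW//; ring.
Qed.

Definition covered (S : {set 'I_p}) (b : 'cV[R]_p) : Prop :=
  absorbed p A3 A4 s0 #|S| (slack X lam al b0 b).

Section Vector.
Variables (S : {set 'I_p}) (b : 'cV[R]_p).
Hypothesis bS : supp b \subset S.
Notation d := (b - b0).
Notation q := (sqnorm (X *m d)).
Notation cone := (l1_on (~: supp b0) d <= 7 * l1_on (supp b0) d).

Lemma supp_diff : (#|supp d| <= #|S| + s0)%N.
Proof.
apply: (@leq_trans #|S :|: supp b0|); last by rewrite cardsU leq_subr.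
apply: subset_leq_card; apply/fintype.subsetP => i; rewrite !inE !mxE.
apply: contraNT; rewrite negb_or negbK => /andP[iS /eqP ->].
by rewrite (supp_notin bS iS) subr0.
Qed.

Lemma slack_noncone : ~~ cone -> slack X lam al b0 b <= - (al * q / 2).
Proof.
rewrite -ltNge => nc; rewrite /slack.
have h : lam * (7 * l1_on (supp b0) d) <= lam * l1_on (~: supp b0) d.
  by rewrite ler_wpM2l ?(ltW nc)// ltW.
have h0 : 0 <= lam * l1_on (supp b0) d by rewrite mulr_ge0 ?l1_on_ge0// ltW.
lra.
Qed.

(** Young's inequality for 3/2 lam a, where a is bounded by compatibility and lam = 2 rho |X| sqrt
    L. The parameter e is the share of the quadratic reserve al q/2 that is spent. *)
Lemma slack_cone (e : R) : 0 < e -> 0 < phi ->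
  (phi * N * l1_on (supp b0) d) ^+ 2 <= q * s0%:R ->
  slack X lam al b0 b <= - (al * q / 2) + e * q + 9 * rho ^+ 2 * s0%:R * L / (4 * e * phi ^+ 2).
Proof.
move=> e0 f0 H; rewrite /slack; set a := l1_on (supp b0) d in H *.
have q0 : 0 <= q := sqnorm_ge0 _.
have a0 : 0 <= a := l1_on_ge0 _ _.
have c0 : 0 <= lam * l1_on (~: supp b0) d by rewrite mulr_ge0 ?l1_on_ge0// ltW.
set z := _ * s0%:R * L / _.
have z0 : 0 <= z.
  have r20 : 0 <= rho ^+ 2 := sqr_ge0 _.
  have F0 : 0 < phi ^+ 2 by rewrite exprn_gt0.
  apply: divr_ge0; last by apply: mulr_ge0 (ltW F0); apply: mulr_ge0 => //; exact: ltW.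
  by apply: mulr_ge0 (ltW L0); apply: mulr_ge0 => //; apply: mulr_ge0.
suff : 3 / 2 * lam * a <= e * q + z by lra.
rewrite -ler_sqr ?nnegrE; last 2 first.
- by apply: mulr_ge0 => //; apply: mulr_ge0 (ltW lam0); rewrite divr_ge0.
- by apply: addr_ge0 => //; apply: mulr_ge0 => //; exact: ltW.
have am : 4 * (e * q * z) <= (e * q + z) ^+ 2 by have := sqr_ge0 (e * q - z); lra.
apply: le_trans am.
rewrite !exprMn lam_sq.
have {}H : (N * a) ^+ 2 <= q * s0%:R / phi ^+ 2.
  by rewrite ler_pdivlMr ?exprn_gt0//; move: H; rewrite !exprMn; lra.
have : 9 * rho ^+ 2 * L * (N * a) ^+ 2 <= 9 * rho ^+ 2 * L * (q * s0%:R / phi ^+ 2).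
  by rewrite ler_wpM2l//; apply: mulr_ge0 (ltW L0); apply: mulr_ge0 => //; exact: sqr_ge0.
rewrite [leRHS](_ : _ = 4 * (e * q * z)).
  by apply: le_trans; rewrite le_eqVlt; apply/orP; left; apply/eqP; set r := lam / _; field.
by rewrite /z; set r := lam / _; field; rewrite !gt_eqF.
Qed.

Lemma covered_noncone_far : ~~ cone -> 3 / A4 * s0%:R <= #|S|%:R - s0%:R -> covered S b.
Proof.
move=> nc far; apply: (@absorb_far _ p A3 A4 A4_gt0 L20 _ _ _ 0) => //.
  by rewrite mulr0 addr0.
rewrite mulr0 !mul0r; apply: le_trans (slack_noncone nc) _.
by rewrite oppr_le0 divr_ge0// mulr_ge0 ?sqnorm_ge0// ltW// frac_gt0.
Qed.

Lemma covered_noncone_large : ~~ cone -> 2 * (A3 + 6) * s0%:R * L <= al * q -> covered S b.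
Proof.
move=> nc large; apply: (absorb_low A3_gt0 A4_gt0 L20).
by apply: le_trans (slack_noncone nc) _; lra.
Qed.

(** Half of the reserve, e = al/4, goes to Young's inequality; with rho <= 2 its remainder is at
    most 36 s0 L/(al phi^2), which is al/4 times the term 144/al^2. The other half pays (A3 + 6) s0
    L. *)
Lemma covered_cone_large i : cone -> i \in supp b0 -> d i ord0 != 0 -> 0 < phi ->
  (144 / al ^+ 2 + 4 * (A3 + 6) / al) * s0%:R * L <= q * phi ^+ 2 -> covered S b.
Proof.
move=> cn iS di f0 large; apply: (absorb_low A3_gt0 A4_gt0 L20).
have al0 : 0 < al := frac_gt0 A4_gt0.
have e0 : 0 < al / 4 by rewrite divr_gt0.
apply: le_trans (slack_cone e0 f0 (phi_c_sq XN cn iS di)) _.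
have f1 : phi <= 1 by exact: phi_c_le1 iS.
have F0 : 0 < phi ^+ 2 by rewrite exprn_gt0.
have F1 : phi ^+ 2 <= 1 by rewrite expr_le1// ltW.
have r4 : rho ^+ 2 <= 4.
  rewrite (_ : 4 = 2 ^+ 2); last by ring.
  by rewrite lerXn2r ?nnegrE ?(ltW rho_gt0)// rho_le2.
have T0 : 0 <= s0%:R * L by rewrite mulr_ge0// ltW.
move: large r4; set F := phi ^+ 2 in F0 F1 *; set r := rho ^+ 2; set T := s0%:R * L in T0.
rewrite -!(mulrA _ s0%:R L) -/T => large r4.
have h1 : 9 * r * T / (4 * (al / 4) * F) <= 36 * T / (al * F).
  rewrite (_ : 4 * (al / 4) = al); last by field.
  rewrite ler_wpM2r ?invr_ge0 ?(ltW (mulr_gt0 al0 F0))// ler_wpM2r//; lra.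
have h2 : 36 * T / (al * F) + (A3 + 6) * T <= al / 4 * q.
  rewrite -(ler_pM2r F0).
  have h3 : (A3 + 6) * T * F <= (A3 + 6) * T.
    by rewrite ler_piMr// mulr_ge0// addr_ge0// ltW.
  rewrite [leLHS](_ : _ = 36 * T / al + (A3 + 6) * T * F); last by field; rewrite !gt_eqF.
  have h4 : al / 4 * ((144 / al ^+ 2 + 4 * (A3 + 6) / al) * T) <= al / 4 * (q * F).
    by rewrite ler_wpM2l// ltW.
  rewrite [leLHS](_ : _ = 36 * T / al + (A3 + 6) * T) in h4; last by field; rewrite gt_eqF.
  by apply: le_trans (lerD (lexx _) h3) _; apply: le_trans h4 _; rewrite mulrA.
lra.
Qed.

(** The whole reserve, e = al/2, goes to Young's inequality. The remainder is quadratic in rho, and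
    rho <= al A4 trades one factor rho/al for A4, the form that the excess of coordinates can
    pay. *)
Lemma covered_cone_far i : cone -> i \in supp b0 -> d i ord0 != 0 -> 0 < phi ->
  rho <= al * A4 -> (3 / A4 + 33 * (rho / phi ^+ 2)) * s0%:R <= #|S|%:R - s0%:R -> covered S b.
Proof.
move=> cn iS di f0 rl far.
have al0 : 0 < al := frac_gt0 A4_gt0.
have e0 : 0 < al / 2 by rewrite divr_gt0.
have F0 : 0 < phi ^+ 2 by rewrite exprn_gt0.
apply: (@absorb_far _ p A3 A4 A4_gt0 L20 _ _ _ (rho / phi ^+ 2)) => //.
  by rewrite divr_ge0 ?(ltW rho_gt0) ?(ltW F0).
apply: le_trans (slack_cone e0 f0 (phi_c_sq XN cn iS di)) _.
have r0 := rho_gt0; move: rl r0; set r := rho => rl r0.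
have -> : - (al * q / 2) + al / 2 * q = 0 by field.
rewrite add0r [leLHS](_ : _ = (9 / 2 * (r / al) * (r / phi ^+ 2)) * s0%:R * L); last first.
  by field; rewrite !gt_eqF.
have rF : 0 <= r / phi ^+ 2 := divr_ge0 (ltW r0) (ltW F0).
rewrite ler_wpM2r ?(ltW L0)// ler_wpM2r// ler_wpM2r//.
by rewrite ler_wpM2l// ler_pdivrMr// mulrC.
Qed.

End Vector.
End BadCases.

(** * Missed coordinates above the thresholds of the first two claims *)

Section Missed.
Variable R : realType.
Variables (n p : nat) (X : 'M[R]_(n, p)) (lam : R) (b0 : 'cV[R]_p) (A3 A4 M : R).
Hypotheses (A3_gt0 : 0 < A3) (A4_gt0 : 0 < A4).
Notation L := (ln (p%:R : R)).
Notation N := (normX X).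
Hypothesis L20 : 20 <= L.
Hypothesis XN : 0 < N.
Hypothesis lam0 : 0 < lam.
Hypothesis lam2 : lam <= 2 * lambdabar X.
Notation s0 := (#|supp b0|).
Notation al := (frac A4).
Notation phi := (phi_c X (supp b0)).
Notation rho := (lam / lambdabar X).

Definition signal_base : R := 144 / al ^+ 2 + 4 * (A3 + 6) / al.
(** The second factor dominates every loss met below: 1 for direct use, 2 + 3/A4 for |supp d|/s0
    with [phibar], and 2 + 24/(al A4) for a sparsified copy. *)
Definition signal_const : R := signal_base * (2 + 3 / A4 + 24 / (al * A4)).

Let al0 : 0 < al. Proof. exact: frac_gt0. Qed.
Let L0 : 0 < L. Proof. by apply: lt_le_trans L20. Qed.

Lemma signal_base_gt0 : 0 < signal_base.
Proof.
rewrite addr_gt0// divr_gt0// ?exprn_gt0// mulr_gt0// addr_gt0//.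
Qed.

Lemma signal_base_ge : 4 * (A3 + 6) <= al * signal_base.
Proof.
have -> : al * signal_base = 144 / al + 4 * (A3 + 6) by rewrite /signal_base; field; rewrite gt_eqF.
by rewrite lerDr divr_ge0// ltW.
Qed.

Lemma psi_arg_ge : (2 + 3 / A4) * s0%:R <= psi_arg A4 lam X (supp b0).
Proof.
rewrite /psi_arg ler_wpM2r// lerDl mulr_ge0 ?(ltW (rho_gt0 L20 XN lam0))//.
by rewrite divr_ge0// sqr_ge0.
Qed.

Lemma psi_arg_ge1 : (0 < s0)%N -> 1 <= psi_arg A4 lam X (supp b0).
Proof.
move=> s00; apply: le_trans psi_arg_ge.
have s1 : 1 <= s0%:R :> R by rewrite ler1n.
have : 0 <= 3 / A4 by rewrite divr_ge0// ltW.
nra.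
Qed.

Hypothesis M2 : signal_const <= M ^+ 2.

Lemma signal_le (x y c : R) : 0 <= x -> 0 < c <= 2 + 3 / A4 + 24 / (al * A4) ->
  M ^+ 2 * x <= c * y -> signal_base * x <= y.
Proof.
move=> x0 /andP[c0 cK] H; rewrite -(ler_pM2l c0); apply: le_trans H.
apply: (@le_trans _ _ (signal_const * x)); last by rewrite ler_wpM2r.
rewrite mulrA; apply: (ler_wpM2r x0); rewrite mulrC; apply: ler_wpM2l => //.
exact: ltW signal_base_gt0.
Qed.

Variables (S : {set 'I_p}) (b : 'cV[R]_p) (i : 'I_p).
Hypotheses (bS : supp b \subset S) (iS : i \notin S) (i0 : i \in supp b0).
Notation d := (b - b0).
Notation q := (sqnorm (X *m d)).
Notation cone := (l1_on (~: supp b0) d <= 7 * l1_on (supp b0) d).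
Notation D := `|b0 i ord0|.

Lemma missed_coord : d i ord0 = - b0 i ord0.
Proof. by rewrite !mxE (supp_notin bS iS) sub0r. Qed.

Lemma missed_neq0 : d i ord0 != 0.
Proof. by rewrite missed_coord oppr_eq0; move: i0; rewrite inE. Qed.

Lemma missed_norm : `|d i ord0| = D.
Proof. by rewrite missed_coord normrN. Qed.

Let s00 : (0 < s0)%N. Proof. by apply/card_gt0P; exists i. Qed.
Let s0R : 0 < s0%:R :> R. Proof. by rewrite ltr0n. Qed.
Let sL : 0 <= s0%:R * L. Proof. by rewrite mulr_ge0// ltW. Qed.
Let q0 : 0 <= q. Proof. exact: sqnorm_ge0. Qed.
Let phi1 : phi <= 1. Proof. exact: phi_c_le1 i0. Qed.
Let phi0 : 0 <= phi. Proof. exact: phi_c_ge0. Qed.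

Lemma supp_diff_near : #|S|%:R - s0%:R <= 3 / A4 * s0%:R -> #|supp d|%:R <= (2 + 3 / A4) * s0%:R :> R.
Proof.
move=> near; have : #|supp d|%:R <= (#|S| + s0)%:R :> R by rewrite ler_nat supp_diff.
by rewrite natrD; lra.
Qed.

Lemma base_noncone : signal_base * (s0%:R * L) <= q -> ~~ cone -> covered X lam b0 A3 A4 S b.
Proof.
move=> H nc; apply: covered_noncone_large => //.
have h1 : al * (signal_base * (s0%:R * L)) <= al * q by rewrite ler_wpM2l// ltW.
have h2 : 4 * (A3 + 6) * (s0%:R * L) <= al * signal_base * (s0%:R * L).
  by rewrite ler_wpM2r// signal_base_ge.
have h3 : 0 <= (A3 + 6) * (s0%:R * L) by rewrite mulr_ge0// addr_ge0// ltW.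
lra.
Qed.

Lemma base_cone : 0 < phi -> signal_base * (s0%:R * L) <= q * phi ^+ 2 -> cone ->
  covered X lam b0 A3 A4 S b.
Proof.
move=> f0 H cn; apply: (covered_cone_large A3_gt0 A4_gt0 L20 XN lam0 lam2 S cn i0 missed_neq0 f0).
by rewrite -mulrA.
Qed.

Let sqrtLL : Num.sqrt L ^+ 2 = L. Proof. by rewrite sqr_sqrtr// ltW. Qed.
Let c1 : 0 < 2 + 3 / A4. Proof. by rewrite addr_gt0// divr_gt0. Qed.
Let c2 : 0 < 24 / (al * A4). Proof. by rewrite divr_gt0// mulr_gt0. Qed.

(** In the cone, one factor phi turns |b0_i| <= |d_(S0)|_1 into a bound on |Xd|, and the other is
    the price of Young's inequality. Outside it, either S is far too large or d is sparse enough for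
    [phibar]. Since both constants are at most 1, one threshold serves all cases. *)
Lemma covered_sel1 : i \in sel1 M A4 lam X b0 -> 0 < M -> covered X lam b0 A3 A4 S b.
Proof.
rewrite inE => /andP[_]; set psi := psibar _ _ _ _ => sel Mp.
have psi0 : 0 <= psi := phibar_ge0 _ _.
have psi1 : psi <= 1 by exact: (phibar_le1 XN i (psi_arg_ge1 s00)).
have sL0 : 0 < M * s0%:R * Num.sqrt L by rewrite !mulr_gt0// sqrtr_gt0.
(* In the cleared form of the threshold, phi = 0 would make the right side vanish while the left
   side is positive. *)
have f0 : 0 < phi.
  rewrite lt_def phi0 andbT; apply: contraTneq sel => ->.
  by rewrite expr0n/= !mulr0 -ltNge.
have D0 : 0 <= D := normr_ge0 _.
have {}sel : M ^+ 2 * (s0%:R * L) * s0%:R <= (psi * phi * N * D) ^+ 2 * phi ^+ 2 /\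
    psi ^+ 2 * phi ^+ 2 <= 1.
  split; last by rewrite mulr_ile1 ?sqr_ge0// expr_le1.
  have : (M * s0%:R * Num.sqrt L) ^+ 2 <= (psi * (psi * phi * N * D) * phi) ^+ 2.
    rewrite lerXn2r ?nnegrE ?(ltW sL0)//.
      by rewrite !mulr_ge0// ltW.
    by apply: le_trans sel _; rewrite le_eqVlt; apply/orP; left; apply/eqP; ring.
  rewrite !exprMn sqrtLL => h.
  rewrite [leLHS](_ : _ = M ^+ 2 * s0%:R ^+ 2 * L); last by ring.
  apply: le_trans h _; rewrite ler_wpM2r ?sqr_ge0// ler_piMl ?expr_le1//.
  by rewrite !mulr_ge0 ?(ltW XN).
case: sel => sel le1.
have [cn|nc] := boolP cone.
  apply: base_cone => //; apply: (@signal_le _ _ 1) => //.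
    rewrite ltr01/= -addrA; have := ltW c2; have : 0 <= 3 / A4 by rewrite divr_ge0// ltW.
    lra.
  rewrite mul1r -(ler_pM2r s0R); apply: le_trans sel _.
  rewrite [leRHS](_ : _ = q * s0%:R * phi ^+ 2); last by ring.
  rewrite ler_wpM2r ?sqr_ge0//.
  apply: le_trans (phi_c_sq XN cn i0 missed_neq0).
  rewrite lerXn2r ?nnegrE ?mulr_ge0 ?l1_on_ge0 ?(ltW XN)//.
  apply: ler_pM; rewrite ?mulr_ge0 ?(ltW XN)//; last by rewrite -missed_norm l1_on_ge_coord.
  by rewrite ler_wpM2r ?(ltW XN)// ler_piMl.
have [far|near] := leP (3 / A4 * s0%:R) (#|S|%:R - s0%:R).
  exact: covered_noncone_far.
apply: base_noncone => //; apply: (@signal_le _ _ (2 + 3 / A4)) => //.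
  by rewrite c1/= lerDl ltW.
have ds := supp_diff_near (ltW near).
have B := phibar_sq XN missed_neq0 (le_trans ds psi_arg_ge).
rewrite -(ler_pM2r s0R); apply: le_trans sel _.
apply: (@le_trans _ _ (q * #|supp d|%:R)); last first.
  by apply: le_trans (ler_wpM2l q0 ds) _; rewrite le_eqVlt; apply/orP; left; apply/eqP; ring.
apply: le_trans B; rewrite -/psi.
apply: (@le_trans _ _ ((psi * N * D) ^+ 2)).
  rewrite !exprMn [leLHS](_ : _ = (psi ^+ 2 * N ^+ 2 * D ^+ 2) * (phi ^+ 2 * phi ^+ 2)); last by ring.
  have F1 : phi ^+ 2 <= 1 by rewrite expr_le1.
  by apply: ler_piMr; [rewrite !mulr_ge0 ?(ltW XN)|rewrite mulr_ile1 ?sqr_ge0].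
rewrite lerXn2r ?nnegrE ?mulr_ge0 ?l1_ge0 ?(ltW XN)//.
by apply: ler_wpM2l; [rewrite mulr_ge0 ?(ltW XN)|rewrite -missed_norm l1_ge_coord].
Qed.

(** [phitilde] bounds |Xd| directly by |d_i|, provided d is sparse. In the cone a large support is
    excluded by the prior only when rho is small, since the remainder in Young's inequality is of
    order rho^2/al; hence the case distinction on rho. *)
Lemma covered_sel2 : i \in sel2 M A4 lam X b0 -> 0 < M -> covered X lam b0 A3 A4 S b.
Proof.
rewrite inE => /andP[_]; set psi := psitilde _ _ _ _ => sel Mp.
have psi0 : 0 <= psi := phitilde_ge0 _ _.
have psi1 : psi <= 1 by exact: (phitilde_le1 XN i (psi_arg_ge1 s00)).
have sL0 : 0 < M * Num.sqrt (s0%:R * L) by rewrite !mulr_gt0// sqrtr_gt0 mulr_gt0.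
have f0 : 0 < phi.
  rewrite lt_def phi0 andbT; apply: contraTneq sel => ->.
  by rewrite !mulr0 -ltNge.
have F1 : phi ^+ 2 <= 1 by rewrite expr_le1.
have D0 : 0 <= D := normr_ge0 _.
have {}sel : M ^+ 2 * (s0%:R * L) <= (psi * N) ^+ 2 * D ^+ 2 * phi ^+ 2.
  have : (M * Num.sqrt (s0%:R * L)) ^+ 2 <= (psi * (psi * N * D * phi)) ^+ 2.
    rewrite lerXn2r ?nnegrE ?(ltW sL0)//.
      by rewrite !mulr_ge0// ltW.
    by apply: le_trans sel _; rewrite le_eqVlt; apply/orP; left; apply/eqP; ring.
  rewrite !exprMn sqr_sqrtr// => h; apply: le_trans h _.
  by rewrite ler_piMl ?expr_le1// !mulr_ge0 ?(ltW XN).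
have bound (e : 'cV[R]_p) : `|e i ord0| = D -> #|supp e|%:R <= psi_arg A4 lam X (supp b0) ->
    M ^+ 2 * (s0%:R * L) <= sqnorm (X *m e) * phi ^+ 2.
  move=> eD es; apply: le_trans sel _; rewrite ler_wpM2r ?sqr_ge0//.
  have e0 : e i ord0 != 0 by rewrite -normr_eq0 eD normr_eq0; move: i0; rewrite inE.
  apply: le_trans (phitilde_sq XN e0 es); rewrite ler_wpM2l ?sqr_ge0//.
  by rewrite -eD real_normK ?num_real// sqnorm_ge_coord.
have [cn|nc] := boolP cone; last first.
  have [far|near] := leP (3 / A4 * s0%:R) (#|S|%:R - s0%:R).
    exact: covered_noncone_far.
  apply: base_noncone => //; apply: (@signal_le _ _ 1) => //.
    rewrite ltr01/= -addrA; have := ltW c2; have : 0 <= 3 / A4 by rewrite divr_ge0// ltW.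
    lra.
  rewrite mul1r; have ds := supp_diff_near (ltW near).
  by apply: le_trans (bound d missed_norm (le_trans ds psi_arg_ge)) _; rewrite ler_piMr.
have F0 : 0 < phi ^+ 2 by rewrite exprn_gt0.
have [rl|rl] := leP rho (al * A4).
  have [dn|df] := leP (#|supp d|%:R : R) (psi_arg A4 lam X (supp b0)).
    apply: base_cone => //; apply: (@signal_le _ _ 1) => //.
      rewrite ltr01/= -addrA; have := ltW c2; have : 0 <= 3 / A4 by rewrite divr_ge0// ltW.
      lra.
    by rewrite mul1r; exact: bound missed_norm dn.
  apply: (covered_cone_far A3 A4_gt0 L20 XN lam0 cn i0 missed_neq0 f0 rl).
  have : #|supp d|%:R <= (#|S| + s0)%:R :> R by rewrite ler_nat supp_diff.
  move: df; rewrite /psi_arg natrD [33 / _ * _](_ : _ = 33 * (rho / phi ^+ 2)).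
    by set y := 33 * _; set z := 3 / A4; lra.
  by rewrite mulrAC mulrA.
(* For large [rho] the vector [d] may have too many coordinates for [psitilde]; a sparsified copy
   with [psi_arg] coordinates has a comparable image. *)
pose x := s0%:R * (1 + 33 * (al * A4) / phi ^+ 2).
have aA : 0 < al * A4 by rewrite mulr_gt0.
have x1 : 1 <= x.
  have s1 : 1 <= s0%:R :> R by rewrite ler1n.
  have y0 : 0 <= 33 * (al * A4) / phi ^+ 2 by apply: divr_ge0 (ltW F0); apply: mulr_ge0 (ltW aA).
  have : 0 <= s0%:R * (33 * (al * A4) / phi ^+ 2) by apply: mulr_ge0.
  by rewrite /x mulrDr mulr1; lra.
pose k := Num.truncn x.
have /andP[kx xk] : k%:R <= x < k.+1%:R by apply: truncn_itv; exact: le_trans x1.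
have k0 : (0 < k)%N by rewrite truncn_gt0.
have [e [eS ek eq]] := sparsify X (supp b0) d k0.
(* Since rho > al A4, the total s0 + x stays below [psi_arg]. *)
have es : #|supp e|%:R <= psi_arg A4 lam X (supp b0).
  apply: (@le_trans _ _ (s0%:R + x)); first by rewrite (le_trans (_ : _ <= (s0 + k)%:R)) ?ler_nat// natrD lerD2l.
  have h : 33 * (al * A4) / phi ^+ 2 <= 33 / phi ^+ 2 * rho.
    rewrite mulrAC; apply: ler_wpM2l (ltW rl); exact: divr_ge0 (ltW F0).
  have : s0%:R * (33 * (al * A4) / phi ^+ 2) <= s0%:R * (33 / phi ^+ 2 * rho) by rewrite ler_wpM2l.
  have : 0 <= s0%:R * (3 / A4) by rewrite mulr_ge0// divr_ge0// ltW.
  by rewrite /psi_arg /x; move: (33 / _ * rho) (33 * _ / _) (3 / A4) => y z w; lra.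
have eD : `|e i ord0| = D by rewrite eS// missed_norm.
have B := bound e eD es.
have H := phi_c_sq XN cn i0 missed_neq0.
have NB : (N * l1_on (~: supp b0) d) ^+ 2 <= 49 * q * s0%:R / phi ^+ 2.
  apply: (@le_trans _ _ ((7 * (N * l1_on (supp b0) d)) ^+ 2)).
    rewrite lerXn2r ?nnegrE ?mulr_ge0 ?l1_on_ge0 ?(ltW XN)// mulrCA ler_wpM2l ?(ltW XN)//.
  rewrite ler_pdivlMr// exprMn; move: H; rewrite -(mulrA phi) exprMn; set w := (_ * _) ^+ 2; lra.
(* As k >= 1, x < k + 1 <= 2 k: rounding down loses at most a factor 2. *)
have kl : 33 * (al * A4) * s0%:R / phi ^+ 2 <= 2 * k%:R.
  have k1 : 1 <= k%:R :> R by rewrite ler1n.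
  move: xk; rewrite -natr1 /x => xk.
  have s00' : 0 <= s0%:R :> R by [].
  have -> : 33 * (al * A4) * s0%:R / phi ^+ 2 = s0%:R * (33 * (al * A4) / phi ^+ 2) by ring.
  by move: xk; set z := _ / phi ^+ 2; lra.
have eq2 : sqnorm (X *m e) <= (2 + 24 / (al * A4)) * q.
  apply: le_trans eq _; rewrite [leRHS]mulrDl; apply: lerD => //; rewrite ler_pdivrMr ?ltr0n//.
  (* The cone constant gives 8 * 7^2 = 392, and the choice of k affords 12 * 33 = 396. *)
  apply: (@le_trans _ _ (8 * (49 * q * s0%:R / phi ^+ 2))); first by rewrite ler_wpM2l.
  have h : 12 / (al * A4) * q * (33 * (al * A4) * s0%:R / phi ^+ 2) <= 12 / (al * A4) * q * (2 * k%:R).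
    by rewrite ler_wpM2l// mulr_ge0// divr_ge0// ltW.
  rewrite [leRHS](_ : _ = 12 / (al * A4) * q * (2 * k%:R)); last by ring.
  apply: le_trans h; rewrite [leRHS](_ : _ = 396 * (q * s0%:R / phi ^+ 2)); last by field; rewrite !gt_eqF.
  have : 0 <= q * s0%:R / phi ^+ 2 by rewrite divr_ge0 ?mulr_ge0 ?(ltW F0).
  lra.
apply: base_cone => //; apply: (@signal_le _ _ (2 + 24 / (al * A4))) => //.
  rewrite addr_gt0//= lerD2r lerDl divr_ge0// ltW//.
by apply: le_trans B _; rewrite mulrA ler_wpM2r// ltW.
Qed.

End Missed.

(** * Expected posterior probability of detection *)

Section Expectation.
Variable R : realType.
Variables (n p : nat) (X : 'M[R]_(n, p)) (lam : R) (b0 : 'cV[R]_p) (pr : nat -> R).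
Variables (A1 A2 A3 A4 : R).
Hypotheses (A1_gt0 : 0 < A1) (A2_gt0 : 0 < A2) (A3_gt0 : 0 < A3) (A4_gt0 : 0 < A4).
Notation L := (ln (p%:R : R)).
Hypothesis L20 : 20 <= L.
Hypothesis lam0 : 0 < lam.
Hypothesis lamN : normX X / p%:R <= lam.
Hypothesis pr0 : forall s, 0 <= pr s.
Hypothesis pr1 : \sum_(s < p.+1) pr s = 1.
Hypothesis prR : forall s, (1 <= s <= p)%N ->
  A1 * (p%:R `^ (- A3)) * pr s.-1 <= pr s /\ pr s <= A2 * (p%:R `^ (- A4)) * pr s.-1.
Hypothesis pA1 : A1^-1 <= p%:R.
Hypothesis pA2 : 4 * A2 * expR (- (A4 / 10 * L)) <= 1 / 2.
Hypothesis s00 : (0 < #|supp b0|)%N.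
Notation s0 := (#|supp b0|).
Notation al := (frac A4).

Let L3 : 3 <= L. Proof. by apply: le_trans L20; lra. Qed.
Let p0 : 0 < p%:R :> R. Proof. exact: p_gt0 L3. Qed.
Let al0 : 0 < al. Proof. exact: frac_gt0. Qed.
Let al4 : al <= 1 / 4. Proof. by have := frac_le1 A4; lra. Qed.

Definition tilt_const (Y : 'cV[R]_n) (S : {set 'I_p}) : R :=
  expR (- (lam * l1 b0)) * lik X (Y - X *m b0) 0 * expR (budget p A3 A4 s0 #|S|).

Lemma tilt_const_ge0 Y S : 0 <= tilt_const Y S.
Proof. by apply: mulr_ge0 (expR_ge0 _); apply: mulr_ge0 (expR_ge0 _) (ltW (lik_gt0 _ _ _)). Qed.

Lemma covered_tilt (Y : 'cV[R]_n) (S : {set 'I_p}) (b : 'cV[R]_p) :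
  noise_ctl X lam (Y - X *m b0) -> supp b \subset S -> covered X lam b0 A3 A4 S b ->
  slab_lik X lam Y S b <= tilt_const Y S * tilt X lam al b0 (Y - X *m b0) S b.
Proof.
move=> T1 bS cov.
have := slab_lik_le_tilt lam0 lamN L3 (ltW al0) al4 T1 s00 bS.
rewrite -ler_pdivlMr ?expR_gt0// => /le_trans; apply.
rewrite -expRN mulrC /tilt_const.
rewrite [leRHS](_ : _ = expR (- (lam * l1 b0)) * (lik X (Y - X *m b0) 0 *
   expR (budget p A3 A4 s0 #|S|) * tilt X lam al b0 (Y - X *m b0) S b)); last by ring.
apply: (ler_wpM2l (expR_ge0 _)); apply: ler_wpM2r; first by rewrite -lee_fin; exact: tilt_ge0.
by apply: ler_wpM2l; [exact: ltW (lik_gt0 _ _ _)|rewrite ler_expR].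
Qed.

Lemma expect_sums_ge (sel : {set 'I_p}) (del : R) : 0 <= del ->
  (forall Y, noise_ctl X lam (Y - X *m b0) ->
     mass X lam pr Y (fun S => ~~ (sel \subset S)) <=
     \sum_(S : {set 'I_p} | ~~ (sel \subset S)) weight pr S *
       (tilt_const Y S * fine (tiltm X lam b0 al Y S)) +
     del * mass X lam pr Y predT) ->
  1 - (p%:R^-1 + expR (8 - L / 5) + del)
  <= expect X b0 (fun Y => posterior pr lam X Y (fun b => sel \subset supp b)).
Proof.
move=> del0 H.
have prs0 : 0 < pr s0.
  by apply: (prior_gt0 pr0 A1_gt0 prR L20 pr1); rewrite -[X in (_ <= X)%N]card_ord max_card.
apply: le_trans (expect_posterior_ge lam0 lamN L3 pr0 s00 prs0 (G := budget p A3 A4 s0) del0 H).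
rewrite lerD2l lerN2 lerD2r lerD// ?sum_noise_le//.
exact: (sum_budget_le pr0 A1_gt0 A2_gt0 A3_gt0 prR L20 pA1 pA2 s00 prs0).
Qed.

Lemma expect_covered (sel : {set 'I_p}) :
  (forall (S : {set 'I_p}) b i, supp b \subset S -> i \in sel -> i \notin S ->
     covered X lam b0 A3 A4 S b) ->
  1 - (p%:R^-1 + expR (8 - L / 5))
  <= expect X b0 (fun Y => posterior pr lam X Y (fun b => sel \subset supp b)).
Proof.
move=> H; rewrite -[X in 1 - X]addr0; apply: expect_sums_ge => // Y T1.
rewrite mul0r addr0 /mass; apply: ler_sum => S /subsetPn[i isel iS].
apply: ler_wpM2l; first exact: weight_ge0.
apply: (ev_le_tilt lam0 (tilt_const_ge0 Y S)) => b bS.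
exact: covered_tilt T1 bS (H _ _ _ bS isel iS).
Qed.

(** One factor p comes from C(p,s+1) <= p C(p,s), the other A3 + 1 from one step down the prior. *)
Lemma weight_le_add (S : {set 'I_p}) i : i \notin S ->
  weight pr S <= expR ((A3 + 2) * L) * weight pr (i |: S).
Proof.
move=> iS; rewrite /weight cardsU1 iS add1n; set s := #|S|.
have sp : (s < p)%N.
  have <- : #|i |: S| = s.+1 by rewrite cardsU1 iS.
  by rewrite -[X in (_ <= X)%N]card_ord max_card.
have B0 : 0 < ('C(p, s))%:R :> R by rewrite ltr0n bin_gt0 ltnW.
have B1 : 0 < ('C(p, s.+1))%:R :> R by rewrite ltr0n bin_gt0.
have BB : ('C(p, s.+1))%:R <= p%:R * ('C(p, s))%:R :> R.
  rewrite -natrM ler_nat; apply: (@leq_trans (s.+1 * 'C(p, s.+1))%N); first by rewrite leq_pmull.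
  by rewrite mul_bin_left leq_mul// leq_subr.
have P := prior_le_down pr0 A1_gt0 prR L20 pA1 (s0 := s.+1) (s := s).
rewrite leqnSn sp subSn// subnn expr1 in P; have {}P := P isT.
rewrite ler_pdivrMr// (_ : A3 + 2 = A3 + 1 + 1); last by ring.
rewrite [(A3 + 1 + 1) * _]mulrDl mul1r expRD (expR_L L3).
apply: le_trans P _.
rewrite [leRHS](_ : _ = expR ((A3 + 1) * L) * (pr s.+1 / ('C(p, s.+1))%:R * (p%:R * ('C(p, s))%:R))); last by ring.
apply: (ler_wpM2l (expR_ge0 _)).
rewrite -mulrA ler_peMr// ler_pdivlMl// mulr1; exact: BB.
Qed.

(** The uncovered mass of S is charged to S + i with factor p^(-A3-4) p^(A3+2) = p^(-2). For each i
    a model is charged at most once, hence at most p times in all, and the total is at most 1/p of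
    the posterior mass. *)
Lemma expect_missed (sel : {set 'I_p}) :
  (forall Y (S : {set 'I_p}) b i, noise_ctl X lam (Y - X *m b0) ->
     supp b \subset S -> i \in sel -> i \notin S -> ~ covered X lam b0 A3 A4 S b ->
     ((slab_lik X lam Y S b)%:E <= (expR (- ((A3 + 4) * L)))%:E *
       \int[@lebesgue_measure R]_x (slab_lik X lam Y (i |: S) (upd b i x))%:E)%E) ->
  1 - (p%:R^-1 + expR (8 - L / 5) + p%:R^-1)
  <= expect X b0 (fun Y => posterior pr lam X Y (fun b => sel \subset supp b)).
Proof.
move=> H; apply: expect_sums_ge => [|Y T1]; first by rewrite invr_ge0 ltW.
set e := expR (- ((A3 + 4) * L)) in H.
have e0 : 0 <= e := expR_ge0 _.
have wev0 S : 0 <= weight pr S * ev X lam Y S by rewrite mulr_ge0 ?weight_ge0 ?ev_ge0.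
have key (S : {set 'I_p}) : ~~ (sel \subset S) ->
    weight pr S * ev X lam Y S <= weight pr S * (tilt_const Y S * fine (tiltm X lam b0 al Y S)) +
      e * expR ((A3 + 2) * L) * \sum_(i | i \notin S) weight pr (i |: S) * ev X lam Y (i |: S).
  move=> /subsetPn[i isel iS].
  have E : ev X lam Y S <= tilt_const Y S * fine (tiltm X lam b0 al Y S) + e * ev X lam Y (i |: S).
    apply: (ev_le_tilt_add lam0 (tilt_const_ge0 Y S) e0 iS) => b bS.
    have t0 : (0 <= (tilt_const Y S * tilt X lam al b0 (Y - X *m b0) S b)%:E)%E.
      by rewrite lee_fin; apply: mulr_ge0 (tilt_const_ge0 _ _) _; rewrite -lee_fin; exact: tilt_ge0.
    have i0 : (0 <= \int[@lebesgue_measure R]_x (slab_lik X lam Y (i |: S) (upd b i x))%:E)%E.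
      by apply: integral_ge0 => x _; rewrite lee_fin slab_lik_ge0.
    have [cov|ncov] := pselect (covered X lam b0 A3 A4 S b).
      apply: (@le_trans _ _ (tilt_const Y S * tilt X lam al b0 (Y - X *m b0) S b)%:E).
        by rewrite lee_fin; exact: covered_tilt.
      by rewrite leeDl// mule_ge0.
    apply: le_trans (H Y S b i T1 bS isel iS ncov) _.
    by rewrite leeDr.
  apply: le_trans (ler_wpM2l (weight_ge0 pr0 S) E) _.
  rewrite mulrDr lerD2l (bigD1 i)//= mulrDr.
  apply: (@le_trans _ _ (e * expR ((A3 + 2) * L) * (weight pr (i |: S) * ev X lam Y (i |: S)))).
    rewrite mulrCA -[leRHS]mulrA; apply: ler_wpM2l => //.
    rewrite [leRHS]mulrA; apply: ler_wpM2r; [exact: ev_ge0|exact: weight_le_add].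
  by rewrite lerDl mulr_ge0 ?mulr_ge0 ?expR_ge0// sumr_ge0.
apply: (@le_trans _ _ (\sum_(S : {set 'I_p} | ~~ (sel \subset S))
   (weight pr S * (tilt_const Y S * fine (tiltm X lam b0 al Y S)) +
      e * expR ((A3 + 2) * L) * \sum_(i | i \notin S) weight pr (i |: S) * ev X lam Y (i |: S)))).
  exact: ler_sum.
rewrite big_split/= lerD2l -mulr_sumr.
have ee : e * expR ((A3 + 2) * L) * p%:R = p%:R^-1.
  have pE := expR_L L3.
  transitivity (e * expR ((A3 + 2) * L) * expR L); first by rewrite pE.
  rewrite (_ : p%:R^-1 = expR (- L)); last by rewrite expRN pE.
  by rewrite /e -!expRD; congr expR; ring.
rewrite -ee [leRHS](_ : _ = e * expR ((A3 + 2) * L) * (p%:R * mass X lam pr Y predT)); last first.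
  by rewrite mulrA.
apply: ler_wpM2l; first by rewrite mulr_ge0// expR_ge0.
apply: (@le_trans _ _ (\sum_(S : {set 'I_p}) \sum_(i | i \notin S) weight pr (i |: S) * ev X lam Y (i |: S))).
  rewrite big_mkcond/=; apply: ler_sum => S _; case: ifP => // _.
  by apply: sumr_ge0.
rewrite (exchange_big_dep predT)//=.
apply: (@le_trans _ _ (\sum_(i < p) mass X lam pr Y predT)); last first.
  by rewrite sumr_const card_ord -[leLHS]mulr_natl.
apply: ler_sum => i _.
(* Adding i is injective on the models that do not contain i. *)
rewrite -(big_imset (fun S => weight pr S * ev X lam Y S)) /=; last first.
  move=> S T iS' iT' /setP ST; apply/setP => k.
  have iS : i \notin S by []. have iT : i \notin T by [].
  have := ST k; rewrite !inE; have [->|//] := eqVneq k i.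
  by rewrite (negbTE iS) (negbTE iT).
set B := (X in \sum_(j in X) _); rewrite /mass [leRHS](bigID (mem B))/=.
by rewrite lerDl sumr_ge0.
Qed.

End Expectation.

(** * Detection under small mutual coherence *)

Section Coherence.
Variable R : realType.
Variables (n p : nat) (X : 'M[R]_(n, p)) (lam : R) (b0 : 'cV[R]_p) (A3 A4 c0 d0 M : R).
Hypotheses (A3_gt0 : 0 < A3) (A4_gt0 : 0 < A4) (c0_gt0 : 0 < c0).
Notation L := (ln (p%:R : R)).
Notation N := (normX X).
Notation sL := (Num.sqrt L).
Hypothesis L20 : 20 <= L.
Hypothesis XN : 0 < N.
Hypothesis lam0 : 0 < lam.
Hypothesis lamN : N / p%:R <= lam.
Hypothesis lam2 : lam <= 2 * lambdabar X.
Notation s0 := (#|supp b0|).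
Notation al := (frac A4).
Notation phi := (phi_c X (supp b0)).
Notation psi := (psitilde A4 lam X (supp b0)).
Hypotheses (phic : c0 <= phi) (psic : c0 <= psi).
Hypothesis mcd : s0%:R * mc X <= d0.

(** The two summands come from vectors outside and inside the cone; 64 is the square of 1 + 7. *)
Definition bias_const : R :=
  Num.sqrt (signal_base A3 A4 * ((2 + 3 / A4) / c0 ^+ 2 + 64 / c0 ^+ 4)).
Definition noise_const : R := 13 / 2 + 4 / c0.
Definition resid_const : R := noise_const + bias_const * d0.

Hypothesis M4 : 4 <= M.
Hypothesis M_resid : 4 * (resid_const + 4 / c0) <= M * c0.
Hypothesis M_gain : 8 * (A3 + 5) <= (M * c0) ^+ 2.

Let L0 : 0 < L. Proof. by apply: lt_le_trans L20. Qed.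
Let L3 : 3 <= L. Proof. by apply: le_trans L20; lra. Qed.
Let p0 : 0 < p%:R :> R. Proof. exact: p_gt0 L3. Qed.
Let sL0 : 0 < sL. Proof. by rewrite sqrtr_gt0. Qed.
Let sLL : sL ^+ 2 = L. Proof. by rewrite sqr_sqrtr// ltW. Qed.
Let lam4 : lam <= 4 * N * sL. Proof. by apply: le_trans lam2 _; rewrite /lambdabar; lra. Qed.

(** Cauchy-Schwarz on the support, from expanding the sum of (k |d_j| - |d|_1)^2 with k = |supp
    d|. *)
Lemma l1_sq_le (d : 'cV[R]_p) : l1 d ^+ 2 <= #|supp d|%:R * sqnorm d.
Proof.
have E1 : l1 d = \sum_(j in supp d) `|d j ord0|.
  rewrite /l1 [RHS]big_mkcond; apply: eq_bigr => j _; rewrite inE.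
  by case: eqP => // ->; rewrite normr0.
have E2 : sqnorm d = \sum_(j in supp d) `|d j ord0| ^+ 2.
  rewrite /sqnorm [RHS]big_mkcond; apply: eq_bigr => j _; rewrite inE real_normK ?num_real//.
  by case: eqP => // ->; rewrite expr0n.
have [k0|k0] := posnP #|supp d|.
  by rewrite E1 big_pred0 ?expr0n ?k0 ?mul0r// => j; move: (card0_eq k0 j).
set k := #|supp d| in k0 *; have kp : 0 < k%:R :> R by rewrite ltr0n.
have : 0 <= \sum_(j in supp d) (k%:R * `|d j ord0| - l1 d) ^+ 2.
  by apply: sumr_ge0 => j _; exact: sqr_ge0.
rewrite (eq_bigr (fun j => k%:R ^+ 2 * `|d j ord0| ^+ 2 - 2 * k%:R * l1 d * `|d j ord0| + l1 d ^+ 2)); last first.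
  by move=> j _; ring.
have Ek : \sum_(j in supp d) l1 d ^+ 2 = k%:R * l1 d ^+ 2 by rewrite sumr_const mulr_natl.
rewrite big_split/= sumrB Ek -!mulr_sumr -E1 -E2 => H.
have {}H : 0 <= k%:R * (k%:R * sqnorm d - l1 d ^+ 2) by move: H; lra.
by move: H; rewrite pmulr_rge0// subr_ge0.
Qed.

Lemma mc_dot i j : 0 < colnorm X i -> 0 < colnorm X j -> j != i ->
  `|dot (col i X) (col j X)| <= mc X * (colnorm X i * colnorm X j).
Proof.
move=> gi gj ji; rewrite -ler_pdivrMr ?mulr_gt0//.
have -> : dot (col i X) (col j X) = \sum_k X k i * X k j.
  by apply: eq_bigr => k _; rewrite !mxE.
apply: le_trans (le_bigmax _ (fun i => \big[Num.max/0]_(j | j != i)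
     (`|\sum_k X k i * X k j| / (colnorm X i * colnorm X j))) i).
exact: (le_bigmax_cond _ (fun j => `|\sum_k X k i * X k j| / (colnorm X i * colnorm X j))).
Qed.

Section Vector.
Variables (Y : 'cV[R]_n) (S : {set 'I_p}) (b : 'cV[R]_p) (i : 'I_p).
Hypothesis T1 : noise_ctl X lam (Y - X *m b0).
Hypotheses (bS : supp b \subset S) (iS : i \notin S) (isel : i \in sel3 M X b0).
Hypothesis ncov : ~ covered X lam b0 A3 A4 S b.
Notation d := (b - b0).
Notation q := (sqnorm (X *m d)).
Notation B := `|b0 i ord0|.
Notation g := (colnorm X i).

Let Bge : M * sL / N <= B. Proof. by move: isel; rewrite inE. Qed.
Let B0 : 0 < B. Proof.
apply: lt_le_trans Bge; rewrite divr_gt0// mulr_gt0//; exact: lt_le_trans M4. Qed.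
Let i0 : i \in supp b0. Proof. by rewrite inE -normr_gt0. Qed.
Let s00 : (0 < s0)%N. Proof. by apply/card_gt0P; exists i. Qed.
Let s0R : 0 < s0%:R :> R. Proof. by rewrite ltr0n. Qed.
Let di : d i ord0 != 0. Proof. exact: missed_neq0 bS iS i0. Qed.
Let psi_col j : c0 * N <= colnorm X j.
Proof.
apply: le_trans (phitilde_col XN j (psi_arg_ge1 A4_gt0 L20 XN lam0 s00)).
by rewrite ler_wpM2r// ltW.
Qed.
Let col_gt0 j : 0 < colnorm X j. Proof. by apply: lt_le_trans (psi_col j); rewrite mulr_gt0. Qed.

(** Since b is uncovered, |Xd|^2 is below the level [signal_base] s0 L, up to phi^2 in the cone.
    There phi bounds the l1 norm; outside it d has at most (2 + 3/A4) s0 coordinates, and [phitilde]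
    with Cauchy-Schwarz applies. *)
Lemma l1_not_covered : N * l1 d <= bias_const * s0%:R * sL.
Proof.
have base0 : 0 < signal_base A3 A4 := signal_base_gt0 A3_gt0 A4_gt0.
have k0 : 0 <= (2 + 3 / A4) / c0 ^+ 2.
  apply: divr_ge0 (sqr_ge0 _); apply: addr_ge0 => //; exact: divr_ge0 (ltW A4_gt0).
have k1 : 0 <= 64 / c0 ^+ 4 by apply: divr_ge0 => //; apply: exprn_ge0; exact: ltW.
rewrite -ler_sqr ?nnegrE; last 2 first.
- by apply: mulr_ge0 (ltW XN) (l1_ge0 _).
- by apply: mulr_ge0 (ltW sL0); apply: mulr_ge0 => //; exact: sqrtr_ge0.
have bc2 : bias_const ^+ 2 = signal_base A3 A4 * ((2 + 3 / A4) / c0 ^+ 2 + 64 / c0 ^+ 4).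
  by rewrite sqr_sqrtr//; apply: mulr_ge0 (ltW base0) _; exact: addr_ge0.
rewrite [leRHS]exprMn sLL [(bias_const * _) ^+ 2]exprMn bc2.
have T0 : 0 <= signal_base A3 A4 * s0%:R ^+ 2 * L.
  by apply: mulr_ge0 (ltW L0); apply: mulr_ge0 (ltW base0) (sqr_ge0 _).
rewrite [leRHS](_ : _ = ((2 + 3 / A4) / c0 ^+ 2) * (signal_base A3 A4 * s0%:R ^+ 2 * L) +
   64 / c0 ^+ 4 * (signal_base A3 A4 * s0%:R ^+ 2 * L)); last by ring.
have f0 : 0 < phi := lt_le_trans c0_gt0 phic.
have c2 : c0 ^+ 2 <= phi ^+ 2 by rewrite lerXn2r ?nnegrE ?(ltW c0_gt0) ?(ltW f0).
have c20 : 0 < c0 ^+ 2 by rewrite exprn_gt0.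
have [cn|nc] := boolP (l1_on (~: supp b0) d <= 7 * l1_on (supp b0) d).
  have qs : q * phi ^+ 2 <= signal_base A3 A4 * (s0%:R * L).
    rewrite leNgt; apply/negP => H; apply: ncov.
    exact: (base_cone A3_gt0 A4_gt0 L20 XN lam0 lam2 bS iS i0 f0 (ltW H) cn).
  have H := phi_c_sq XN cn i0 di.
  have l8 : l1 d <= 8 * l1_on (supp b0) d by rewrite (l1_split (supp b0) d); lra.
  apply: (@le_trans _ _ (64 / c0 ^+ 4 * (signal_base A3 A4 * s0%:R ^+ 2 * L))); last first.
    by rewrite lerDr mulr_ge0.
  apply: (@le_trans _ _ ((N * (8 * l1_on (supp b0) d)) ^+ 2)).
    rewrite lerXn2r ?nnegrE; last by rewrite ler_wpM2l// ltW.
      by [].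
      by apply: mulr_ge0 (ltW XN) (l1_ge0 _).
      by apply: mulr_ge0 (ltW XN) (mulr_ge0 _ (l1_on_ge0 _ _)).
  have a4 : c0 ^+ 4 * (N * l1_on (supp b0) d) ^+ 2 <= signal_base A3 A4 * s0%:R ^+ 2 * L.
    apply: (@le_trans _ _ (c0 ^+ 2 * (phi * N * l1_on (supp b0) d) ^+ 2)).
      rewrite [leLHS](_ : _ = c0 ^+ 2 * (c0 ^+ 2 * (N * l1_on (supp b0) d) ^+ 2)); last by ring.
      rewrite [leRHS](_ : _ = c0 ^+ 2 * (phi ^+ 2 * (N * l1_on (supp b0) d) ^+ 2)); last by ring.
      by rewrite ler_wpM2l ?(ltW c20)// ler_wpM2r// sqr_ge0.
    apply: (@le_trans _ _ (phi ^+ 2 * (q * s0%:R))).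
      apply: ler_pM => //; [exact: ltW|exact: sqr_ge0].
    rewrite [leLHS](_ : _ = q * phi ^+ 2 * s0%:R); last by ring.
    apply: le_trans (ler_wpM2r (ltW s0R) qs) _.
    by rewrite le_eqVlt; apply/orP; left; apply/eqP; ring.
  rewrite mulrAC ler_pdivlMr ?exprn_gt0//.
  rewrite [leLHS](_ : _ = 64 * (c0 ^+ 4 * (N * l1_on (supp b0) d) ^+ 2)); last by ring.
  exact: ler_wpM2l.
apply: (@le_trans _ _ ((2 + 3 / A4) / c0 ^+ 2 * (signal_base A3 A4 * s0%:R ^+ 2 * L))); last first.
  by rewrite lerDl mulr_ge0.
have near : #|S|%:R - s0%:R <= 3 / A4 * s0%:R.
  rewrite leNgt; apply/negP => H; apply: ncov.
  exact: (covered_noncone_far X A3 A4_gt0 L20 lam0 nc (ltW H)).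
have qs : q <= signal_base A3 A4 * (s0%:R * L).
  rewrite leNgt; apply/negP => H; apply: ncov.
  exact: (base_noncone A3_gt0 A4_gt0 L20 lam0 S (ltW H) nc).
have ds := supp_diff_near bS near.
have pa : (2 + 3 / A4) * s0%:R <= psi_arg A4 lam X (supp b0) by exact: psi_arg_ge.
have Q := phitilde_sq XN di (le_trans ds pa).
have Q2 : c0 ^+ 2 * (N ^+ 2 * sqnorm d) <= signal_base A3 A4 * (s0%:R * L).
  apply: le_trans qs; apply: le_trans Q.
  rewrite [leRHS](_ : _ = psi ^+ 2 * (N ^+ 2 * sqnorm d)); last by ring.
  apply: ler_wpM2r; first by apply: mulr_ge0 (sqr_ge0 _) (sqnorm_ge0 _).
  by rewrite lerXn2r ?nnegrE ?(ltW c0_gt0)//; exact: le_trans (ltW c0_gt0) psic.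
rewrite mulrAC ler_pdivlMr//.
apply: (@le_trans _ _ (c0 ^+ 2 * (N ^+ 2 * (#|supp d|%:R * sqnorm d)))).
  rewrite [leLHS](_ : _ = c0 ^+ 2 * (N ^+ 2 * l1 d ^+ 2)); last by ring.
  by apply: ler_wpM2l (ltW c20) _ _ _; apply: ler_wpM2l (sqr_ge0 _) _ _ _; exact: l1_sq_le.
have -> : c0 ^+ 2 * (N ^+ 2 * (#|supp d|%:R * sqnorm d)) = #|supp d|%:R * (c0 ^+ 2 * (N ^+ 2 * sqnorm d)) by ring.
apply: (@le_trans _ _ (((2 + 3 / A4) * s0%:R) * (signal_base A3 A4 * (s0%:R * L)))).
  apply: ler_pM => //; apply: mulr_ge0 (ltW c20) _; apply: mulr_ge0 (sqr_ge0 _) (sqnorm_ge0 _).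
by rewrite le_eqVlt; apply/orP; left; apply/eqP; ring.
Qed.

(** Noise control on the one-coordinate model {i}, tested at +t and -t with t = sqrt L/|X_i|: the
    quadratic term is L/2, so 13/2 = 6 + 1/2. The term 4/c0 comes from lam <= 4 |X| sqrt L and c0
    |X| <= |X_i|. *)
Lemma noise_col : `|dot (Y - X *m b0) (col i X)| <= noise_const * g * sL.
Proof.
have g0 := col_gt0 i.
pose t := sL / g.
have t0 : 0 < t by rewrite divr_gt0.
have one (e : R) : `|e| = 1 -> e * dot (Y - X *m b0) (col i X) <= noise_const * g * sL.
  move=> e1; pose h : 'cV[R]_p := (e * t) *: delta_mx i ord0.
  have hU : supp h \subset [set i]%SET.
    apply/fintype.subsetP => k; rewrite !inE !mxE andbT; have [//|ki] := eqVneq k i.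
    by rewrite mulr0 eqxx.
  have := noise_ctl_dot lam0 lamN L3 T1 _ hU; rewrite cards1 => /(_ isT).
  rewrite /h -scalemxAr -colE dotZr sqnormZ.
  have -> : l1 ((e * t) *: delta_mx i ord0 : 'cV[R]_p) = t.
    rewrite /l1 (bigD1 i)//= big1 ?addr0; last by move=> k ki; rewrite !mxE (negbTE ki) mulr0 normr0.
    by rewrite !mxE !eqxx mulr1 normrM e1 mul1r gtr0_norm.
  have -> : (e * t) ^+ 2 * sqnorm (col i X) = L.
    rewrite -(sqnorm_norm2 (col i X)) exprMn -[e ^+ 2]real_normK ?num_real// e1 expr1n mul1r.
    by rewrite -[norm2 _]/g /t -exprMn divfK ?gt_eqF.
  move: (dot _ _) => D H.
  have {}H : t * (e * D) <= 13 / 2 * L + lam * t by move: H; lra.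
  have {}H : e * D <= (13 / 2 * L + lam * t) / t by rewrite ler_pdivlMr// mulrC.
  apply: le_trans H _; rewrite mulrDl mulfK ?gt_eqF//.
  have -> : 13 / 2 * L / t = 13 / 2 * g * sL.
    by rewrite -{1}sLL /t; field; rewrite !gt_eqF.
  rewrite /noise_const [leRHS](_ : _ = 13 / 2 * g * sL + 4 / c0 * g * sL); last by ring.
  rewrite lerD2l; apply: le_trans lam4 _.
  apply: ler_wpM2r (ltW sL0) _ _ _.
  rewrite mulrAC -mulrA; apply: ler_wpM2l => //.
  by rewrite ler_pdivlMr// mulrC; exact: psi_col.
rewrite ler_norml; apply/andP; split.
  by rewrite lerNl -mulN1r; apply: one; rewrite normrN normr1.
by rewrite -[leLHS]mul1r; apply: one; rewrite normr1.
Qed.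

(** The missed coordinate contributes b0_i |X_i|^2 to the residual; the others contribute at most
    mc(X) |X_i| |X| |d|_1. The l1 norm is of order s0 sqrt L, and s0 mc(X) <= d0 cancels s0. *)
Lemma resid_le : `|dot (Y - X *m b) (col i X) - b0 i ord0 * g ^+ 2| <= resid_const * g * sL.
Proof.
have g0 := col_gt0 i.
have -> : Y - X *m b = (Y - X *m b0) - X *m d by rewrite mulmxBr opprB addrA subrK.
rewrite dotBl [dot (X *m d) _]dotC dot_mulmxr (bigD1 i)//= (missed_coord b0 bS iS).
rewrite -sqnorm_dot -(sqnorm_norm2 (col i X)) -[norm2 _]/g.
set Z := \sum_(j | j != i) _.
have -> : dot (Y - X *m b0) (col i X) - (- b0 i ord0 * g ^+ 2 + Z) - b0 i ord0 * g ^+ 2 =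
   dot (Y - X *m b0) (col i X) - Z by ring.
apply: le_trans (ler_normB _ _) _.
rewrite /resid_const [leRHS](_ : _ = noise_const * g * sL + bias_const * d0 * g * sL); last by ring.
apply: lerD; first exact: noise_col.
have mc0 : 0 <= mc X by exact: bigmax_ge_id.
apply: (@le_trans _ _ (mc X * g * (N * l1 d))).
  apply: le_trans (ler_norm_sum _ _ _) _.
  rewrite [l1 d](bigID (fun j => j != i))/= mulrDr mulrDr -[leLHS]addr0; apply: lerD; last first.
    apply: mulr_ge0; first by rewrite mulr_ge0// ltW.
    by apply: mulr_ge0 (ltW XN) _; exact: sumr_ge0.
  rewrite !mulr_sumr; apply: ler_sum => j ji; rewrite normrM.
  apply: le_trans (ler_wpM2l (normr_ge0 _) (mc_dot g0 (col_gt0 j) ji)) _.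
  rewrite [leLHS](_ : _ = mc X * g * (colnorm X j * `|d j ord0|)); last by ring.
  apply: ler_wpM2l; first by rewrite mulr_ge0// ltW.
  by apply: ler_wpM2r => //; exact: colnorm_le.
apply: le_trans (ler_wpM2l (mulr_ge0 mc0 (ltW g0)) l1_not_covered) _.
rewrite [leLHS](_ : _ = bias_const * (s0%:R * mc X) * g * sL); last by ring.
apply: ler_wpM2r (ltW sL0) _ _ _; apply: ler_wpM2r (ltW g0) _ _ _.
by apply: ler_wpM2l; [exact: sqrtr_ge0|].
Qed.

(** For y = |x| <= B the linear minus quadratic term is at least y B g^2/2 up to the residual error.
    The error and the Laplace cost take at most half of it by [M_resid], and y >= B/2 leaves (B
    g)^2/8, at least (A3 + 5) L by [M_gain]. *)
Lemma lik_gain (x : R) : 0 <= x * b0 i ord0 -> B / 2 <= `|x| <= B ->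
  expR ((A3 + 5) * L) * lik X Y b <= lik X Y (upd b i x) * expR (- (lam * `|x|)).
Proof.
move=> xb /andP[x1 x2].
have g0 := col_gt0 i.
have M0 : 0 < M by apply: lt_le_trans M4.
have -> : upd b i x = b + x *: delta_mx i ord0.
  apply/matrixP => k c; rewrite ord1 !mxE andbT.
  have [->|ki] := eqVneq k i; last by rewrite mulr0 addr0.
  by rewrite (supp_notin bS iS) add0r mulr1.
rewrite (lik_sub X Y b (b + _)) (addrC b) addrK [lik X _ (x *: _)]lik_dot -scalemxAr -colE dotZr sqnormZ.
have -> : lik X (Y - X *m b) 0 = lik X Y b by rewrite (lik_sub X Y b b) subrr.
rewrite -(sqnorm_norm2 (col i X)) -[norm2 _]/g mulrC -[leRHS]mulrA; apply: ler_wpM2l.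
  exact: ltW (lik_gt0 _ _ _).
rewrite -expRD ler_expR.
have := resid_le; set D := dot _ _ => HD.
set y := `|x| in x1 x2 *.
have y0 : 0 <= y := normr_ge0 _.
have xB : x * b0 i ord0 = y * B by rewrite -normrM ger0_norm.
have xD : y * (B * g ^+ 2 - resid_const * g * sL) <= x * D.
  rewrite (_ : x * D = x * b0 i ord0 * g ^+ 2 + x * (D - b0 i ord0 * g ^+ 2)); last by ring.
  rewrite xB [leLHS](_ : _ = y * B * g ^+ 2 - y * (resid_const * g * sL)); last by ring.
  rewrite lerD2l lerNl.
  apply: le_trans (ler_norm _) _; rewrite normrN normrM ler_wpM2l//.
have x2E : x ^+ 2 = y ^+ 2 by rewrite real_normK ?num_real.
have lamy : lam * y <= y * (4 / c0 * g * sL).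
  rewrite mulrC; apply: ler_wpM2l => //; apply: le_trans lam4 _.
  apply: ler_wpM2r (ltW sL0) _ _ _; rewrite -mulrA; apply: ler_wpM2l => //.
  by rewrite mulrC ler_pdivlMr// mulrC; exact: psi_col.
have Bg : M * c0 * sL <= B * g.
  apply: (@le_trans _ _ (M * sL / N * (c0 * N))).
    by rewrite le_eqVlt; apply/orP; left; apply/eqP; field; rewrite gt_eqF.
  apply: ler_pM => //; first by rewrite divr_ge0 ?mulr_ge0 ?ltW.
  by rewrite mulr_ge0 ?ltW.
have B1 : 4 * (resid_const + 4 / c0) * sL <= B * g.
  by apply: le_trans Bg; apply: ler_wpM2r (ltW sL0) _ _ _.
have B2 : 8 * (A3 + 5) * L <= (B * g) ^+ 2.
  apply: (@le_trans _ _ ((M * c0) ^+ 2 * sL ^+ 2)); first by rewrite sLL ler_wpM2r// ltW.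
  rewrite -exprMn lerXn2r ?nnegrE//; first by rewrite !mulr_ge0 ?ltW.
  by rewrite mulr_ge0 ?ltW.
have e1 : y * (y * g ^+ 2) <= y * (B * g ^+ 2).
  by apply: ler_wpM2l => //; apply: ler_wpM2r => //; exact: sqr_ge0.
have e2 : y * g * (4 * (resid_const + 4 / c0) * sL) <= y * g * (B * g).
  by apply: ler_wpM2l => //; apply: mulr_ge0 (ltW g0).
have e3 : B / 2 * (B * g ^+ 2) <= y * (B * g ^+ 2).
  by apply: ler_wpM2r => //; apply: mulr_ge0 (sqr_ge0 _).
rewrite x2E; move: xD lamy e1 e2 e3 B2; move: (resid_const) (4 / c0) => r w; nra.
Qed.

(* Moving the missed coordinate [x] to within a factor 2 of [b0 i] gains [(B g)^2 / 8] in the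
   exponent, which dominates the cost of the extra slab coordinate. *)
Lemma slab_lik_add_ge :
  ((slab_lik X lam Y S b)%:E <= (expR (- ((A3 + 4) * L)))%:E *
     \int[@lebesgue_measure R]_x (slab_lik X lam Y (i |: S) (upd b i x))%:E)%E.
Proof.
pose c : R := if 0 <= b0 i ord0 then B / 2 else - B.
pose f : R -> R := \1_(`[c, c + B / 2]%classic).
have M0 : 0 < M by apply: lt_le_trans M4.
pose K := lam / 2 * expR ((A3 + 5) * L) * slab_lik X lam Y S b.
have sb0 : 0 <= slab_lik X lam Y S b := slab_lik_ge0 X lam0 Y S b.
have K0 : 0 <= K.
  by apply: mulr_ge0 sb0; apply: mulr_ge0 (expR_ge0 _); rewrite divr_ge0// ltW.
have If : (\int[@lebesgue_measure R]_x (f x)%:E = (B / 2)%:E)%E.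
  rewrite integral_indic// setIT.
  transitivity (@lebesgue_measure R [set` `[c, c + B / 2]]); first by [].
  rewrite lebesgue_measure_itv/= lte_fin ltrDl divr_gt0//.
  by rewrite -EFinB addrAC subrr add0r.
have f0 x : 0 <= f x by rewrite /f indicE.
have low : ((K * (B / 2))%:E <= \int[@lebesgue_measure R]_x (slab_lik X lam Y (i |: S) (upd b i x))%:E)%E.
  have -> : (K * (B / 2))%:E = (\int[@lebesgue_measure R]_x (K * f x)%:E)%E.
    under eq_integral do rewrite EFinM.
    rewrite ge0_integralZl ?lee_fin//.
    - by rewrite If.
    - by apply/measurable_EFinP; exact: measurable_indic.
    - by move=> x _; rewrite lee_fin.
  apply: le_integralT => x; rewrite lee_fin; first exact: mulr_ge0.
  have [xI|xI] := boolP (x \in `[c, c + B / 2]); last first.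
    by rewrite /f indicE memNset ?mulr0 ?slab_lik_ge0//; exact/negP.
  rewrite /f indicE mem_set// mulr1.
  have [xb xB] : 0 <= x * b0 i ord0 /\ B / 2 <= `|x| <= B.
    move: xI; rewrite in_itv/= /c; case: (lerP 0 (b0 i ord0)) => [b00|b00] /andP[h1 h2].
      have E : B = b0 i ord0 by rewrite ger0_norm.
      have x0 : 0 <= x by apply: le_trans h1; rewrite divr_ge0.
      by rewrite mulr_ge0// (ger0_norm x0) h1; split=> //; move: h2; lra.
    have E : B = - b0 i ord0 by rewrite ltr0_norm.
    have x0 : x <= 0 by move: h2 B0; lra.
    by rewrite mulr_le0 ?(ltW b00)// (ler0_norm x0); split=> //; move: h1 h2; lra.
  rewrite /slab_lik big_setU1//=.
  have -> : \prod_(j in S) lap lam (upd b i x j ord0) = \prod_(j in S) lap lam (b j ord0).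
    apply: eq_bigr => j jS; rewrite mxE ifN//; apply: contraNneq iS => <- //.
  rewrite mxE eqxx /lap.
  have P0 : 0 <= \prod_(j in S) lap lam (b j ord0) by apply: prodr_ge0 => j _; exact: lap_ge0.
  have := ler_wpM2r (mulr_ge0 (divr_ge0 (ltW lam0) (ler0n R 2)) P0) (lik_gain xb xB).
  rewrite /K /slab_lik; set P := \prod_(j in S) _.
  rewrite [leRHS](_ : _ = lik X Y (upd b i x) * (lam / 2 * expR (- (lam * `|x|)) * P)); last by ring.
  by apply: le_trans; rewrite le_eqVlt; apply/orP; left; apply/eqP; ring.
apply: (@le_trans _ _ ((expR (- ((A3 + 4) * L)))%:E * (K * (B / 2))%:E)%E); last first.
  by apply: lee_wpmul2l => //; rewrite lee_fin expR_ge0.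
rewrite -EFinM lee_fin /K.
have eE : expR (- ((A3 + 4) * L)) * expR ((A3 + 5) * L) = p%:R.
  by rewrite -expRD -[RHS](expR_L L3); congr expR; ring.
rewrite [leRHS](_ : _ = (expR (- ((A3 + 4) * L)) * expR ((A3 + 5) * L)) * (lam * B) / 4 * slab_lik X lam Y S b); last by field.
rewrite eE; apply: ler_peMl => //.
have s1 : 1 <= sL.
  by have := ler_wsqrtr (_ : 1 <= L); rewrite sqrtr1; apply; apply: le_trans L20; lra.
(* The slab density lam/2 times the interval length B/2 is at least 1/p; this lowers the gain from
   A3 + 5 to A3 + 4. *)
have lB : 4 / p%:R <= lam * B.
  apply: (@le_trans _ _ (N / p%:R * (M * sL / N))).
    rewrite [leRHS](_ : _ = M * sL / p%:R); last by field; rewrite !gt_eqF.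
    rewrite ler_wpM2r ?invr_ge0 ?(ltW p0)//.
    by rewrite -[4]mulr1; apply: ler_pM.
  by apply: ler_pM => //; rewrite divr_ge0 ?mulr_ge0 ?ltW.
by move: lB; rewrite ler_pdivrMr// => lB; rewrite ler_pdivlMr// mul1r mulrC.
Qed.

End Vector.
End Coherence.

(** * Large dimensions and the zero signal *)

Section Asymptotics.
Variable R : realType.

Lemma large_dimension (A1 A2 A4 e : R) : 0 < A1 -> 0 < A2 -> 0 < A4 -> 0 < e ->
  exists m : nat, forall p : nat, (m <= p)%N ->
  [/\ 20 <= ln (p%:R : R), A1^-1 <= p%:R,
      4 * A2 * expR (- (A4 / 10 * ln (p%:R : R))) <= 1 / 2 &
      p%:R^-1 + expR (8 - ln (p%:R : R) / 5) + p%:R^-1 <= e].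
Proof.
move=> A10 A20 A40 e0.
have e30 : 0 < e / 3 by rewrite divr_gt0.
(* Solved for p: p >= r2 gives 8 A2 <= p^(A4/10), and p >= r3 gives e^(8 - L/5) <= e/3. *)
pose r2 := expR (ln (8 * A2) * (10 / A4)); pose r3 := expR (40 - 5 * ln (e / 3)).
pose r := expR 20 + A1^-1 + r2 + 3 / e + r3.
have r20 : 0 < r2 := expR_gt0 _.
have r30 : 0 < r3 := expR_gt0 _.
have er0 : 0 < 3 / e by rewrite divr_gt0.
have E0 : 0 < expR 20 :> R := expR_gt0 _.
have A1V : 0 < A1^-1 by rewrite invr_gt0.
exists (Num.bound r) => p pr.
have rp : r <= p%:R.
  have r0 : 0 <= r by rewrite /r; lra.
  by apply: le_trans (ltW (archi_boundP r0)) _; rewrite ler_nat.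
have lnp (x : R) : expR x <= p%:R -> x <= ln (p%:R : R).
  move=> xp; rewrite -[leLHS](@expRK R) ler_ln// posrE; first exact: expR_gt0.
  by apply: lt_le_trans xp; exact: expR_gt0.
have p0 : 0 < p%:R :> R by apply: lt_le_trans rp; rewrite /r; lra.
split.
- by apply: lnp; move: rp; rewrite /r; lra.
- by move: rp; rewrite /r; lra.
- have : ln (8 * A2) * (10 / A4) <= ln (p%:R : R) by apply: lnp; move: rp; rewrite /r -/r2; lra.
  have A104 : 0 <= A4 / 10 by rewrite divr_ge0// ltW.
  move=> /(ler_wpM2l A104) H.
  have {}H : 8 * A2 <= expR (A4 / 10 * ln (p%:R : R)).
    rewrite -[8 * A2]lnK ?posrE ?mulr_gt0// ler_expR.
    by apply: le_trans H; rewrite le_eqVlt; apply/orP; left; apply/eqP; field; rewrite gt_eqF.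
  by rewrite expRN ler_pdivrMr ?expR_gt0//; lra.
- have h1 : p%:R^-1 <= e / 3.
    rewrite -[e / 3]invrK lef_pV2 ?posrE ?invr_gt0// invf_div.
    by move: rp; rewrite /r; lra.
  have h2 : expR (8 - ln (p%:R : R) / 5) <= e / 3.
    rewrite -[leRHS](@lnK R)// ler_expR.
    have : 40 - 5 * ln (e / 3) <= ln (p%:R : R) by apply: lnp; move: rp; rewrite /r -/r3; lra.
    lra.
  by move: h1 h2; lra.
Qed.

(** This serves b0 = 0, since the other bounds assume a nonempty S0. The event is certain, so only a
    positive denominator is required, and the empty model provides it. *)
Lemma expect_set0 (n p : nat) (X : 'M[R]_(n, p)) (lam : R) (b0 : 'cV[R]_p) (pr : nat -> R)
    (sel : {set 'I_p}) :
  0 < lam -> (forall s, 0 <= pr s) -> 0 < pr 0%N -> sel = finset.set0 ->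
  1 <= expect X b0 (fun Y => posterior pr lam X Y (fun b => sel \subset supp b)).
Proof.
move=> lam0 pr0 pr00 ->.
rewrite -[X in X <= _]subr0; apply: (@expect_ge _ _ _ _ _ _ (fun=> 0%E)).
- by move=> y; exact: posterior_bounds.
- exact: posterior_mf1.
- by [].
- by move=> d T h ch; exact: measurable_cst.
- move=> Y; rewrite adde0 lee_fin -[leRHS]addr0; apply: posterior_ge => //.
    have w0 : 0 < weight pr (finset.set0 : {set 'I_p}) by rewrite /weight cards0 bin0 divr1.
    rewrite /mass (bigD1 (finset.set0 : {set 'I_p}))//=; apply: ltr_wpDr.
      by apply: sumr_ge0 => S _; rewrite mulr_ge0 ?weight_ge0 ?ev_ge0.
    apply: mulr_gt0 => //; rewrite -lte_fin evE// /evidence enum_set0/= lte_fin /slab_lik.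
    by rewrite big_set0 mulr1 lik_gt0.
  by rewrite mul0r /mass big_pred0// => S; rewrite finset.sub0set.
- by rewrite (eq_iint (G := fun=> 0%E)) ?iint0// => y _; rewrite mul0e.
Qed.

Lemma sq_ge_self (c M : R) : 0 <= c -> 1 + c <= M -> c <= M ^+ 2.
Proof.
move=> c0 cM; have : 0 <= (M - 1) * M by apply: mulr_ge0; lra.
by rewrite expr2; lra.
Qed.

End Asymptotics.

Theorem theorem5 (R : realType) (n p : nat -> nat)
  (X : forall k, 'M[R]_(n k, p k)) (lam : nat -> R) (pi : nat -> nat -> R)
  (A1 A2 A3 A4 : R) :
  (forall N : nat, \forall k \near \oo, (N <= n k)%N /\ (N <= p k)%N) ->
  (forall k, 0 < lam k) ->
  (forall k, normX (X k) / (p k)%:R <= lam k /\ lam k <= 2 * lambdabar (X k)) ->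
  (forall k s, 0 <= pi k s) ->
  (forall k, \sum_(s < (p k).+1) pi k s = 1) ->
  0 < A1 -> 0 < A2 -> 0 < A3 -> 0 < A4 ->
  (forall k s, (1 <= s <= p k)%N ->
     A1 * ((p k)%:R `^ (- A3)) * pi k s.-1 <= pi k s /\
     pi k s <= A2 * ((p k)%:R `^ (- A4)) * pi k s.-1) ->
  [/\ exists M0 : R, forall M, M0 <= M ->
        inf_to_one (fun k b0 => expect (X k) b0 (fun Y =>
            posterior (pi k) (lam k) (X k) Y
              (fun b => sel1 M A4 (lam k) (X k) b0 \subset supp b)))
          (fun k => [set: 'cV[R]_(p k)]),
      exists M0 : R, forall M, M0 <= M ->
        inf_to_one (fun k b0 => expect (X k) b0 (fun Y =>
            posterior (pi k) (lam k) (X k) Y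
              (fun b => sel2 M A4 (lam k) (X k) b0 \subset supp b)))
          (fun k => [set: 'cV[R]_(p k)]) &
      forall c0 : R, 0 < c0 ->
      forall d0 : R, 0 < d0 -> d0 <= c0 ^+ 2 * (1 + 2 / A4)^-1 / 8 ->
      forall s : nat -> R,
        (fun k => lam k * s k * Num.sqrt (ln (p k)%:R) / normX (X k)) @ \oo --> (0 : R) ->
      exists M0 : R, forall M, M0 <= M ->
        inf_to_one (fun k b0 => expect (X k) b0 (fun Y =>
            posterior (pi k) (lam k) (X k) Y
              (fun b => sel3 M (X k) b0 \subset supp b)))
          (fun k b0 => [/\ c0 <= phi_c (X k) (supp b0),
                           c0 <= psitilde A4 (lam k) (X k) (supp b0),
                           #|supp b0|%:R <= s k &
                           #|supp b0|%:R * mc (X k) <= d0])].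
Proof.
move=> pinf lam0 lamR pr0 pr1 A10 A20 A30 A40 prR.
(* If |X| were 0, then [lambdabar] would be 0, against 0 < lam <= 2 [lambdabar]. *)
have XN k : 0 < normX (X k).
  rewrite lt_def normX_ge0 andbT; apply/eqP => N0.
  have [_] := lamR k; rewrite /lambdabar N0 mulr0 mul0r mulr0.
  by rewrite leNgt lam0.
(* The threshold depends on p alone, which makes the convergence uniform in b0. *)
have eventually e (Q : nat -> Prop) : 0 < e ->
    (forall k, [/\ 20 <= ln ((p k)%:R : R), A1^-1 <= (p k)%:R,
      4 * A2 * expR (- (A4 / 10 * ln ((p k)%:R : R))) <= 1 / 2 &
      (p k)%:R^-1 + expR (8 - ln ((p k)%:R : R) / 5) + (p k)%:R^-1 <= e] -> Q k) ->
    \forall k \near \oo, Q k.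
  move=> e0 H; have [m Hm] := large_dimension A10 A20 A40 e0.
  by apply: filterS (pinf m) => k [_ /Hm]; exact: H.
have empty k b0 e (sel : {set 'I_(p k)}) : 20 <= ln ((p k)%:R : R) -> 0 < e -> sel = finset.set0 ->
    1 - e <= expect (X k) b0 (fun Y => posterior (pi k) (lam k) (X k) Y (fun b => sel \subset supp b)).
  move=> L20 e0 s0; apply: (@le_trans _ _ 1); first by rewrite gerBl ltW.
  by apply: expect_set0 => //; exact: (prior_gt0 (pr0 k) A10 (prR k) L20 (pr1 k)).
have C0 : 0 < signal_const A3 A4.
  rewrite mulr_gt0 ?signal_base_gt0//; apply: addr_gt0; first by rewrite addr_gt0// divr_gt0.
  by rewrite divr_gt0// mulr_gt0// frac_gt0.
have sub_empty k (b0 : 'cV[R]_(p k)) (sel : {set 'I_(p k)}) : sel \subset supp b0 ->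
    #|supp b0| = 0%N -> sel = finset.set0.
  by move=> ss /eqP; rewrite cards_eq0 => /eqP s0; apply/eqP; rewrite -finset.subset0 -s0.
have pV k : 0 <= (p k)%:R^-1 :> R by rewrite invr_ge0.
split.
- exists (1 + signal_const A3 A4) => M MM e e0.
  have M2 := sq_ge_self (ltW C0) MM.
  have M0 : 0 < M by move: MM C0; lra.
  apply: (eventually e) => // k [L20 pA1 pA2 pe] b0 _.
  have [s0|s0] := posnP #|supp b0|.
    apply: empty => //; apply: (sub_empty _ b0) => //.
    by apply/fintype.subsetP => i; rewrite inE => /andP[].
  apply: le_trans (expect_covered A10 A20 A30 A40 L20 (lam0 k) (lamR k).1 (pr0 k) (pr1 k) (prR k)
    pA1 pA2 s0 _); first by move: (pV k) pe; lra.
  move=> S b i bS isel iS.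
  have i0 : i \in supp b0 by move: isel; rewrite inE => /andP[].
  exact: (covered_sel1 A30 A40 L20 (XN k) (lam0 k) (lamR k).2 M2 bS iS i0 isel M0).
- exists (1 + signal_const A3 A4) => M MM e e0.
  have M2 := sq_ge_self (ltW C0) MM.
  have M0 : 0 < M by move: MM C0; lra.
  apply: (eventually e) => // k [L20 pA1 pA2 pe] b0 _.
  have [s0|s0] := posnP #|supp b0|.
    apply: empty => //; apply: (sub_empty _ b0) => //.
    by apply/fintype.subsetP => i; rewrite inE => /andP[].
  apply: le_trans (expect_covered A10 A20 A30 A40 L20 (lam0 k) (lamR k).1 (pr0 k) (pr1 k) (prR k)
    pA1 pA2 s0 _); first by move: (pV k) pe; lra.
  move=> S b i bS isel iS.
  have i0 : i \in supp b0 by move: isel; rewrite inE => /andP[].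
  exact: (covered_sel2 A30 A40 L20 (XN k) (lam0 k) (lamR k).2 M2 bS iS i0 isel M0).
- move=> c0 c00 d0 d00 _ s _.
  pose K := 4 * (resid_const A3 A4 c0 d0 + 4 / c0); pose K' := 8 * (A3 + 5).
  have K0 : 0 <= K.
    rewrite mulr_ge0// addr_ge0//; last by rewrite divr_ge0// ltW.
    rewrite addr_ge0//; first by rewrite addr_ge0// divr_ge0// ltW.
    by rewrite mulr_ge0 ?sqrtr_ge0// ltW.
  have K0' : 0 <= K' by rewrite mulr_ge0// addr_ge0// ltW.
  (* This choice gives M c0 >= 1 + K + K', so M c0 >= K and (M c0)^2 >= K'. *)
  exists (4 + (1 + K + K') / c0) => M MM e e0.
  have Kc0 : 0 <= (1 + K + K') / c0 by rewrite divr_ge0 ?(ltW c00)// !addr_ge0.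
  have M4 : 4 <= M by move: MM Kc0; lra.
  have Mc : 1 + K + K' <= M * c0 by rewrite -ler_pdivrMr//; move: MM; lra.
  apply: (eventually e) => // k [L20 pA1 pA2 pe] b0 [phic psic _ mcd].
  have [s0|s0] := posnP #|supp b0|.
    apply: empty => //; apply: (sub_empty _ b0) => //.
    (* The threshold is positive, so no zero coordinate is selected. *)
    apply/fintype.subsetP => i; rewrite !inE; apply: contraTneq => ->.
    rewrite normr0 -ltNge divr_gt0// mulr_gt0 ?sqrtr_gt0//; first exact: lt_le_trans M4.
    exact: lt_le_trans L20.
  apply: le_trans (expect_missed A10 A20 A30 A40 L20 (lam0 k) (lamR k).1 (pr0 k) (pr1 k) (prR k)
    pA1 pA2 s0 _); first by rewrite lerD2l lerN2.
  move=> Y S b i T1 bS isel iS ncov.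
  apply: (slab_lik_add_ge A30 A40 c00 L20 (XN k) (lam0 k) (lamR k).1 (lamR k).2 phic psic mcd
    M4 _ _ T1 bS iS isel ncov).
    by apply: le_trans Mc; rewrite -/K; move: K0'; lra.
  by apply: sq_ge_self => //; apply: le_trans Mc; rewrite -/K'; move: K0; lra.
Qed.
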